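(* Assume $\mathbb{E}(J) > 0$ and $J \in \{-j^*, \ldots, 0, 1\}$ almost surely for some $j^* \in \mathbb{N}$. Let $a \geq 0$ be any integer. Then under $\mathbb{P}$, the successive excursions of $\pi \circ X$ above level $a$ are i.i.d., with common distribution the law of the first excursion of $\pi \circ X$ away from $0$ under $\mathbb{P}_{\delta_1}$.
   Context: The model has two parameters: $\lambda > 0$ and a real-valued random variable $J$. Let $\mathcal{M}$ be the set of finite positive measures on $[0,\infty)$, $\mathbf{z}$ the zero measure, $\delta_a$ the Dirac mass at $a$, and $\mathcal{M}_F \subset \mathcal{M}$ the set of finite point measures (finite support, integer masses). For $\nu \in \mathcal{M}$ let $\pi(\nu) = \sup\{y \geq 0 : \nu([y,\infty)) > 0\}$ (the price), with $\pi(\mathbf{z}) = 0$. $X$ is the canonical càdlàg $\mathcal{M}$-valued process and $\pi\circ X = (\pi(X_t), t\ge 0)$. For $\chi \in \mathcal{M}_F$, $\mathbb{P}_\chi$ is the law of the $\mathcal{M}_F$-valued Markov process started at $\chi$ with generator $$\omega(f)(\nu) = \lambda\, \mathbb{E}\big[ f(\nu + \delta_{(\pi(\nu)+J)^+}) - f(\nu)\big] + \lambda \big[ f(\nu - \delta_{\pi(\nu)}) - f(\nu)\big] \mathbf{1}_{\{\nu \neq \mathbf{z}\}},$$ where $a^+ = \max(0,a)$; $\mathbb{P} = \mathbb{P}_{\mathbf{z}}$. Let $\mathcal{D}$ be the set of real-valued càdlàg functions on $[0,\infty)$, and $\zeta(f) = \inf\{t > 0 : f(t) = 0\}$ for $f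 \in \mathcal{D}$. An excursion (away from $0$) is a function $f \in \mathcal{D}$ with $0 < \zeta(f) < +\infty$ and $f(\zeta(f)+t) = 0$ for all $t \geq 0$; $\mathcal{E}$ denotes the set of excursions. For $a \geq 0$ and $g \leq d$, the function $e = (f((g+t)\wedge d) - a, t \geq 0)$ is an excursion of $f$ above level $a$ (with endpoints $g$ and $d$) if $e \in \mathcal{E}$, $e_t \geq 0$ for all $t \geq 0$, and $f(g-) \leq a$. Under $\mathbb{P}_{\delta_1}$, the first excursion of $\pi\circ X$ away from $0$ is the path of $\pi\circ X$, started at $1$, stopped when it first hits $0$. *)

(* Defs.v *)
From HB Require Import structures.
From mathcomp Require Import all_boot all_order all_algebra finmap multiset.
From mathcomp Require Import all_classical all_reals all_analysis.
From mathcomp Require Import measurable_realfun.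

Set Implicit Arguments.
Unset Strict Implicit.
Unset Printing Implicit Defensive.

Import Order.TTheory GRing.Theory Num.Theory.
Import numFieldNormedType.Exports.

Local Open Scope classical_set_scope.
Local Open Scope ring_scope.

(* Time is indexed by [R]; only times [t >= 0] are ever constrained. *)

Section PointMeasures.
Variable R : realType.

(* A finite point measure on [0, +oo[ is a finitely supported, nat-valued mass
   function: [{mset K}] is [{fsfun K -> nat with 0}]. *)
Definition point_measure := multiset {nonneg R}.

HB.instance Definition _ := Choice.on point_measure.
HB.instance Definition _ := isPointed.Build point_measure mset0.

Definition pm_measure (nu : point_measure) (A : set R) : \bar R :=
  (\sum_(x <- finsupp nu) (nu x)%:R%:E * \d_(x%:num) A)%E.

Section IsMeasure.
Variable nu : point_measure.

Let term (k : nat) : {measure set R -> \bar R} :=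
  let x := nth 0%:nng (finsupp nu) k in mscale ((nu x)%:R)%:nng \d_(x%:num).

Let pm_measureE : pm_measure nu = msum term (size (finsupp nu)).
Proof. by apply/funext => A; rewrite /pm_measure (big_nth 0%:nng) big_mkord. Qed.

Let pm_measure0 : pm_measure nu set0 = 0%E.
Proof. by rewrite pm_measureE measure0. Qed.

Let pm_measure_ge0 A : (0 <= pm_measure nu A)%E.
Proof. by rewrite pm_measureE measure_ge0. Qed.

Let pm_measure_sigma_additive : semi_sigma_additive (pm_measure nu).
Proof. by rewrite pm_measureE; exact: measure_semi_sigma_additive. Qed.

HB.instance Definition _ := isMeasure.Build _ _ _ (pm_measure nu)
  pm_measure0 pm_measure_ge0 pm_measure_sigma_additive.
End IsMeasure.

(* The sigma-algebra generated by the evaluations nu |-> nu(A), A Borel; it is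
   the Borel sigma-algebra of the weak topology. *)
Definition pm_evals : set (set point_measure) :=
  \bigcup_(A in (measurable : set (set R)))
    preimage_set_system setT (pm_measure ^~ A) measurable.

Definition pmT := g_sigma_algebraType pm_evals.

Definition price (nu : point_measure) : R :=
  sup [set y : R | 0 <= y /\ (0 < pm_measure nu `[y, +oo[%classic)%E].

Lemma price_ge0 (nu : point_measure) : 0 <= price nu.
Proof.
have [h|h] := pselect (has_sup [set y : R |
  0 <= y /\ (0 < pm_measure nu `[y, +oo[%classic)%E]); last first.
  by rewrite /price sup_out.
have [y [y0 hy]] := h.1.
by apply: (le_trans y0); apply: ub_le_sup => //; exact: h.2.
Qed.

Definition price_nng (nu : point_measure) : {nonneg R} := NngNum (price_ge0 nu).

Lemma pos_part_ge0 (x : R) : 0 <= Num.max 0 x.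
Proof. by rewrite le_max lexx. Qed.

Definition pos_part (x : R) : {nonneg R} := NngNum (pos_part_ge0 x).

Definition add_order (nu : point_measure) (x : {nonneg R}) : point_measure :=
  msetD nu (msetn 1%N x).

Definition remove_order (nu : point_measure) (x : {nonneg R}) : point_measure :=
  msetB nu (msetn 1%N x).

(* Weak convergence of finite measures on [0, +oo[; every bounded continuous
   function on [0, +oo[ is the restriction of one on R. *)
Definition weak_cvg (F : set_system R) (x : R -> point_measure)
    (nu : point_measure) : Prop :=
  forall phi : R -> R, continuous phi -> (exists M, forall y, `|phi y| <= M) ->
    (fun t => \int[pm_measure (x t)]_y phi y) @ F --> \int[pm_measure nu]_y phi y.

(* The integer-valued measures are weakly closed among the finite measures, so
   that left limits may be sought among point measures. *)
Definition pm_cadlag (x : R -> point_measure) : Prop :=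
  (forall t, 0 <= t -> weak_cvg t^'+ x (x t)) /\
  (forall t, 0 < t -> exists nu, weak_cvg t^'- x nu).

End PointMeasures.

Section OrderBook.
Context (R : realType) (lam : R).
Context (dJ : measure_display) (TJ : measurableType dJ) (PJ : probability TJ R).
Variable J : {RV PJ >-> R}.

Definition book_generator (f : pmT R -> R) (nu : pmT R) : R :=
  lam * fine 'E_PJ[fun w => (f (add_order nu (pos_part (price nu + J w))) - f nu)%R]%E
  + lam * (f (remove_order nu (price_nng nu)) - f nu) * (nu != mset0)%:R.

(* The generator is bounded for the sup norm on bounded measurable functions; it
   is the derivative at 0 of the transition semigroup for this norm. *)
Definition has_book_generator (kappa : R -> R.-pker pmT R ~> pmT R) : Prop :=
  forall f : pmT R -> R, measurable_fun setT f ->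
    (exists M, forall nu, `|f nu| <= M) ->
    forall eps : R, 0 < eps -> \forall t \near 0^'+, forall nu : pmT R,
      `| (\int[kappa t nu]_mu f mu - f nu) / t - book_generator f nu | <= eps.

Definition transition_semigroup (kappa : R -> R.-pker pmT R ~> pmT R) : Prop :=
  (forall nu (B : set (pmT R)), measurable B -> kappa 0 nu B = \d_nu B) /\
  (forall s t, 0 <= s -> 0 <= t -> forall nu (B : set (pmT R)), measurable B ->
     kappa (s + t) nu B = (\int[kappa s nu]_mu kappa t mu B)%E).

Context (d : measure_display) (T : measurableType d) (P : probability T R).

Definition history (X : R -> T -> pmT R) (t : R) : set (set T) :=
  <<s [set A | exists (s : R) (B : set (pmT R)),
        [/\ 0 <= s <= t, measurable B & A = X s @^-1` B]] >>.

Definition markov_with (kappa : R -> R.-pker pmT R ~> pmT R)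
    (X : R -> T -> pmT R) : Prop :=
  forall s t, 0 <= s -> 0 <= t ->
  forall A, history X t A -> forall B : set (pmT R), measurable B ->
    P (A `&` X (t + s) @^-1` B) = (\int[P]_(w in A) kappa s (X t w) B)%E.

(* Under P, X has the law P_chi of the Markov process started at chi. *)
Definition order_book (chi : pmT R) (X : R -> T -> pmT R) : Prop :=
  [/\ forall t, 0 <= t -> measurable_fun setT (X t),
      forall w, pm_cadlag (X ^~ w),
      {ae P, forall w, X 0 w = chi} &
      exists kappa : R -> R.-pker pmT R ~> pmT R,
        [/\ transition_semigroup kappa, has_book_generator kappa
          & markov_with kappa X]].

End OrderBook.

Definition price_path (R : realType) (T : Type) (X : R -> T -> pmT R) (w : T)
  : R -> R := fun t => price (X t w).

Section Excursions.
Variable R : realType.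
Implicit Types (f e : R -> R) (a g d : R).

Definition cadlag f : Prop :=
  (forall t, 0 <= t -> f @ t^'+ --> f t) /\
  (forall t, 0 < t -> cvg (f @ t^'-)).

Definition zeta f : \bar R := ereal_inf [set t%:E | t in [set t | 0 < t /\ f t = 0]].

Definition excursion e : Prop :=
  [/\ cadlag e, (0 < zeta e < +oo)%E &
      forall t, 0 <= t -> e (fine (zeta e) + t) = 0].

(* f(0-) = f(0) by convention. *)
Definition left_limit f g : R := if g == 0 then f 0 else lim (f @ g^'-).

Definition excursion_above f a g d e : Prop :=
  0 <= g <= d /\
  (forall t, 0 <= t -> e t = f (Num.min (g + t) d) - a) /\
  excursion e /\
  (forall t, 0 <= t -> 0 <= e t) /\
  left_limit f g <= a.

(* [e] lists all the excursions of [f] above [a] by increasing left endpoint.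
   The right endpoint need not be unique, as [f] may stay at [a] after the
   excursion, but the left endpoint determines the excursion. *)
Definition successive_excursions f a (e : nat -> R -> R) : Prop :=
  exists g : nat -> R,
    [/\ forall n, g n < g n.+1,
        forall n, exists d, excursion_above f a (g n) d (e n) &
        forall g' d' e', excursion_above f a g' d' e' -> exists n, g' = g n].

Definition stop_at_zero f : R -> R := fun t => f (fine (Order.min t%:E (zeta f))).

(* On cadlag paths this generates the Borel sigma-algebra of the Skorokhod
   topology. *)
Definition coordinate_events : set (set (R -> R)) :=
  [set C | exists (t : R) (B : set R),
    [/\ 0 <= t, measurable B & C = [set f | B (f t)]]].

Definition pathT := g_sigma_algebraType coordinate_events.

End Excursions.

Section RandomPaths.
Context (R : realType) (d : measure_display) (T : measurableType d).
Variable P : probability T R.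

Definition random_path_with_law (Z : T -> pathT R) (mu : probability (pathT R) R)
  : Prop :=
  measurable_fun setT Z /\
  forall C : set (pathT R), measurable C -> P (Z @^-1` C) = mu C.

(* The law of a random path which is only known to have a measurable version. *)
Definition has_law (W : T -> R -> R) (mu : probability (pathT R) R) : Prop :=
  exists Z : T -> pathT R,
    {ae P, forall w, forall t, 0 <= t -> Z w t = W w t} /\
    random_path_with_law Z mu.

Definition independent (Y : nat -> T -> pathT R) : Prop :=
  forall (F : {fset nat}) (C : nat -> set (pathT R)),
    (forall n, measurable (C n)) ->
    P (\bigcap_(n in [set` F]) (Y n @^-1` C n)) =
      (\prod_(n <- F) P (Y n @^-1` C n))%E.

Definition iid_with_law (Y : nat -> T -> pathT R) (mu : probability (pathT R) R)
  : Prop :=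
  (forall n, random_path_with_law (Y n) mu) /\ independent Y.

End RandomPaths.

(* Main.v *)
Require Import Defs.
From HB Require Import structures.
From mathcomp Require Import all_boot all_order all_algebra finmap multiset.
From mathcomp Require Import all_classical all_reals all_analysis.
From mathcomp Require Import measurable_realfun.
From mathcomp Require Import ring lra zify.

Set Implicit Arguments.
Unset Strict Implicit.
Unset Printing Implicit Defensive.

Import Order.TTheory GRing.Theory Num.Theory.
Import numFieldNormedType.Exports.

Local Open Scope classical_set_scope.
Local Open Scope ring_scope.

(* The chain with transition operator 1 + h * generator approximates the book
   observed at times h, 2h, ...: bounding the kernel semigroup gives an error
   O(h^2) per step, hence O(N h^2) over N steps, which vanishes for
   h = 1/(m+1)^2 and N = (m+1)^3. The chain is studied by hand. When the price
   jumps above a, exactly one order lies above a, at a + 1; until the price comes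
   back to a, the orders above a, shifted by -a, evolve like those at positive
   prices of a book started from one order at 1, and no order at or below a is
   removed. So, for the chain, the probability that n excursions above a are
   completed and lie in C_1, ..., C_n is at most the product of the probabilities
   that the first excursion from 1 lies in C_i. The price leaves [0, a] because
   J = 1 has positive probability, and comes back to it because the number of
   orders performs a symmetric random walk. Fatou's lemma passes the inequality
   to the process for events C_i depending on finitely many coordinates;
   replacing C_i by its complement turns it into an equality, and a pi-lambda
   argument reaches all the events of the path space. *)

(** * Euler chains on books of natural prices *)

(** The book is known only through a transition semigroup and its generator: no jump times are at
    hand, and excursions begin and end at random times. A chain on a fixed mesh replaces the strong
    Markov property by an induction on the number of remaining steps. That induction gives only an
    inequality, because each factor of the product is granted the whole horizon, whereas the
    excursions of the chain have to share it. The inequality suffices because the excursions are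
    almost surely finite: the bounds for an event and for its complement then add up to a total
    already known. Two facts about the paths are needed besides. An excursion must end at the value
    0, so the price has to return to [a] exactly; since J is at most 1 and the book starts empty,
    every level from 1 to the price is occupied, and removing the best order lowers the price by at
    most one. The price must also be a step function, which comes from integer masses: weak
    convergence of books with integer prices forces eventual equality. *)

Definition top (s : seq nat) : nat := \max_(x <- s) x.

Lemma top_cons x s : top (x :: s) = maxn x (top s).
Proof. by rewrite /top big_cons. Qed.

Lemma leq_top s x : x \in s -> (x <= top s)%N.
Proof. by move=> xs; rewrite /top (big_rem x xs) /= leq_maxl. Qed.

Lemma top_mem s : s != [::] -> top s \in s.
Proof.
elim: s => // x s IH _; rewrite top_cons inE.
have [->|/IH h] := eqVneq s [::]; first by rewrite /top big_nil maxn0 eqxx.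
by rewrite /maxn; case: ifP => _; rewrite ?h ?orbT ?eqxx.
Qed.

Lemma top_gt0 s : (0 < top s)%N -> top s \in s.
Proof.
by move=> h; apply: top_mem; apply: contraTneq h => ->; rewrite /top big_nil.
Qed.

Lemma top_perm s t : perm_eq s t -> top s = top t.
Proof. exact: perm_big. Qed.

(** With [J = 1 - i], truncated subtraction is the positive part in the price of the new order. *)
Definition add_bid (i : nat) (s : seq nat) : seq nat := ((top s).+1 - i)%N :: s.

(** On the empty list [rem] does nothing, so a removal leaves the empty book unchanged and the
    indicator of the generator is built in. *)
Definition drop_top (s : seq nat) : seq nat := rem (top s) s.

Lemma top_add_bid i s : top (add_bid i s) = maxn ((top s).+1 - i) (top s).
Proof. exact: top_cons. Qed.

Lemma perm_add_bid i s t : perm_eq s t -> perm_eq (add_bid i s) (add_bid i t).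
Proof. by move=> st; rewrite /add_bid (top_perm st) perm_cons. Qed.

Lemma perm_drop_top s t : perm_eq s t -> perm_eq (drop_top s) (drop_top t).
Proof.
move=> st; rewrite /drop_top (top_perm st).
have [ts|ts] := boolP (top t \in s); last first.
  by rewrite !rem_id // -(perm_mem st).
rewrite -(perm_cons (top t)) -(permPl (perm_to_rem ts)).
by rewrite -(permPr (perm_to_rem _)) // -(perm_mem st).
Qed.

Lemma top_drop_top s : (top (drop_top s) <= top s)%N.
Proof.
rewrite /top big_seq; elim/big_ind: _ => // [x y hx hy|x]; first by rewrite geq_max hx.
by move=> /mem_rem; apply: leq_top.
Qed.

Lemma size_drop_top s : s != [::] -> size (drop_top s) = (size s).-1.
Proof. by move=> s0; rewrite size_rem// top_mem. Qed.

Section EulerChain.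
Variables (R : realType) (lam h : R) (n : nat) (p : 'I_n.+1 -> R).
Implicit Types (phi psi : seq nat -> R) (B : pred (seq nat)) (s t : seq nat).

(* One step of the chain with transition operator [1 + h * generator]; the
   letter [i] stands for the event [J = 1 - i]. *)
Definition euler phi s : R :=
  (1 - 2 * lam * h) * phi s
  + lam * h * (phi (drop_top s) + \sum_i p i * phi (add_bid i s)).

(* The list tested by [B] consists of the prices after steps 1, ..., N; the
   initial price is left out. *)
Fixpoint euler_prob N B s : R :=
  if N is N'.+1 then
    euler (fun s' => euler_prob N' (fun l => B (top s' :: l)) s') s
  else (B [::])%:R.

Lemma euler_probS N B s : euler_prob N.+1 B s =
  euler (fun s' => euler_prob N (fun l => B (top s' :: l)) s') s.
Proof. by []. Qed.

Hypotheses (lam_ge0 : 0 <= lam) (h_ge0 : 0 <= h) (lamh : 2 * lam * h <= 1).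
Hypotheses (p_ge0 : forall i, 0 <= p i) (sum_p : \sum_i p i = 1).

(** All coefficients are nonnegative because [2 * lam * h <= 1]. The two books may differ and are
    compared move by move, which acts as a coupling: in [euler_prob_excursions] the shifted book
    makes the same moves as the original one. *)
Lemma euler_le2 phi psi s t :
  phi s <= psi t -> phi (drop_top s) <= psi (drop_top t) ->
  (forall i : 'I_n.+1, phi (add_bid i s) <= psi (add_bid i t)) ->
  euler phi s <= euler psi t.
Proof.
move=> h1 h2 h3; apply: lerD; first by rewrite ler_wpM2l// subr_ge0.
apply: ler_wpM2l; first exact: mulr_ge0.
by apply: lerD => //; apply: ler_sum => i _; rewrite ler_wpM2l.
Qed.

Lemma euler_le phi psi s : (forall s', phi s' <= psi s') ->
  euler phi s <= euler psi s.
Proof. by move=> h12; apply: euler_le2. Qed.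

Lemma euler_cst c s : euler (fun=> c) s = c.
Proof. by rewrite /euler -mulr_suml sum_p; ring. Qed.

Lemma eulerZ c phi s : euler (fun s' => c * phi s') s = c * euler phi s.
Proof.
rewrite /euler (eq_bigr (fun i => c * (p i * phi (add_bid i s)))); last by move=> i _; ring.
by rewrite -mulr_sumr; ring.
Qed.

Lemma eulerD phi psi s :
  euler (fun s' => phi s' + psi s') s = euler phi s + euler psi s.
Proof.
rewrite /euler (eq_bigr (fun i => p i * phi (add_bid i s) + p i * psi (add_bid i s)));
  last by move=> i _; ring.
by rewrite big_split /=; ring.
Qed.

Lemma eq_euler_prob N B B' s : B =1 B' -> euler_prob N B s = euler_prob N B' s.
Proof.
elim: N B B' s => [|N IH] B B' s BB /=; first by rewrite BB.
by congr euler; apply/funext => s'; apply: IH => l; exact: BB.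
Qed.

Lemma euler_prob_mono N B B' s :
  (forall l, size l = N -> B l -> B' l) -> euler_prob N B s <= euler_prob N B' s.
Proof.
elim: N B B' s => [|N IH] B B' s BB /=.
  by rewrite ler_nat; case: (B [::]) (BB [::] erefl) => // ->.
by apply: euler_le => s'; apply: IH => l sl; apply: BB; rewrite /= sl.
Qed.

Lemma euler_prob_cst N (b : bool) s : euler_prob N (fun=> b) s = b%:R.
Proof.
elim: N s => [//|N IH] s /=.
by rewrite -[RHS](euler_cst _ s); congr euler; apply/funext => s'; exact: IH.
Qed.

Lemma euler_prob_ge0 N B s : 0 <= euler_prob N B s.
Proof.
have := euler_prob_cst N false s; rewrite /= mulr0n => <-; exact: euler_prob_mono.
Qed.

Lemma euler_prob_le1 N B s : euler_prob N B s <= 1.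
Proof.
have := euler_prob_cst N true s; rewrite /= mulr1n => <-; exact: euler_prob_mono.
Qed.

Lemma euler_prob_disjoint N B B' s : (forall l, ~~ (B l && B' l)) ->
  euler_prob N B s + euler_prob N B' s <= 1.
Proof.
elim: N B B' s => [|N IH] B B' s BB /=.
  by move: (BB [::]); case: (B _); case: (B' _) => //= _; lra.
rewrite -eulerD -[leRHS](euler_cst _ s); apply: euler_le => s'.
by apply: IH => l; exact: BB.
Qed.

Lemma euler_prob_perm N B s t : perm_eq s t ->
  euler_prob N B s = euler_prob N B t.
Proof.
elim: N B s t => [//|N IH] B s t st /=; rewrite /euler.
congr (_ * _ + _ * (_ + _)); [..|apply: eq_bigr => i _; congr (_ * _)].
- by rewrite (top_perm st); apply: IH.
- by have st' := perm_drop_top st; rewrite (top_perm st'); apply: IH.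
- by have st' := perm_add_bid i st; rewrite (top_perm st'); apply: IH.
Qed.

(* The chain spends an expected time at most [W s] in [A] before leaving it;
   the alternative [h * K <= W s] serves to cut the time off at [h * K]. *)
Lemma euler_prob_stay (A : pred nat) (W : seq nat -> R) (K : nat) s :
  (forall s, 0 <= W s) ->
  (forall s, A (top s) -> euler W s + h <= W s \/ h * K%:R <= W s) ->
  A (top s) -> h * K%:R * euler_prob K (all A) s <= W s.
Proof.
move=> W0 WA As.
(* [V N] is the probability of being in [A] at the steps 0, ..., N, and [U N] below is the expected
   time spent there before the first exit, over N steps. [VU] is then Markov's inequality, and [UW]
   bounds [U] by the supersolution [W]. *)
pose V N s : R := (A (top s))%:R * euler_prob N (all A) s.
pose fix U (N : nat) (s : seq nat) {struct N} : R :=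
  if N is N'.+1 then (A (top s))%:R * (h + euler (U N') s) else 0.
have VS N t : V N.+1 t = (A (top t))%:R * euler (V N) t.
  rewrite /V /=; congr (_ * euler _ _); apply/funext => t'.
  case: (A (top t')); rewrite ?mul1r ?mul0r; first exact: eq_euler_prob.
  exact: euler_prob_cst.
have V1 N t : V N t <= 1.
  by rewrite /V; case: (A _); rewrite ?mul0r ?mul1r ?ler01 ?euler_prob_le1.
have VU N t : h * N%:R * V N t <= U N t.
  elim: N t => [|N IH] t; first by rewrite mulr0 mul0r.
  rewrite -[in leLHS]natr1 mulrDr mulr1 mulrDl addrC.
  case At : (A (top t)); last first.
    by rewrite VS /= At !mul0r !mulr0 addr0.
  rewrite {2}VS /= At !mul1r; apply: lerD.
    by rewrite -[leRHS]mulr1 ler_wpM2l.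
  by rewrite -eulerZ; apply: euler_le => t'; exact: IH.
have UN N t : U N t <= h * N%:R.
  elim: N t => [|N IH] t /=; first by rewrite mulr0.
  case: (A _); last by rewrite mul0r mulr_ge0.
  rewrite mul1r -natr1 mulrDr mulr1 addrC lerD2r.
  by rewrite -[leRHS](euler_cst _ t); apply: euler_le => t'; exact: IH.
have UW N t : (N <= K)%N -> U N t <= W t.
  elim: N t => [|N IH] t NK //.
  case At : (A (top t)); last by rewrite /= At mul0r.
  have [hW|hW] := WA _ At; last first.
    by apply: le_trans hW; apply: le_trans (UN _ _) _; rewrite ler_wpM2l// ler_nat.
  rewrite /= At mul1r; apply: le_trans hW; rewrite addrC lerD2r.
  by apply: euler_le => t'; apply: IH; exact: ltnW.
have := le_trans (VU K s) (UW K s (leqnn _)).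
by rewrite /V As mul1r.
Qed.

(** The function [(r ^+ a.+1 - r ^+ q) / lam] of the price [q] dominates the expected time to exceed
    [a]. A removal is bounded as if it sent the price to 0, which costs at most
    [(r ^+ q - 1) / lam]; the value [r = 1 + 1 / p ord0] makes the mean gain of a bid at [q + 1]
    equal to [r ^+ q / lam], so the drift over a step is at most [- h]. *)
Lemma euler_prob_stay_below (a K : nat) s : 0 < p ord0 -> 0 < lam -> (top s <= a)%N ->
  h * K%:R * euler_prob K (all (fun q => q <= a)%N) s
    <= (1 + (p ord0)^-1) ^+ a.+1 / lam.
Proof.
move=> p0 l0 sa; set r := 1 + (p ord0)^-1.
have r1 : 1 <= r by rewrite lerDl invr_ge0 ltW.
have r0 : 0 <= r by apply: le_trans r1.
pose W s : R := (r ^+ a.+1 - r ^+ (minn (top s) a.+1)) / lam.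
have W0 t : 0 <= W t.
  rewrite divr_ge0 ?(ltW l0)// subr_ge0 ler_weXn2l// geq_minr//.
apply: (@le_trans _ _ (W s)); last first.
  by rewrite ler_pM2r ?invr_gt0// gerBl exprn_ge0.
apply: (@euler_prob_stay (fun q => q <= a)%N) => // t ta; left.
set q := top t in ta *.
have Wt : W t = (r ^+ a.+1 - r ^+ q) / lam.
  by rewrite /W (minn_idPl _)// -/q (leq_trans ta).
have Wd : W (drop_top t) <= (r ^+ a.+1 - 1) / lam.
  rewrite /W ler_pM2r ?invr_gt0// lerD2l lerN2.
  exact: exprn_ege1.
have Wa (i : 'I_n.+1) : W (add_bid i t) <=
    W t - (i == ord0)%:R * (r ^+ q.+1 - r ^+ q) / lam.
  have [->|i0] := eqVneq i ord0.
    rewrite Wt /W top_add_bid -/q subn0 (maxn_idPl (leqnSn _)) (minn_idPl _) ?ltnS//.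
    by rewrite mul1r -mulrBl; rewrite le_eqVlt; apply/orP; left; apply/eqP; congr (_ / _); ring.
  have i1 : (0 < i)%N by rewrite lt0n; apply: contra i0 => /eqP i0; apply/eqP/val_inj.
  rewrite !mul0r subr0 Wt /W top_add_bid -/q (maxn_idPr _); last by lia.
  by rewrite (minn_idPl _)// (leq_trans ta).
have hE : euler W t <= (1 - 2 * lam * h) * W t
   + lam * h * ((r ^+ a.+1 - 1) / lam + (W t - p ord0 * (r ^+ q.+1 - r ^+ q) / lam)).
  apply: lerD => //; apply: ler_wpM2l; first exact: mulr_ge0.
  apply: lerD => //.
  apply: (@le_trans _ _ (\sum_i (p i * W t
      - (i == ord0)%:R * p i * (r ^+ q.+1 - r ^+ q) / lam))).
    apply: ler_sum => i _; apply: le_trans (ler_wpM2l (p_ge0 i) (Wa i)) _.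
    by rewrite mulrBr lerD2l lerN2 !mulrA (mulrC (p i)).
  rewrite sumrB -mulr_suml sum_p mul1r lerD2l lerN2 -!mulr_suml.
  rewrite (bigD1 ord0)//= mul1r big1 ?addr0// => i /negbTE ->.
  by rewrite mul0r.
apply: (@le_trans _ _ _ _ _ (lerD hE (lexx h))).
rewrite Wt (exprS r q).
have -> : (r * r ^+ q - r ^+ q) = (p ord0)^-1 * r ^+ q by rewrite /r; ring.
have pn := lt0r_neq0 p0; have ln := lt0r_neq0 l0.
rewrite le_eqVlt; apply/orP; left; apply/eqP.
by field; rewrite pn ln.
Qed.

(** While the price exceeds [a] the book is nonempty and its size is a lazy symmetric random walk.
    In [w], the ratio [x / L] is the probability that the walk started at [x] reaches [L] before 0,
    and [x * (L - x) / (2 * lam)] is its mean exit time; from size [L] on, the time is cut off at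
    [h * K]. The bound [L] is free, to be chosen large before [K]. *)
Lemma euler_prob_stay_above (a K L : nat) s : 0 < lam -> (0 < L)%N ->
  (a < top s)%N -> (size s <= L)%N ->
  h * K%:R * euler_prob K (all (fun q => a < q)%N) s
    <= h * K%:R * (size s)%:R / L%:R + (size s)%:R * L%:R / (2 * lam).
Proof.
move=> l0 L0 sa sL.
pose w (x : nat) : R := if (x <= L)%N then
  h * K%:R * x%:R / L%:R + x%:R * (L%:R - x%:R) / (2 * lam) else h * K%:R.
have ln := lt0r_neq0 l0.
have Lp : 0 < L%:R :> R by rewrite ltr0n.
have Ln := lt0r_neq0 Lp.
have hK : 0 <= h * K%:R by rewrite mulr_ge0.
have l20 : 0 <= 2 * lam by rewrite mulr_ge0.
have w0 x : 0 <= w x.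
  rewrite /w; case: ifP => // xL.
  by rewrite addr_ge0// divr_ge0 ?mulr_ge0// subr_ge0 ler_nat.
apply: (@le_trans _ _ (w (size s))); last first.
  rewrite /w sL lerD2l ler_wpM2r// ?invr_ge0// ler_wpM2l// gerBl//.
apply: (@euler_prob_stay (fun q => a < q)%N (fun s => w (size s))) => // t ta.
have t0 : t != [::] by apply: contraTneq ta => ->; rewrite /top big_nil.
have [Lt|tL] := leqP L (size t).
  right; rewrite /w; case: ifP => // tL.
  have -> : size t = L by lia.
  by rewrite subrr mulr0 mul0r addr0 -mulrA mulfV// mulr1.
left; rewrite /euler size_drop_top// /= -mulr_suml sum_p mul1r.
have [x sx] : exists x, size t = x.+1 by case: (t) t0 => //= y u _; exists (size u).
move: tL; rewrite sx /= => xL.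
rewrite /w xL (ltnW xL) (ltnW (ltnW xL)) -!natr1.
rewrite le_eqVlt; apply/orP; left; apply/eqP.
by field; rewrite Ln ln.
Qed.

(** Invariant that keeps the price from falling by more than one: a bid lands at most one level
    above the top, and a removal takes one order at the top. Level 0 may be vacant, as the empty
    book has price 0 too. *)
Definition no_gap s := forall k, (0 < k <= top s)%N -> k \in s.

Lemma no_gap_add_bid i s : no_gap s -> no_gap (add_bid i s).
Proof.
move=> sg k; rewrite top_add_bid leq_max /add_bid inE => /andP[k0].
have [->//|kn] := eqVneq k ((top s).+1 - i)%N.
by move=> k2; apply: sg; rewrite k0 /=; move: kn k2; lia.
Qed.

Lemma no_gap_drop_top s : no_gap s -> no_gap (drop_top s).
Proof.
move=> sg k /andP[k0 ks].
have ks' := leq_trans ks (top_drop_top s).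
have [kt|kt] := eqVneq k (top s); last first.
  have : k \in s by apply: sg; rewrite k0.
  by rewrite (perm_mem (perm_to_rem (top_gt0 (leq_trans k0 ks')))) inE (negbTE kt).
have <- : top (drop_top s) = k by apply/eqP; rewrite eqn_leq ks kt top_drop_top.
exact: top_gt0 (leq_trans k0 ks).
Qed.

Lemma no_gap_top s : no_gap s -> (top s <= (top (drop_top s)).+1)%N.
Proof.
move=> sg; have [//|s1] := leqP (top s) 1.
  by move=> h1; apply: leq_trans h1 _.
have : (top s).-1 \in s by apply: sg; lia.
rewrite (perm_mem (perm_to_rem (top_gt0 (ltnW s1)))) inE => /orP[|/leq_top].
  by lia.
by rewrite -/(drop_top s); lia.
Qed.

Lemma euler_prob_price_drop N s : no_gap s ->
  euler_prob N (fun l => ~~ path (fun q r => q <= r.+1)%N (top s) l) s = 0.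
Proof.
move=> sg; apply/le_anti; rewrite euler_prob_ge0 andbT.
elim: N s sg => [//|N IH] s sg /=.
have step t : no_gap t -> (top s <= (top t).+1)%N -> euler_prob N
  (fun l => ~~ path (fun q r => q <= r.+1)%N (top s) (top t :: l)) t <= 0.
  move=> tg st; apply: le_trans (IH _ tg).
  by rewrite le_eqVlt; apply/orP; left; apply/eqP/eq_euler_prob => l /=; rewrite st.
rewrite -[leRHS](euler_cst _ s); apply: euler_le2.
- exact: step.
- by apply: step; [exact: no_gap_drop_top | exact: no_gap_top].
- move=> i; apply: step; first exact: no_gap_add_bid.
  by rewrite top_add_bid; lia.
Qed.

(* Reads the successive excursions above [a] off a list of prices and tests
   them against [Cs]; [q] is the part already read of the current excursion. *)
Fixpoint test_excursions (a : nat) (Cs : seq (pred (seq nat)))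
    (q : option (seq nat)) (l : seq nat) {struct l} : bool :=
  match Cs, l with
  | [::], _ => true
  | _, [::] => false
  | C :: Cs', x :: l' =>
    if q is Some q' then
      if (x <= a)%N then C (rcons q' (x - a)%N) && test_excursions a Cs' None l'
      else test_excursions a Cs (Some (rcons q' (x - a)%N)) l'
    else test_excursions a Cs (if (x <= a)%N then None else Some [:: (x - a)%N]) l'
  end.

Lemma test_excursions_nil a q l : test_excursions a [::] q l = true.
Proof. by case: l. Qed.

(** Kept in the order of [s]: a bid goes to the front and [rem] takes the first occurrence, so a
    book and its shifted copy satisfy equalities of lists and not only of multisets. *)
Definition orders_above (a : nat) s := [seq (x - a)%N | x <- s & (a < x)%N].

Lemma top_orders_above a s :
  (top (orders_above a s) = top s - a)%N.
Proof.
elim: s => [|x s IH]; first by rewrite /orders_above /top /= !big_nil.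
rewrite /orders_above /= top_cons; case: ifP => ax; rewrite /= ?top_cons;
  move: IH; rewrite /orders_above => ->; lia.
Qed.

(** The right-hand side involves [s] and [a] only through [top s - a] and [orders_above a s], and
    [orders_above_drop] has the same form. Hence two books with the same orders above their levels
    keep this property under equal moves; bids at or below the level are invisible, even where
    truncation puts them at price 0 in the shifted book. *)
Lemma orders_above_add a i s : (a < top s)%N ->
  orders_above a (add_bid i s) =
  if (i <= top s - a)%N then ((top s - a).+1 - i)%N :: orders_above a s
  else orders_above a s.
Proof.
move=> sa; rewrite /orders_above /add_bid /=.
case: ifP => h1; case: ifP => h2 //=; try lia.
by congr cons; lia.
Qed.

Lemma orders_above_drop a s : (a < top s)%N ->
  orders_above a (drop_top s) = rem (top s - a)%N (orders_above a s).
Proof.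
rewrite /drop_top; move: (top s) => m am.
rewrite /orders_above; elim: s => //= x s IH.
case: (eqVneq x m) => [->|xm]; first by rewrite am /= eqxx.
rewrite /=; case: ifP => ax //=; rewrite IH.
by have -> : (x - a == m - a)%N = false by apply/negbTE; move: xm; lia.
Qed.

Lemma euler_prob_last N b a s :
  euler_prob N (fun l => b && test_excursions a [::] None l) s = b%:R.
Proof.
rewrite -[RHS](euler_prob_cst N b s); apply: eq_euler_prob => l.
by rewrite test_excursions_nil andbT.
Qed.

(** The prefix supplies the initial price 1, which [euler_prob] does not put into the list. *)
Definition first_excursion_prob N C : R :=
  euler_prob N (test_excursions 0 [:: C] (Some [:: 1%N])) [:: 1%N].

(** An excursion unfinished at the horizon counts as a failure, so a longer horizon only adds
    successes. This raises factors with different remaining horizons to a common one. *)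
Lemma first_excursion_mono N C q s :
  euler_prob N (test_excursions 0 [:: C] q) s
    <= euler_prob N.+1 (test_excursions 0 [:: C] q) s.
Proof.
elim: N q s => [|N IH] q s; first exact: euler_prob_ge0.
rewrite (euler_probS N.+1) (euler_probS N); apply: euler_le => s'.
have E M x u : euler_prob M (fun l => test_excursions 0 [:: C] q (x :: l)) u =
    if q is Some q' then
      if (x <= 0)%N then (C (rcons q' (x - 0)%N))%:R
      else euler_prob M (test_excursions 0 [:: C] (Some (rcons q' (x - 0)%N))) u
    else euler_prob M
      (test_excursions 0 [:: C] (if (x <= 0)%N then None else Some [:: (x - 0)%N])) u.
  by case: q => [q'|//] /=; case: ifP => // _; exact: euler_prob_last.
by rewrite !E; case: q {E} => [q|]; [case: ifP|].
Qed.

(** The induction on [N] needs both phases at once: between excursions, and inside one, where [s] is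
    coupled with a book [t] having the same orders above 0. The current excursion is measured by
    [t], so whatever [s] holds at or below [a] is forgotten. *)
Lemma euler_prob_excursions (a N : nat) (Cs : seq (pred (seq nat))) s :
  ((top s <= a)%N -> euler_prob N (test_excursions a Cs None) s
     <= \prod_(C <- Cs) first_excursion_prob N C) /\
  (forall C q t, orders_above a s = orders_above 0 t ->
     (0 < top t)%N ->
     euler_prob N (test_excursions a (C :: Cs) (Some q)) s
     <= euler_prob N (test_excursions 0 [:: C] (Some q)) t
        * \prod_(C <- Cs) first_excursion_prob N C).
Proof.
have P0 M C : 0 <= first_excursion_prob M C by exact: euler_prob_ge0.
have PP M Cs' : 0 <= \prod_(C <- Cs') first_excursion_prob M C.
  by rewrite prodr_ge0.
have PS M Cs' : \prod_(C <- Cs') first_excursion_prob M C <=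
    \prod_(C <- Cs') first_excursion_prob M.+1 C.
  by apply: ler_prod => C _; rewrite P0 /= first_excursion_mono.
elim: N Cs s => [|N IH] Cs s.
  split=> [sa|C q t _ _]; last by rewrite /= mul0r.
  case: Cs => [|C Cs]; first by rewrite big_nil /=.
  exact: PP.
split=> [sa|C q t st t0].
  case: Cs => [|C Cs].
    by rewrite big_nil euler_prob_le1.
  apply: le_trans (PS _ _); rewrite /= -[leRHS](euler_cst _ s).
  apply: euler_le2 => [|| i] /=.
  - by rewrite sa; apply: (IH (C :: Cs) s).1.
  - have sa' := leq_trans (top_drop_top s) sa.
    by rewrite sa'; apply: (IH (C :: Cs) _).1.
  - case: ifP => sa'; first by apply: (IH (C :: Cs) _).1.
    have s' : top s = a by move: sa'; rewrite top_add_bid; lia.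
    have i0 : val i = 0%N by move: sa'; rewrite top_add_bid /=; lia.
    have o0 : orders_above a s = [::].
      apply/eqP; rewrite -size_eq0 /orders_above size_map size_filter -leqn0 leqNgt -has_count.
      by apply/hasPn => x /leq_top; rewrite s' -leqNgt.
    have o1 : orders_above a (add_bid i s) = [:: 1%N].
      rewrite /orders_above /add_bid /= i0 subn0 s' ltnSn /=.
      by move: o0; rewrite /orders_above => ->; rewrite subSnn.
    rewrite big_cons.
    have -> : (top (add_bid i s) - a)%N = 1%N.
      by rewrite top_add_bid i0 s'; lia.
    by apply: (IH Cs _).2; rewrite ?o1// /top big_seq1.
rewrite mulrC -eulerZ.
have PPS : \prod_(C <- Cs) first_excursion_prob N C <=
   \prod_(C <- Cs) first_excursion_prob N.+1 C by exact: PS.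
have tops u v : orders_above a u = orders_above 0 v -> (top u - a = top v)%N.
  by move=> uv; rewrite -top_orders_above uv top_orders_above subn0.
have step u v : orders_above a u = orders_above 0 v ->
   euler_prob N (fun l => test_excursions a (C :: Cs) (Some q) (top u :: l)) u
   <= \prod_(C0 <- Cs) first_excursion_prob N.+1 C0 *
   euler_prob N (fun l => test_excursions 0 [:: C] (Some q) (top v :: l)) v.
  move=> uv; have tuv := tops _ _ uv; rewrite /= subn0.
  (* Both excursions end at the same step with the same recorded values, so [C] decides alike on
     both sides; what follows is bounded by the first half of the induction hypothesis. *)
  have -> : (top u <= a)%N = (top v <= 0)%N by lia.
  rewrite tuv; case v0 : (top v <= 0)%N; last first.
    apply: (@le_trans _ _ (\prod_(C0 <- Cs) first_excursion_prob N C0 *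
      euler_prob N (test_excursions 0 [:: C] (Some (rcons q (top v)))) v)).
      by rewrite mulrC; apply: (IH Cs u).2 => //; lia.
    by rewrite ler_wpM2r// euler_prob_ge0.
  rewrite euler_prob_last; case: (C _) => /=.
    by rewrite mulr1; apply: le_trans PPS; apply: (IH Cs u).1; lia.
  by rewrite (euler_prob_cst _ false) mulr0.
have tst := tops _ _ st.
have sa : (a < top s)%N by lia.
rewrite euler_probS; apply: euler_le2 => [|| i]; apply: step.
- exact: st.
- by rewrite orders_above_drop// orders_above_drop// subn0 st tst.
- by rewrite !orders_above_add// subn0 st tst.
Qed.

End EulerChain.

(** * Books as point measures *)

Section PointMeasureTheory.
Variable R : realType.
Implicit Types (nu : point_measure R) (x : {nonneg R}) (A : set R) (s : seq nat).

Definition atom (k : nat) : {nonneg R} := NngNum (ler0n R k).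

Definition atoms nu : seq {nonneg R} := enum_mset (nu : multiset _).

Lemma count_atoms nu x : count_mem x (atoms nu) = nu x.
Proof. exact: count_mem_mset. Qed.

Lemma pm_measureE nu A :
  pm_measure nu A = (count (fun x : {nonneg R} => x%:num \in A) (atoms nu))%:R%:E.
Proof.
rewrite /pm_measure.
under eq_bigr do rewrite diracE mule_natl.
transitivity (\sum_(x <- atoms nu) (x%:num \in A)%:R%:E : \bar R)%E.
  rewrite /atoms (@big_mset _ (\bar R) 0%E +%E); exact: eq_bigr.
rewrite sumEFin -natr_sum -sum1_count [in RHS]big_mkcond/=.
by congr (_%:R%:E); apply: eq_bigr => x _; case: (_ \in A).
Qed.

Lemma perm_add_order nu x : perm_eq (atoms (add_order nu x)) (x :: atoms nu).
Proof.
apply/allP => y _ /=; rewrite count_atoms /add_order msetE2 msetnE /= count_atoms.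
rewrite addnC (eq_sym y x).
by case: (x == y).
Qed.

Lemma pm_measure_add nu x A :
  pm_measure (add_order nu x) A = (pm_measure nu A + (x%:num \in A)%:R%:E)%E.
Proof.
rewrite !pm_measureE (permP (perm_add_order nu x)) /= -EFinD -natrD addnC.
by congr (_%:R%:E); rewrite addnC.
Qed.

Lemma Rintegral_pm_measure nu (phi : R -> R) : continuous phi ->
  (forall y, 0 <= phi y) ->
  \int[pm_measure nu]_y phi y = \sum_(x <- (atoms nu)) phi x%:num.
Proof.
move=> cphi phi0.
pose m i : {measure set R -> \bar R} := \d_((nth (atom 0) (atoms nu) i)%:num).
have mphi : measurable_fun setT (EFin \o phi).
  by apply/measurable_EFinP; exact: continuous_measurable_fun.
rewrite /Rintegral (@eq_measure_integral _ _ _ _ (msum m (size (atoms nu)))); last first.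
  move=> A mA _; rewrite [RHS](_ : _ = \sum_(i < size (atoms nu)) m i A)%E//.
  transitivity (\sum_(i < size (atoms nu))
    ((nth (atom 0) (atoms nu) i)%:num \in A)%:R%:E : \bar R)%E; last first.
    by apply: eq_bigr => i _; rewrite /m /= diracE.
  rewrite sumEFin -natr_sum.
  rewrite -(big_mkord predT (fun i => nat_of_bool ((nth (atom 0) (atoms nu) i)%:num \in A))).
  rewrite -(big_nth (atom 0) predT (fun x : {nonneg R} => nat_of_bool (x%:num \in A))).
  rewrite -[LHS]/(pm_measure nu A) pm_measureE -sum1_count big_mkcond/=.
  by congr (_%:R%:E); apply: eq_bigr => x _; case: (_ \in A).
rewrite ge0_integral_measure_sum//; last by move=> x _; rewrite lee_fin.
under eq_bigr do rewrite integral_dirac//= diracT mul1e.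
by rewrite sumEFin/= -(big_mkord predT (fun i => phi (nth (atom 0) (atoms nu) i)%:num))
   -(big_nth (atom 0) predT (fun x : {nonneg R} => phi x%:num)).
Qed.

Lemma atom_inj : injective atom.
Proof. by move=> i j /(congr1 (fun x => x%:num)) /= /eqP; rewrite eqr_nat => /eqP. Qed.

Definition book_of s : point_measure R := seq_mset [seq atom k | k <- s].

Lemma perm_book s : perm_eq (atoms (book_of s)) [seq atom k | k <- s].
Proof. exact: perm_eq_seq_mset. Qed.

Lemma book_of_eq s t : book_of s = book_of t -> perm_eq s t.
Proof. by move=> /eq_seq_msetP /(perm_map_inj atom_inj). Qed.

Lemma book_of_nil : book_of [::] = mset0.
Proof. by apply/msetP => x; rewrite mset_seqE mset0E. Qed.

Lemma book_of1 k x : x%:num = k%:R -> book_of [:: k] = msetn 1%N x.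
Proof.
move=> xk; have <- : atom k = x by apply/val_inj; rewrite /= xk.
by apply/msetP => y; rewrite mset_seqE msetnE/= eq_sym addn0; case: eqP.
Qed.

Lemma book_of_cons k s : book_of (k :: s) = add_order (book_of s) (atom k).
Proof.
apply/msetP => y; rewrite /add_order msetE2 !mset_seqE msetnE/= addnC eq_sym.
by case: eqP.
Qed.

Lemma book_of_drop s : book_of (drop_top s) = remove_order (book_of s) (atom (top s)).
Proof.
apply/msetP => y; rewrite /remove_order msetE2 !mset_seqE msetnE /drop_top.
rewrite !count_map count_rem /= eq_sym.
have [ts|/count_memPn ts] := boolP (top s \in s); first by case: eqP.
rewrite subn0; case: eqP => [->|]; last by rewrite subn0.
rewrite (eq_count (a2 := pred1 (top s))) ?ts// => k /=.
by rewrite (inj_eq atom_inj).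
Qed.

Lemma pm_measure_book s A : pm_measure (book_of s) A = (count (fun k => k%:R \in A) s)%:R%:E.
Proof. by rewrite pm_measureE (permP (perm_book s)) count_map. Qed.

Lemma price_book s : price (book_of s) = (top s)%:R.
Proof.
have E : [set y : R | 0 <= y /\ (0 < pm_measure (book_of s) `[y, +oo[%classic)%E] =
         [set y | 0 <= y /\ exists2 k, k \in s & y <= k%:R].
  apply/seteqP; split => y /= [y0 h]; split => //.
    move: h; rewrite pm_measure_book lte_fin ltr0n -has_count => /hasP[k ks].
    by rewrite inE /= in_itv/= andbT => yk; exists k.
  rewrite pm_measure_book lte_fin ltr0n -has_count; case: h => k ks yk.
  by apply/hasP; exists k => //; rewrite inE/= in_itv/= yk.
rewrite /price E; have [->|s0] := eqVneq s [::].
  rewrite (_ : [set y : R | _] = set0) ?sup0 ?/top ?big_nil//.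
  by apply/seteqP; split => y //= [_ []].
rewrite (_ : [set y : R | _] = `[0, (top s)%:R]%classic) ?sup_itv//.
  by rewrite bnd_simp ler0n.
apply/seteqP; split => y /=; rewrite in_itv/=.
  by move=> [-> [k /leq_top ks yk]]; apply: le_trans yk _; rewrite ler_nat.
by move=> /andP[-> yt]; split => //; exists (top s) => //; exact: top_mem.
Qed.

Lemma book_of_add i s :
  book_of (add_bid i s) = add_order (book_of s) (pos_part (price (book_of s) + (1 - i%:R))).
Proof.
rewrite book_of_cons; congr add_order; apply/val_inj => /=.
rewrite price_book addrA natr1.
have [h|h] := leqP i (top s).+1.
  by rewrite natrB// (max_idPr _)// subr_ge0 ler_nat.
rewrite (max_idPl _); last by rewrite subr_le0 ler_nat ltnW.
by rewrite (eqP (_ : (top s).+1 - i == 0)%N)// subn_eq0 ltnW.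
Qed.

Lemma book_of_remove s :
  book_of (drop_top s) = remove_order (book_of s) (price_nng (book_of s)).
Proof. by rewrite book_of_drop; congr remove_order; apply/val_inj; rewrite /= price_book. Qed.

Lemma book_of_eq0 s : (book_of s == mset0) = (s == [::]).
Proof.
rewrite -book_of_nil; by apply/eqP/eqP => [/book_of_eq/perm_nilP|->].
Qed.

Lemma measurable_pm_eval A : measurable A ->
  measurable_fun setT (fun nu : pmT R => pm_measure nu A).
Proof.
move=> mA _ B mB; apply: sub_sigma_algebra.
by exists A => //; exists B.
Qed.

(** A book is determined by finitely many evaluations: mass 0 outside the finite set of its prices
    and the right mass at each of them. *)
Lemma measurable_set1_pmT (nu : pmT R) : measurable [set nu].
Proof.
pose S : set R := [set x%:num | x in [set` atoms nu]].
have mS : measurable S.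
  apply: countable_measurable; first exact: measurable_set1.
  apply: finite_set_countable; apply: finite_image; exact: finite_seq.
rewrite (_ : [set nu] = [set mu : pmT R | pm_measure mu (~` S) = 0%E] `&`
  \bigcap_(x in [set` atoms nu])
   [set mu : pmT R | pm_measure mu [set x%:num] = pm_measure nu [set x%:num]]).
  apply: measurableI.
    rewrite -[X in measurable X]setTI.
    exact: (@measurable_pm_eval _ (measurableC mS) measurableT [set 0%E]).
  apply: fin_bigcap_measurable; first exact: finite_seq.
  move=> x _; rewrite -[X in measurable X]setTI.
  exact: (@measurable_pm_eval _ (measurable_set1 _) measurableT [set _]).
have count1 (mu : point_measure R) x :
    count (fun y : {nonneg R} => y%:num \in [set x%:num]) (atoms mu) = mu x.
  rewrite -count_atoms; apply: eq_count => y /=.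
  by apply/idP/eqP => [/set_mem/val_inj//|->]; exact/mem_set.
apply/seteqP; split => mu /=.
  move=> ->; split => //.
  rewrite pm_measureE (eqP (_ : count _ _ == 0%N))// -leqn0 leqNgt -has_count.
  by apply/hasPn => x xnu; apply/negP => /set_mem; apply; exists x.
move=> [h1 h2]; apply/msetP => x.
have [xnu|xnu] := boolP (x \in (atoms nu)).
  have := h2 x xnu; rewrite /= !pm_measureE !count1 => -[] /eqP.
  by rewrite eqr_nat => /eqP.
have -> : nu x = 0%N by rewrite -count_atoms; apply/count_memPn.
rewrite -count_atoms; apply/count_memPn.
move: h1; rewrite pm_measureE => -[] /eqP; rewrite pnatr_eq0 -leqn0 leqNgt -has_count.
apply: contra => xmu; apply/hasP; exists x => //; apply/mem_set => -[y ynu] /val_inj yx.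
by move: xnu; rewrite -yx; apply/negP; rewrite negbK.
Qed.

Definition natural_books : set (pmT R) := [set nu | exists s, nu = book_of s].

(** There are only countably many natural books, so functions and events on them can be defined list
    by list. *)
Lemma measurable_natural_books (B : set (pmT R)) : B `<=` natural_books -> measurable B.
Proof.
move=> BN; apply: countable_measurable; first exact: measurable_set1_pmT.
apply: (@sub_countable _ _ B natural_books); first exact: subset_card_le.
apply: (@sub_countable _ _ _ [set: seq nat]); last exact: countableP.
rewrite (_ : natural_books = range book_of); first exact: card_image_le.
by apply/seteqP; split => nu [s]; [move=> ->; exists s | move=> _ <-; exists s].
Qed.

Lemma measurable_fun_pmT d (T : measurableType d) (f : T -> pmT R) :
  (forall A, measurable A -> measurable_fun setT (fun w => pm_measure (f w) A)) ->
  measurable_fun setT f.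
Proof.
move=> mf; apply: (@measurability _ _ _ _ _ f (@pm_evals R)) => // _ [_ [A mA [B mB <-]] <-].
by rewrite setTI; apply: mf.
Qed.

Lemma measurable_add_order d (T : measurableType d) (g : T -> R) nu :
  measurable_fun setT g ->
  measurable_fun setT (fun w => add_order nu (pos_part (g w)) : pmT R).
Proof.
move=> mg; apply: measurable_fun_pmT => A mA.
under eq_fun do rewrite pm_measure_add.
apply: emeasurable_funD => //.
have := @measurable_indic _ _ R setT A mA.
move=> /measurable_EFinP /measurableT_comp; apply.
exact: measurable_maxr.
Qed.

End PointMeasureTheory.

Lemma natrSM (R : pzRingType) (j : nat) (K : R) : j.+1%:R * K = K + j%:R * K.
Proof. by rewrite mulrS mulrDl mul1r. Qed.

Lemma inv_succ_lt (R : realType) (eps : R) : 0 < eps ->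
  exists N : nat, forall n, (N <= n)%N -> n.+1%:R^-1 < eps.
Proof.
by move=> e0; have [N _ h] := near_infty_natSinv_lt (PosNum e0); exists N.
Qed.

(** * Integrals of bounded functions against a probability measure *)

Section BoundedIntegral.
Context (R : realType) (d : measure_display) (E : measurableType d).
Implicit Types (f g : E -> R) (M : R).

Definition bounded_measurable M f :=
  measurable_fun setT f /\ forall x, `|f x| <= M.

Lemma bounded_measurableB M N f g : bounded_measurable M f ->
  bounded_measurable N g -> bounded_measurable (M + N) (fun x => f x - g x).
Proof.
move=> [mf fM] [mg gN]; split; first exact: measurable_funB.
by move=> x; apply: le_trans (ler_normB _ _) _; exact: lerD.
Qed.

Lemma bounded_measurableZ M c f : bounded_measurable M f ->
  bounded_measurable (`|c| * M) (fun x => c * f x).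
Proof.
move=> [mf fM]; split; first exact: measurable_funM.
by move=> x; rewrite normrM ler_wpM2l.
Qed.

Lemma bounded_measurable_cst c : bounded_measurable `|c| (fun=> c).
Proof. by split. Qed.

Variable mu : {measure set E -> \bar R}.
Hypothesis mu1 : mu setT = 1%E.

Lemma bounded_measurable_integrable M f :
  bounded_measurable M f -> mu.-integrable setT (EFin \o f).
Proof.
move=> [mf fM]; apply: measurable_bounded_integrable => //.
  by rewrite mu1 ltry.
exists M; split; first exact: num_real.
by move=> y My x _; apply: le_trans (fM x) (ltW My).
Qed.

Lemma Rintegral_prob_cst (c : R) : \int[mu]_x c = c.
Proof. by rewrite Rintegral_cst// mu1 mulr1. Qed.

Lemma Rintegral_prob_ler M N f g : bounded_measurable M f ->
  bounded_measurable N g -> (forall x, f x <= g x) ->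
  \int[mu]_x f x <= \int[mu]_x g x.
Proof.
move=> fM gN fg; apply: le_Rintegral => //.
  exact: bounded_measurable_integrable fM.
exact: bounded_measurable_integrable gN.
Qed.

Lemma Rintegral_prob_bound M f : bounded_measurable M f -> `|\int[mu]_x f x| <= M.
Proof.
move=> [mf fM]; apply: le_trans (le_normr_Rintegral _ _) _ => //.
  by apply: (@bounded_measurable_integrable M); split.
rewrite -[leRHS]Rintegral_prob_cst.
apply: (Rintegral_prob_ler _ (bounded_measurable_cst M)) => //.
by split => [|x]; [exact: measurableT_comp | rewrite normr_id].
Qed.

Lemma Rintegral_probB M N f g : bounded_measurable M f ->
  bounded_measurable N g ->
  \int[mu]_x (f x - g x) = \int[mu]_x f x - \int[mu]_x g x.
Proof.
move=> fM gN; apply: RintegralB => //.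
  exact: bounded_measurable_integrable fM.
exact: bounded_measurable_integrable gN.
Qed.

Lemma Rintegral_probZ M c f : bounded_measurable M f ->
  \int[mu]_x (c * f x) = c * \int[mu]_x f x.
Proof. by move=> fM; rewrite RintegralZl//; exact: bounded_measurable_integrable fM. Qed.

End BoundedIntegral.

(** * Kernel semigroups and their Euler steps *)

Section Semigroup.
Context (R : realType) (d : measure_display) (E : measurableType d).
Variable kappa : R -> R.-pker E ~> E.
Implicit Types (f g : E -> R) (M s t : R) (x : E).

Let kappa1 t x : kappa t x setT = 1%E.
Proof. exact: prob_kernel. Qed.

Definition transition t f x : R := \int[kappa t x]_y f y.

Lemma transition_bounded M t f :
  bounded_measurable M f -> bounded_measurable M (transition t f).
Proof.
move=> fM; split; last by move=> x; exact: Rintegral_prob_bound.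
(* Shifting by [M] reduces the claim to nonnegative functions, whose integrals against a kernel
   depend measurably on the starting point. *)
have fM0 x : 0 <= f x - (- M).
  by have := fM.2 x; rewrite ler_norml => /andP[? _]; rewrite subr_ge0.
have bM := bounded_measurable_cst E (- M).
have -> : transition t f = (fun x => \int[kappa t x]_y (f y - (- M)) + - M).
  apply/funext => x; rewrite (Rintegral_probB _ fM bM)//.
  by rewrite Rintegral_prob_cst// subrK.
apply: measurable_funD => //; apply: measurableT_comp => //.
apply: (@measurable_fun_integral_kernel _ _ _ _ _ (kappa t)) => //.
- by move=> U mU; exact: measurable_kernel.
- by apply/measurable_EFinP; exact: (bounded_measurableB fM bM).1.
Qed.

Hypothesis semigroup : forall s t, 0 <= s -> 0 <= t ->
  forall x (B : set E), measurable B ->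
    kappa (s + t) x B = (\int[kappa s x]_y kappa t y B)%E.

Lemma transitionD M s t f x : 0 <= s -> 0 <= t -> bounded_measurable M f ->
  transition (s + t) f x = transition s (transition t f) x.
Proof.
move=> s0 t0 fM.
pose g y := f y - (- M).
have g0 y : 0 <= g y.
  by have := fM.2 y; rewrite ler_norml => /andP[? _]; rewrite subr_ge0.
have bM := bounded_measurable_cst E (- M).
have gM := bounded_measurableB fM bM.
have fE u y : transition u f y = transition u g y + - M.
  rewrite /transition (Rintegral_probB _ fM bM)//.
  by rewrite Rintegral_prob_cst// subrK.
have mg : measurable_fun setT (EFin \o g) by apply/measurable_EFinP; exact: gM.1.
have gi u y : (\int[kappa u y]_z (g z)%:E)%E = (transition u g y)%:E.
  rewrite /transition /Rintegral fineK//.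
  exact: integrable_fin_num (bounded_measurable_integrable (kappa1 u y) gM).
have gD : transition (s + t) g x = transition s (transition t g) x.
  rewrite /transition {1}/Rintegral.
  have -> : (\int[kappa (s + t) x]_y (g y)%:E)%E =
     (\int[kcomp (kappa s) (kernel.kernel_snd (kappa t)) x]_y (g y)%:E)%E.
    by apply: eq_measure_integral => A mA _; exact: semigroup.
  rewrite integral_kcomp//.
  rewrite /Rintegral; congr fine; apply: eq_integral => y _.
  by rewrite /= gi.
rewrite fE gD.
have -> : transition s (transition t f) x =
  transition s (fun y => transition t g y - M) x.
  by congr transition; apply/funext => y; exact: fE.
rewrite [in RHS]/transition (Rintegral_probB _ (transition_bounded t gM)
  (bounded_measurable_cst E M))//.
by rewrite Rintegral_prob_cst.
Qed.

Variables (G : (E -> R) -> E -> R) (c : R).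
Hypothesis G_bound : forall M f, bounded_measurable M f -> forall x, `|G f x| <= c * M.
Hypothesis G_limit : forall M f, bounded_measurable M f ->
  forall eps : R, 0 < eps -> exists2 delta : R, 0 < delta &
    forall t x, 0 < t < delta -> `|(transition t f x - f x) / t - G f x| <= eps.
Hypothesis kappa0 : forall x (B : set E), measurable B -> kappa 0 x B = \d_x B.

Lemma transition0 M f x : bounded_measurable M f -> transition 0 f x = f x.
Proof.
move=> fM; rewrite /transition /Rintegral.
rewrite (@eq_measure_integral _ _ _ _ \d_x); last by move=> A mA _; exact: kappa0.
rewrite integral_dirac//; first by rewrite diracT mul1e.
by apply/measurable_EFinP; exact: fM.1.
Qed.

(** [G f] is the pointwise limit of the measurable difference quotients at [t = 1 / (n + 1)]. This
    makes it an admissible argument of the semigroup, as [transition_expansion] requires. *)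
Lemma G_bounded_measurable M f :
  bounded_measurable M f -> bounded_measurable (c * M) (G f).
Proof.
move=> fM; split; last exact: G_bound.
apply: (@measurable_fun_cvg _ _ _ _ (fun n x => n.+1%:R * (transition n.+1%:R^-1 f x - f x))).
  move=> n; apply: measurable_funM => //.
  by apply: measurable_funB; [exact: (transition_bounded _ fM).1|exact: fM.1].
move=> x _; apply/cvgrPdist_le => eps e0.
have [delta d0 hd] := G_limit fM e0.
have [N hN] := inv_succ_lt d0.
exists N => // n /= Nn; rewrite distrC -[X in X * _]invrK mulrC; apply: hd.
by rewrite invr_gt0 ltr0n /= hN.
Qed.

Lemma transition_step M f eps : bounded_measurable M f -> 0 < eps ->
  exists2 delta : R, 0 < delta &
    forall u, 0 < u < delta -> forall x, `|transition u f x - f x - u * G f x| <= u * eps.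
Proof.
move=> fM e0; have [delta d0 hd] := G_limit fM e0; exists delta => // u ud x.
have u0 : 0 < u by case/andP: ud.
have := hd u x ud; rewrite -(ler_pM2l u0) -{1}(gtr0_norm u0) -normrM.
by rewrite mulrBr mulrCA mulfV ?gt_eqF// mulr1.
Qed.

Lemma transition_telescope M f u K k x : bounded_measurable M f -> 0 <= u ->
  (forall (j : nat) y, (j < k)%N ->
    `|transition (j.+1%:R * u) f y - transition (j%:R * u) f y - u * G f y| <= K) ->
  `|transition (k%:R * u) f x - f x - k%:R * u * G f x| <= k%:R * K.
Proof.
move=> fM u0; elim: k => [|k IH] hk.
  by rewrite !mul0r (transition0 _ fM) subrr subr0 normr0.
rewrite (_ : _ - _ = (transition (k.+1%:R * u) f x - transition (k%:R * u) f x - u * G f x)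
   + (transition (k%:R * u) f x - f x - k%:R * u * G f x)); last first.
  by rewrite -natr1; ring.
apply: le_trans (ler_normD _ _) _.
rewrite (natrSM k K); apply: lerD; first exact: hk.
by apply: IH => j y jk; apply: hk; exact: ltnW.
Qed.

Lemma transition_incr M f u j y : bounded_measurable M f -> 0 <= u ->
  transition (j.+1%:R * u) f y - transition (j%:R * u) f y =
  transition (j%:R * u) (fun z => transition u f z - f z) y.
Proof.
move=> fM u0; rewrite -natr1 mulrDl mul1r (transitionD _ _ _ fM)//; last first.
  by rewrite mulr_ge0.
by rewrite [RHS](Rintegral_probB _ (transition_bounded u fM) fM).
Qed.

Lemma transition_mesh t delta : 0 < t -> 0 < delta ->
  exists (n : nat) (u : R), 0 < u < delta /\ t = n%:R * u.
Proof.
move=> t0 d0; have [n hn] := inv_succ_lt (divr_gt0 d0 t0).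
exists n.+1, (t / n.+1%:R); split; last by rewrite mulrC divfK// pnatr_eq0.
rewrite divr_gt0 ?ltr0n//= mulrC -ltr_pdivlMr//; exact: hn.
Qed.

(** The derivative at 0 is controlled only within a [delta] that depends on [f], so the interval is
    cut into steps [u < delta]. Each increment is a kernel average of [transition u f - f], hence at
    most [u * (c * M + e / t)]; the sum is [t * (c * M) + e], with [e] arbitrary. *)
Lemma transition_lipschitz M f t x : bounded_measurable M f -> 0 <= t ->
  `|transition t f x - f x| <= t * (c * M).
Proof.
move=> fM; rewrite le_eqVlt => /predU1P[<-|t0].
  by rewrite (transition0 _ fM) subrr normr0 mul0r.
rewrite -[leRHS]addr0; apply/ler_addgt0Pr => _ /posnumP[e].
have et0 : 0 < e%:num / t by rewrite divr_gt0.
have [delta d0 hd] := transition_step fM et0.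
have [k [u [/andP[u0 ud] tE]]] := transition_mesh t0 d0.
have step y : `|transition u f y - f y| <= u * (c * M + e%:num / t).
  rewrite -[X in `|X|](subrK (u * G f y)) mulrDr addrC.
  apply: le_trans (ler_normD _ _) _; apply: lerD.
    by rewrite normrM gtr0_norm// ler_pM2l// (G_bound fM).
  by apply: hd; rewrite u0.
have dM : bounded_measurable (u * (c * M + e%:num / t)) (fun z => transition u f z - f z).
  by split => //; exact: (bounded_measurableB (transition_bounded u fM) fM).1.
have : `|transition (k%:R * u) f x - f x| <= k%:R * (u * (c * M + e%:num / t)).
  elim: (k) => [|j IH]; first by rewrite !mul0r (transition0 _ fM) subrr normr0.
  rewrite (natrSM j (u * _)).
  apply: le_trans (ler_distD (transition (j%:R * u) f x) _ _) _.
  apply: lerD => //; rewrite (transition_incr _ _ fM (ltW u0)).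
  exact: (transition_bounded _ dM).2.
rewrite -tE mulrA -tE mulrDr addr0 => /le_trans; apply.
by rewrite lerD2l mulrCA mulfV ?mulr1// gt_eqF.
Qed.

(** Each increment over a fine mesh is a kernel average of [u * G f] up to [u * (e / t)], and
    averaging moves [G f], which is bounded by [c * M], by at most [t * (c * (c * M))] according to
    [transition_lipschitz]. The gain is an error that depends on [f] only through [M], as is needed
    when the function changes at every step of the chain. *)
Lemma transition_expansion M f t x : bounded_measurable M f -> 0 <= t ->
  `|transition t f x - f x - t * G f x| <= c ^+ 2 * M * t ^+ 2.
Proof.
move=> fM; rewrite le_eqVlt => /predU1P[<-|t0].
  by rewrite (transition0 _ fM) subrr mul0r subr0 normr0 expr0n mulr0.
rewrite -[leRHS]addr0; apply/ler_addgt0Pr => _ /posnumP[e].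
have et0 : 0 < e%:num / t by rewrite divr_gt0.
have [delta d0 hd] := transition_step fM et0.
have [k [u [/andP[u0 ud] tE]]] := transition_mesh t0 d0.
have GM := G_bounded_measurable fM.
have dM : bounded_measurable (u * (e%:num / t)) (fun z => transition u f z - f z - u * G f z).
  split; last by apply: hd; rewrite u0.
  exact: (bounded_measurableB (bounded_measurableB (transition_bounded u fM) fM)
  (bounded_measurableZ u GM)).1.
have : `|transition (k%:R * u) f x - f x - k%:R * u * G f x| <=
   k%:R * (u * (e%:num / t) + u * (t * (c * (c * M)))).
  apply: (transition_telescope _ fM) => [|j y jk]; first exact: ltW.
  rewrite (transition_incr _ _ fM (ltW u0)).
  have -> : transition (j%:R * u) (fun z => transition u f z - f z) y =
    transition (j%:R * u) (fun z => transition u f z - f z - u * G f z) y +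
    u * transition (j%:R * u) (G f) y.
    rewrite [X in _ = X + _](Rintegral_probB _ (bounded_measurableB (transition_bounded u fM) fM)
  (bounded_measurableZ u GM))//.
    by rewrite (Rintegral_probZ _ _ GM)// subrK.
  rewrite -addrA -mulrBr; apply: le_trans (ler_normD _ _) _; apply: lerD.
    exact: (transition_bounded _ dM).2.
  rewrite normrM gtr0_norm// ler_pM2l//.
  have ju : 0 <= j%:R * u by rewrite mulr_ge0// ltW.
  apply: le_trans (transition_lipschitz y GM ju) _.
  apply: ler_wpM2r; first exact: le_trans (normr_ge0 _) ((G_bounded_measurable GM).2 x).
  by rewrite tE ler_pM2r// ler_nat ltnW.
rewrite -tE => /le_trans; apply; rewrite addr0 -mulrDr mulrA -tE mulrDr addrC.
rewrite [t * (e%:num / t)]mulrCA mulfV ?gt_eqF// mulr1 lerD2r.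
by rewrite le_eqVlt; apply/orP; left; apply/eqP; ring.
Qed.

End Semigroup.

(** * The generator on books of natural prices *)

Section BookGenerator.
Context (R : realType).
Context (dJ : measure_display) (TJ : measurableType dJ) (PJ : probability TJ R).
Variables (J : {RV PJ >-> R}) (jstar : nat).
Hypothesis J_range : {ae PJ, forall w, exists k : int,
  (- jstar%:Z <= k <= 1)%R /\ J w = k%:~R}.

(** The [jstar + 2] letters stand for the values 1, 0, ..., -jstar of [J]. *)
Definition jump_prob (i : 'I_jstar.+2) : R := fine (PJ (J @^-1` [set 1 - i%:R])).

Lemma jump_prob_ge0 i : 0 <= jump_prob i.
Proof. by rewrite fine_ge0. Qed.

Let mJ (x : R) : measurable (J @^-1` [set x]).
Proof. by rewrite -[X in measurable X]setTI; exact: measurable_funP. Qed.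

Lemma jump_probE (i : 'I_jstar.+2) : PJ (J @^-1` [set 1 - i%:R]) = (jump_prob i)%:E.
Proof. by rewrite /jump_prob fineK// fin_num_measure. Qed.

Lemma expectation_jump (g : R -> R) : measurable_fun setT (fun w => g (J w)) ->
  'E_PJ[fun w => g (J w)]%E = (\sum_i jump_prob i * g (1 - i%:R))%:E.
Proof.
move=> mg; rewrite unlock.
pose A (i : 'I_jstar.+2) := J @^-1` [set 1 - i%:R : R].
have mA i : measurable (A i) by exact: mJ.
have mterm (i : 'I_jstar.+2) : measurable_fun setT (fun w => (g (1 - i%:R) * \1_(A i) w)%:E).
  by apply/measurable_EFinP; apply: measurable_funM => //; exact: measurable_indic.
rewrite (@ae_eq_integral _ _ _ _ _
  (fun w => \sum_(i < jstar.+2) (g (1 - i%:R) * \1_(A i) w)%:E)%E)//=; last 3 first.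
- exact/measurable_EFinP.
- exact: emeasurable_sum.
- have := J_range; apply: filterS => w [k [/andP[k1 k2] Jk]] _.
  have kI : (`|1 - k| < jstar.+2)%N by lia.
  have Jw : J w = 1 - `|1 - k|%N%:R.
    by rewrite natr_absz ger0_norm; [rewrite Jk intrB; ring | lia].
  rewrite (bigD1 (Ordinal kI))//= big1 => [|i ik].
    rewrite adde0 indicE (_ : w \in _) ?mulr1 -?Jw//.
    exact/mem_set.
  rewrite indicE (_ : w \in _ = false) ?mulr0//.
  apply/negbTE/negP => /set_mem; rewrite /A /= Jk => ki.
  move: ik => /eqP; apply; apply/val_inj => /=.
  have : (1 - k)%:~R = (i%:Z)%:~R :> R by rewrite intrB ki -pmulrn; ring.
  by move=> /eqP; rewrite eqr_int => /eqP; lia.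
rewrite integral_sum//; last first.
  move=> i; under eq_fun do rewrite EFinM.
  by apply: integrableZl => //; exact: integrable_indic.
rewrite -sumEFin; apply: eq_bigr => i _.
under eq_integral do rewrite EFinM.
rewrite integralZl//; last exact: integrable_indic.
transitivity ((g (1 - i%:R)%R)%:E * PJ (J @^-1` [set (1 - i%:R)%R : R]))%E.
  by congr (_ * _)%E; rewrite integral_indic// setIT.
by rewrite jump_probE -EFinM mulrC.
Qed.

Lemma sum_jump_prob : \sum_i jump_prob i = 1.
Proof.
have := @expectation_jump (fun=> 1) (measurable_cst _).
rewrite expectation_cst => -[->].
by apply: eq_bigr => i _; rewrite mulr1.
Qed.

(** 1 is the only positive value of [J], so without it the mean would be at most 0. *)
Lemma jump_prob0_gt0 : (0 < 'E_PJ[J])%E -> 0 < jump_prob ord0.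
Proof.
rewrite (@expectation_jump id)//= lte_fin.
move=> EJ0; rewrite lt_neqAle jump_prob_ge0 andbT; apply: contraTneq EJ0 => p0.
rewrite -leNgt sumr_le0// => i _; have [i0|i0] := eqVneq i ord0.
  by rewrite i0 -p0 mul0r.
rewrite mulr_ge0_le0 ?jump_prob_ge0// subr_le0 ler1n lt0n.
by apply: contra i0 => /eqP i0; apply/eqP/val_inj.
Qed.

Variable lam : R.
Hypothesis lam_gt0 : 0 < lam.

Let bids (nu : pmT R) (w : TJ) : pmT R := add_order nu (pos_part (price nu + J w)).

Let mbids nu : measurable_fun setT (bids nu).
Proof. by apply: measurable_add_order; exact: measurable_funD. Qed.

(** Two kinds of moves at rate [lam], each changing [f] by at most [2 * M]. *)
Lemma book_generator_bound M (f : pmT R -> R) : bounded_measurable M f ->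
  forall nu, `|book_generator lam J f nu| <= 4 * lam * M.
Proof.
move=> fM nu; have M0 : 0 <= M by apply: le_trans (fM.2 nu).
have h1 x y : `|f x - f y| <= 2 * M.
  by apply: le_trans (ler_normB _ _) _; rewrite mulr2n mulrDl mul1r lerD ?fM.2.
rewrite /book_generator (_ : 4 * lam * M = lam * (2 * M) + lam * (2 * M)); last by ring.
apply: le_trans (ler_normD _ _) _; apply: lerD; rewrite ?normrM (gtr0_norm lam_gt0).
  rewrite ler_pM2l// unlock; apply: Rintegral_prob_bound; first exact: probability_setT.
  split; last by move=> w; exact: h1.
  by apply: measurable_funB => //; apply: measurableT_comp (mbids nu) => //; exact: fM.1.
case: (_ != _); rewrite ?normr1 ?normr0 ?mulr1 ?mulr0 ?ler_pM2l//.
exact: mulr_ge0 (ltW lam_gt0) (mulr_ge0 _ M0).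
Qed.

Lemma euler_book (h : R) M (f : pmT R -> R) s : bounded_measurable M f ->
  euler lam h jump_prob (fun s' => f (book_of R s')) s =
  f (book_of R s) + h * book_generator lam J f (book_of R s).
Proof.
move=> fM; rewrite /book_generator.
rewrite (@expectation_jump (fun x => f (add_order (book_of R s)
   (pos_part (price (book_of R s) + x))) - f (book_of R s))); last first.
  apply: measurable_funB => //.
  exact: (measurableT_comp fM.1 (mbids (book_of R s))).
rewrite /=; under eq_bigr do rewrite -book_of_add mulrBr.
rewrite sumrB -mulr_suml sum_jump_prob mul1r -book_of_remove book_of_eq0 /euler.
have [->|_] := eqVneq s [::]; last by rewrite /=; ring.
by rewrite /drop_top /= mulr0; ring.
Qed.

Section Kernel.
Variable kappa : R -> R.-pker pmT R ~> pmT R.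
Hypothesis ksemi : transition_semigroup kappa.
Hypothesis kgen : has_book_generator lam J kappa.

(** The factor [c ^+ 2] of [transition_expansion], with the bound [c = 4 * lam] of the generator. *)
Definition step_error : R := (4 * lam) ^+ 2.

Lemma step_error_ge0 : 0 <= step_error. Proof. exact: sqr_ge0. Qed.

Lemma transition_euler M h (f : pmT R -> R) s : bounded_measurable M f -> 0 <= h ->
  `|transition kappa h f (book_of R s)
    - euler lam h jump_prob (fun s' => f (book_of R s')) s| <= step_error * M * h ^+ 2.
Proof.
move=> fM h0; rewrite (euler_book _ _ fM) opprD addrA.
apply: (@transition_expansion _ _ _ kappa _ (book_generator lam J) (4 * lam)) => //.
- exact: ksemi.2.
- exact: book_generator_bound.
- move=> M' g gM eps e0.
  have := kgen gM.1 (ex_intro _ M' gM.2) e0.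
  move=> [delta /= d0 hd]; exists delta => // t x /andP[t0 td].
  by apply: hd => //=; rewrite sub0r normrN gtr0_norm.
- exact: ksemi.1.
Qed.

(** The chain never leaves the natural books, and the indicator of their complement vanishes on
    them. Over [k] steps of length [u] with [t = k * u], the kernel therefore deviates by at most
    [k * step_error * u ^ 2], which tends to 0 with [u]. *)
Lemma kernel_natural t s : 0 <= t -> kappa t (book_of R s) (~` @natural_books R) = 0%E.
Proof.
have mN : measurable (~` @natural_books R).
  by apply: measurableC; exact: measurable_natural_books.
pose f : pmT R -> R := \1_(~` @natural_books R).
have f1 : bounded_measurable 1 f.
  split; first exact: measurable_indic.
  by move=> x; rewrite /f indicE; case: (_ \in _); rewrite ?normr1 ?normr0.
have trE u x : (transition kappa u f x)%:E = kappa u x (~` @natural_books R).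
  rewrite /transition /Rintegral integral_indic// setIT fineK//.
  exact: (finite_kernel_measure (kappa u) x).
have fB s' : f (book_of R s') = 0.
  rewrite /f indicE (_ : _ \in _ = false)//.
  by apply/negbTE/negP => /set_mem; apply; exists s'.
have step (k : nat) (u : R) s' : 0 <= u ->
    2 * lam * u <= 1 ->
    transition kappa (k%:R * u) f (book_of R s') <= k%:R * (step_error * u ^+ 2).
  move=> u0 lu; elim: k s' => [|k IH] s'.
    by rewrite !mul0r (transition0 ksemi.1 _ f1) fB.
  have ku0 : 0 <= k%:R * u by rewrite mulr_ge0.
  rewrite (natrSM k u) (natrSM k (_ * _)) (transitionD ksemi.2 _ u0 ku0 f1).
  have fk := transition_bounded kappa (k%:R * u) f1.
  have := transition_euler s' fk u0.
  rewrite ler_distl mulr1 => /andP[_ hle]; apply: le_trans hle _; rewrite addrC lerD2l.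
  rewrite -[leRHS](euler_cst lam u sum_jump_prob _ s').
  apply: euler_le => //; first exact: ltW.
  exact: jump_prob_ge0.
rewrite le_eqVlt => /predU1P[<-|t0].
  rewrite ksemi.1// diracE (_ : _ \in _ = false)//.
  by apply/negbTE/negP => /set_mem; apply; exists s.
apply/eqP; rewrite -trE eqe; apply/eqP/le_anti/andP; split; last first.
  by rewrite -lee_fin trE.
apply/ler_addgt0Pr => e e0; rewrite add0r.
have st0 : 0 < t * step_error + 1.
  by apply: ltr_wpDl => //; apply: mulr_ge0; [exact: ltW | exact: step_error_ge0].
have d0 : 0 < Num.min ((2 * lam)^-1) (e / (t * step_error + 1)).
  by rewrite lt_min invr_gt0 mulr_gt0//= divr_gt0.
have [k [u [/andP[u0]]]] := transition_mesh t0 d0.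
rewrite lt_min => /andP[u1 u2] tE.
have := step k u s (ltW u0); rewrite -tE => /(_ _)/le_trans; apply.
  by rewrite mulrC -ler_pdivlMr ?div1r ?ltW// mulr_gt0.
have -> : k%:R * (step_error * u ^+ 2) = u * (t * step_error) by rewrite tE; ring.
rewrite ltr_pdivlMr// in u2; apply: le_trans (ltW u2).
by rewrite mulrDr mulr1 lerDl ltW.
Qed.

End Kernel.
End BookGenerator.

(** * The book observed on a mesh *)

Section MeshBound.
Context (R : realType) (lam : R).
Context (dJ : measure_display) (TJ : measurableType dJ) (PJ : probability TJ R).
Variables (J : {RV PJ >-> R}) (jstar : nat).
Hypothesis lam_gt0 : 0 < lam.
Hypothesis J_range : {ae PJ, forall w, exists k : int,
  (- jstar%:Z <= k <= 1)%R /\ J w = k%:~R}.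
Variable kappa : R -> R.-pker pmT R ~> pmT R.
Hypothesis ksemi : transition_semigroup kappa.
Hypothesis kgen : has_book_generator lam J kappa.
Context (d : measure_display) (T : measurableType d) (P : probability T R).
Variable X : R -> T -> pmT R.
Hypothesis mX : forall t, 0 <= t -> measurable_fun setT (X t).
Hypothesis markov : markov_with P kappa X.
Implicit Types (B : pred (seq nat)) (s : seq nat) (t h : R).

Local Notation p := (@jump_prob R dJ TJ PJ J jstar).
Local Notation Pr h := (euler_prob lam h p).

Lemma measurable_book_event t s : 0 <= t -> measurable [set w | X t w = book_of R s].
Proof.
move=> t0; rewrite -[X in measurable X]setTI.
exact: (mX t0 measurableT (measurable_set1_pmT (book_of R s))).
Qed.

(* At the times [t + (k + 1) h, ..., t + (k + N) h] the book has its orders at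
   natural prices and the list of its prices is in [B]. *)
Fixpoint mesh_event t h N k B : set T :=
  if N is N'.+1 then
    \bigcup_s ([set w | X (t + k.+1%:R * h) w = book_of R s] `&`
               mesh_event t h N' k.+1 (fun l => B (top s :: l)))
  else if B [::] then setT else set0.

Lemma measurable_mesh_event t h N k B : 0 <= t -> 0 <= h -> measurable (mesh_event t h N k B).
Proof.
move=> t0 h0; elim: N k B => [|N IH] k B /=; first by case: ifP.
apply: countable_bigcupT_measurable => // s; apply: measurableI => //.
by apply: measurable_book_event; rewrite addr_ge0// mulr_ge0.
Qed.

Lemma mesh_eventP t h N k B w : mesh_event t h N k B w <->
  exists ss : seq (seq nat), [/\ size ss = N,
    forall i, (i < N)%N -> X (t + (k + i).+1%:R * h) w = book_of R (nth [::] ss i) &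
    B [seq top s | s <- ss]].
Proof.
elim: N k B => [|N IH] k B /=.
  split=> [|[ss [/eqP]]]; last by rewrite size_eq0 => /eqP -> _ /= ->.
  by case: ifP => // Bn _; exists [::].
split=> [[s _ [Xs /IH[ss [<- hs Bs]]]]|[[|s ss] [//= [sN] hs Bs]]].
  exists (s :: ss); split => // -[|i] iN /=; first by rewrite addn0.
  by rewrite addnS -addSn; exact: hs.
exists s => //; split; first by have := hs 0%N isT; rewrite addn0.
by apply/IH; exists ss; split => // i iN; have := hs i.+1 iN; rewrite addnS -addSn.
Qed.

Lemma historyW t A : history X t A -> measurable A.
Proof.
have : sigma_algebra setT (@measurable _ T).
  split; [exact: measurable0 | by move=> D mD; apply: measurableD |].
  by move=> F mF; exact: bigcup_measurable.
move=> sT; apply: smallest_sub => // _ [s [B [/andP[s0 _] mB ->]]].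
by rewrite -[X in measurable X]setTI; exact: mX.
Qed.

Lemma history_le u t A : u <= t -> history X u A -> history X t A.
Proof.
move=> ut; apply: sub_sigma_algebra2 => _ [v [B [/andP[v0 vu] mB ->]]].
by exists v, B; rewrite v0 (le_trans vu ut).
Qed.

Lemma historyI t (A B : set T) : history X t A -> history X t B -> history X t (A `&` B).
Proof. exact: (@measurableI _ (g_sigma_algebraType _)). Qed.

Lemma history_book t s : 0 <= t -> history X t [set w | X t w = book_of R s].
Proof.
move=> t0; apply: sub_sigma_algebra; exists t, [set book_of R s : pmT R].
by split => //; [rewrite t0 lexx | exact: measurable_set1_pmT].
Qed.

Lemma markov_from_book t h A s (B : set (pmT R)) : 0 <= t -> 0 <= h -> history X t A ->
  A `<=` [set w | X t w = book_of R s] -> measurable B ->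
  P (A `&` X (t + h) @^-1` B) = (P A * kappa h (book_of R s) B)%E.
Proof.
move=> t0 h0 hA As mB; rewrite (markov h0 t0 hA mB).
rewrite (eq_integral (cst (kappa h (book_of R s) B))); last first.
  by move=> w /set_mem /As /= ->.
rewrite integral_cst; [exact: muleC | exact: historyW hA].
Qed.

(* Only sorted lists are kept, so that no book is enumerated twice. *)
Let F (n : nat) : set (pmT R) :=
  if @pickle_inv (seq nat) n is Some s then
    if sorted leq s then [set book_of R s : pmT R] else set0
  else set0.

Let F_cover (nu : pmT R) s : nu = book_of R s ->
  exists n s', [/\ F n nu, @pickle_inv (seq nat) n = Some s' & perm_eq s' s].
Proof.
move=> nus; exists (choice.pickle (sort leq s)), (sort leq s).
rewrite /F pickleK_inv (sort_sorted ssrnat.leq_total) ?perm_sort//.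
split => //; rewrite nus /=; apply/eq_seq_msetP; apply: perm_map.
by rewrite perm_sym perm_sort.
Qed.

Let F_triv : trivIset setT F.
Proof.
apply/trivIsetP => i j _ _ ij; apply/seteqP; split => // nu []; rewrite /F.
case ui : (@pickle_inv (seq nat) i) => [s|//]; case: ifP => // ss /= nus.
case uj : (@pickle_inv (seq nat) j) => [s'|//]; case: ifP => // ss' /= nus'.
have : perm_eq s s' by apply: (@book_of_eq R); rewrite -nus.
move=> /(sorted_eq leq_trans anti_leq ss ss') sE; move: ij; rewrite -sE in uj.
have := @pickle_invK (seq nat) i; have := @pickle_invK (seq nat) j.
by rewrite /oapp ui uj => <- <-; rewrite eqxx.
Qed.

Let mF n : measurable (F n).
Proof. by rewrite /F; case: pickle_inv => // s; case: ifP => // _; exact: measurable_set1_pmT. Qed.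

(* Replacing the transition kernel by one Euler step costs [step_error * h ^+ 2]
   at each of the [N] steps. *)
Lemma mesh_bound t h N k A s B : 0 <= t -> 0 < h -> 2 * lam * h <= 1 ->
  history X (t + k%:R * h) A ->
  A `<=` [set w | X (t + k%:R * h) w = book_of R s] ->
  (P (A `&` mesh_event t h N k B) <=
   P A * (Pr h N B s + N%:R * (step_error lam * h ^+ 2))%:E)%E.
Proof.
move=> t0 h0 lh.
have p0 := @jump_prob_ge0 _ _ _ _ J jstar.
have p1 := sum_jump_prob J_range.
have h0' := ltW h0.
have l0 := ltW lam_gt0.
elim: N k A s B => [|N IH] k A s B hA As.
  rewrite /= mul0r addr0; case: (B [::]); first by rewrite setIT mule1.
  by rewrite setI0 measure0 mule0.
have tk0 : 0 <= t + k%:R * h by rewrite addr_ge0// mulr_ge0// ltW.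
have tk1 : 0 <= t + k.+1%:R * h by rewrite addr_ge0// mulr_ge0// ltW.
have tS : t + k.+1%:R * h = t + k%:R * h + h by rewrite -natr1; ring.
pose c : R := N%:R * (step_error lam * h ^+ 2).
have c0 : 0 <= c by rewrite !mulr_ge0// ?step_error_ge0 ?ltW// exprn_gt0.
pose q s' := Pr h N (fun l => B (top s' :: l)) s'.
have q_perm s1 s2 : perm_eq s1 s2 -> q s1 = q s2.
  by move=> s12; rewrite /q (top_perm s12); exact: euler_prob_perm.
have q0 s' : 0 <= q s' by apply: euler_prob_ge0.
have q1 s' : q s' <= 1 by apply: euler_prob_le1.
(* The probability that the chain passes the remaining test, as a function of the book at the next
   mesh time. By [q_perm] it does not depend on the chosen list; with the value 0 off the natural
   books it is measurable and bounded by 1, so [transition_euler] applies to it. *)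
pose phi (nu : pmT R) : R :=
  if pselect (exists s, nu = book_of R s) is left e then q (projT1 (cid e)) else 0.
have phiE s' : phi (book_of R s') = q s'.
  rewrite /phi; case: pselect => [e|]; last by case; exists s'.
  by case: cid => s'' /= /esym e'; apply/q_perm/(@book_of_eq R).
have phi0 nu : 0 <= phi nu by rewrite /phi; case: pselect.
have phi1 : bounded_measurable 1 phi.
  split; last by move=> nu; rewrite ger0_norm//; rewrite /phi; case: pselect.
  move=> _ Y mY; rewrite setTI.
  rewrite -[X in measurable X]setIT -(setUv (@natural_books R)) setIUr.
  apply: measurableU; first by apply: measurable_natural_books => nu [].
  have [Y0|Y0] := pselect (Y 0).
    rewrite (_ : _ `&` _ = ~` @natural_books R); last first.
      apply/seteqP; split => nu => [[]//|nN]; split => //=.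
      by rewrite /phi; case: pselect.
    by apply: measurableC; exact: measurable_natural_books.
  rewrite (_ : _ `&` _ = set0)//; apply/seteqP; split => // nu [/=].
  by rewrite /phi; case: pselect.
pose E n := A `&` X (t + k.+1%:R * h) @^-1` F n.
pose G n := if @pickle_inv (seq nat) n is Some s' then
   mesh_event t h N k.+1 (fun l => B (top s' :: l)) else set0.
have hE n : history X (t + k.+1%:R * h) (E n).
  apply: historyI; first by apply: history_le hA; rewrite tS lerDl ltW.
  by apply: sub_sigma_algebra; exists (t + k.+1%:R * h), (F n); rewrite tk1 lexx.
have mG n : measurable (G n).
  by rewrite /G; case: pickle_inv => // s'; apply: measurable_mesh_event => //; exact: ltW.
have mE n : measurable (E n) := historyW (hE n).
(* The next book is split along the disjoint sets [F n]. On each of them the induction hypothesis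
   applies with [E n] as the past; as [phi] is constant on [F n], the bounds add up to a single
   integral against [kappa h]. *)
have sub : A `&` mesh_event t h N.+1 k B `<=` \bigcup_n (E n `&` G n).
  move=> w [Aw [s' _ [Xs' Gw]]].
  have [n [s'' [Fn un pn]]] := F_cover Xs'.
  exists n => //; split => //; rewrite /G un.
  by rewrite (top_perm pn).
apply: (@le_trans _ _ (\sum_(n <oo) P (E n `&` G n))%E).
  apply: measure_sigma_subadditive => //.
    by move=> n; exact: measurableI.
  by apply: measurableI; [exact: historyW hA | apply: measurable_mesh_event => //; exact: ltW].
have PE n : P (E n) = (P A * kappa h (book_of R s) (F n))%E.
  by rewrite /E tS (markov_from_book tk0 (ltW h0) hA As).
have PEG n : (P (E n `&` G n) <= P A * \int[kappa h (book_of R s)]_(nu in F n) (phi nu + c)%:E)%E.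
  have : forall s', @pickle_inv (seq nat) n = Some s' -> sorted leq s' ->
     (P (E n `&` G n) <= P A * (kappa h (book_of R s) (F n) * (phi (book_of R s') + c)%:E))%E.
    move=> s' un ss; rewrite muleA -PE phiE.
    have -> : G n = mesh_event t h N k.+1 (fun l => B (top s' :: l)) by rewrite /G un.
    by apply: IH => //; move=> w [_]; rewrite /= /F un ss.
  move=> h1; case un : (@pickle_inv (seq nat) n) => [s'|]; last first.
    rewrite /G un setI0 measure0 mule_ge0//; apply: integral_ge0 => nu _.
    by rewrite lee_fin addr_ge0.
  case ss : (sorted leq s'); last first.
    rewrite /E /F un ss preimage_set0 setI0 set0I measure0 mule_ge0//.
    by apply: integral_ge0 => nu _; rewrite lee_fin addr_ge0.
  apply: le_trans (h1 _ un ss) _.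
  rewrite (eq_integral (cst (phi (book_of R s') + c)%:E)); last first.
    by move=> nu /set_mem; rewrite /F un ss => ->.
  by rewrite integral_cst// [in leRHS](muleC (phi _ + c)%:E).
apply: (@le_trans _ _ (\sum_(n <oo)
  P A * \int[kappa h (book_of R s)]_(nu in F n) (phi nu + c)%:E)%E).
  by apply: lee_nneseries => // n _ _; exact: measure_ge0.
have PAf : P A = (fine (P A))%:E by rewrite fineK// fin_num_measure//; exact: historyW hA.
have mphic D : measurable_fun D (fun nu => (phi nu + c)%:E).
  apply: measurable_funTS; apply/measurable_EFinP.
  by apply: measurable_funD => //; exact: phi1.1.
rewrite PAf nneseriesZl; last first.
  by move=> n _; apply: integral_ge0 => nu _; rewrite lee_fin addr_ge0.
apply: lee_pmul => //; first by rewrite lee_fin fine_ge0.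
  by apply: nneseries_ge0 => n _ _; apply: integral_ge0 => nu _; rewrite lee_fin addr_ge0.
rewrite -ge0_integral_bigcup//; last by move=> nu _; rewrite lee_fin addr_ge0.
have phic : bounded_measurable (1 + `|- c|) (fun nu => phi nu - (- c)).
  by apply: bounded_measurableB => //; exact: bounded_measurable_cst.
apply: (@le_trans _ _ (\int[kappa h (book_of R s)]_nu (phi nu + c)%:E)%E).
  apply: ge0_subset_integral => //; first exact: bigcup_measurable.
  by move=> nu _; rewrite lee_fin addr_ge0.
have k1 : kappa h (book_of R s) setT = 1%E by exact: prob_kernel.
have -> : (\int[kappa h (book_of R s)]_nu (phi nu + c)%:E)%E =
    (transition kappa h phi (book_of R s) + c)%:E.
  rewrite -[in RHS](opprK c) -(Rintegral_prob_cst k1 (- c))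
    -(Rintegral_probB k1 phi1 (bounded_measurable_cst _ (- c))).
  rewrite /Rintegral fineK; first by under [in RHS]eq_integral do rewrite opprK.
  exact: integrable_fin_num (bounded_measurable_integrable k1 phic).
rewrite lee_fin natrSM addrCA addrC [leRHS]addrC.
have := transition_euler J_range lam_gt0 ksemi kgen s phi1 (ltW h0).
rewrite mulr1 ler_distl => /andP[_].
have -> : euler lam h p (fun s' => phi (book_of R s')) s = Pr h N.+1 B s.
  by rewrite euler_probS; congr euler; apply/funext => s'; rewrite phiE.
by rewrite /c; lra.
Qed.

End MeshBound.

(** * Regularity of the paths *)

Section StepPaths.
Variable R : realType.
Implicit Types (nu mu : point_measure R) (u v : seq nat).

Lemma natural_booksP nu :
  (forall x, x \in atoms nu -> exists k, x = atom R k) -> @natural_books R nu.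
Proof.
move=> h.
have [s hs] : exists s, [seq atom R k | k <- s] = atoms nu.
  elim: (atoms nu) h => [|x l IH] h; first by exists [::].
  have [|s <-] := IH; first by move=> y yl; apply: h; rewrite inE yl orbT.
  have [k ->] := h x (mem_head _ _).
  by exists (k :: s).
by exists s; rewrite /book_of hs /atoms seq_mset_id.
Qed.

(** Continuous bump with value 1 at [c] and 0 at distance [e] or more, since weak convergence sees
    only continuous functions. With radius 1 and an integer centre it counts the orders at [c] in a
    natural book. *)
Definition tent (c e y : R) : R := Num.max 0 (1 - `|y - c| / e).

Lemma tent_ge0 c e y : 0 <= tent c e y. Proof. by rewrite le_max lexx. Qed.

Lemma tent_le1 c e y : 0 < e -> `|tent c e y| <= 1.
Proof.
move=> e0; rewrite ger0_norm ?tent_ge0// ge_max ler01/= lerBlDr lerDl divr_ge0//.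
exact: ltW.
Qed.

Lemma tent_bounded c e : 0 < e -> exists M, forall y, `|tent c e y| <= M.
Proof. by exists 1 => y; exact: tent_le1. Qed.

Lemma tent_center c e : tent c e c = 1.
Proof. by rewrite /tent subrr normr0 mul0r subr0 max_r. Qed.

Lemma tent_eq0 c e y : 0 < e -> e <= `|y - c| -> tent c e y = 0.
Proof. by move=> e0 ey; rewrite /tent max_l// subr_le0 ler_pdivlMr// mul1r. Qed.

Lemma continuous_tent c e : continuous (tent c e).
Proof.
move=> y; apply: (@continuous_max R R (fun=> 0) (fun y => 1 - `|y - c| / e)).
  exact: cvg_cst.
apply: cvgB; first exact: cvg_cst.
apply: cvgMr_tmp; apply: cvg_norm; apply: cvgB; [exact: cvg_id|exact: cvg_cst].
Qed.

Definition mass nu (phi : R -> R) : R := \sum_(x <- atoms nu) phi x%:num.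

Lemma mass_book u (phi : R -> R) : mass (book_of R u) phi = \sum_(k <- u) phi k%:R.
Proof. by rewrite /mass (perm_big _ (perm_book R u)) big_map. Qed.

Lemma mass_tent_ge1 nu x e : x \in atoms nu -> 1 <= mass nu (tent x%:num e).
Proof.
move=> xnu; rewrite /mass (big_rem x xnu) /= tent_center lerDl.
by apply: sumr_ge0 => y _; exact: tent_ge0.
Qed.

Lemma mass_tent_natural u (c : nat) :
  mass (book_of R u) (tent c%:R 1) = (count_mem c u)%:R.
Proof.
rewrite mass_book -sum1_count natr_sum [RHS]big_mkcond; apply: eq_bigr => k _ /=.
have [->|kc] := eqVneq k c; first by rewrite tent_center.
apply: tent_eq0 => //; rewrite -[1]/(1%:~R) !pmulrn -intrB -intr_norm ler_int.
by lia.
Qed.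

Lemma mass_cvg (F : set_system R) (x : R -> point_measure R) nu (phi : R -> R) :
  weak_cvg F x nu -> continuous phi -> (forall y, 0 <= phi y) ->
  (exists M, forall y, `|phi y| <= M) -> mass (x t) phi @[t --> F] --> mass nu phi.
Proof.
move=> xnu cphi phi0 phiM; have := xnu phi cphi phiM.
rewrite Rintegral_pm_measure//; under eq_fun do rewrite Rintegral_pm_measure//.
exact.
Qed.

Section Filter.
Context (F : set_system R) (FF : ProperFilter F).
Variables (x : R -> point_measure R) (nu : point_measure R).
Hypothesis xnu : weak_cvg F x nu.

(** An atom of the limit at a non-integer price gives mass at least 1 to the tent whose radius is
    its distance to the nearest integer, whereas natural books give that tent mass 0. Natural books
    are required only frequently along the filter, so that rational times can be used. *)
Lemma weak_cvg_natural :
  (forall A, F A -> exists2 s, A s & @natural_books R (x s)) -> @natural_books R nu.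
Proof.
move=> frequent; apply: natural_booksP => y ynu; apply: contrapT => yN.
have y0 : 0 <= y%:num by [].
have /andP[ny yn1] := truncn_itv y0.
set n := Num.truncn _ in ny yn1.
have ny' : n%:R < y%:num.
  rewrite lt_neqAle ny andbT; apply/eqP => nyE; apply: yN; exists n.
  exact/val_inj.
pose e := Num.min (y%:num - n%:R) (n.+1%:R - y%:num).
have e0 : 0 < e by rewrite lt_min !subr_gt0 ny' yn1.
have h0 u : mass (book_of R u) (tent y%:num e) = 0.
  rewrite mass_book big1// => k _; apply: tent_eq0 => //; rewrite ge_min.
  have [kn|kn] := leqP k n; apply/orP; [left|right].
    rewrite distrC ger0_norm ?subr_ge0 ?lerD2l ?lerN2 ?ler_nat//.
    by apply: le_trans ny; rewrite ler_nat.
  rewrite ger0_norm ?subr_ge0 ?lerD2r ?ler_nat//.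
  by apply: le_trans (ltW yn1) _; rewrite ler_nat.
have := mass_cvg xnu (@continuous_tent y%:num e) (tent_ge0 y%:num e)
  (tent_bounded y%:num e0).
move=> /cvgrPdist_lt /(_ 1 ltr01) /frequent[s + [u xs]].
rewrite xs h0 subr0 ger0_norm; last by apply: sumr_ge0 => z _; exact: tent_ge0.
by rewrite ltNge mass_tent_ge1.
Qed.

Lemma near_natr_eq (f : R -> nat) (n : nat) :
  (f t)%:R @[t --> F] --> (n%:R : R) -> \forall t \near F, f t = n.
Proof.
move=> /cvgrPdist_lt /(_ 1 ltr01); apply: filterS => t.
rewrite -[1]/(1%:~R) !pmulrn -intrB -intr_norm ltr_int; lia.
Qed.

(** With equal sizes, the letters of [v] already exhaust [u]. So finitely many counts suffice, each
    of which is eventually right under weak convergence. *)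
Lemma perm_eq_count u v : size u = size v ->
  (forall c, c \in v -> count_mem c u = count_mem c v) -> perm_eq u v.
Proof.
move=> suv cuv.
have L l : uniq l -> {subset l <= v} -> count (mem l) u = count (mem l) v.
  elim: l => [|c l IH]; first by rewrite !(@eq_count _ (mem [::]) pred0)// !count_pred0.
  move=> /= /andP[cl ul] clv.
  have E w : count (mem (c :: l)) w = (count_mem c w + count (mem l) w)%N.
    rewrite -count_predUI [X in (_ + X)%N](@eq_count _ _ pred0) ?count_pred0 ?addn0.
      by apply: eq_count => z; rewrite /= inE.
    by move=> z /=; apply/negbTE; apply: contra cl => /andP[/eqP <-].
  rewrite !E IH// => [|z zl]; last by apply: clv; rewrite inE zl orbT.
  by rewrite cuv// clv// mem_head.
have uvv : {subset undup v <= v} by move=> z; rewrite mem_undup.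
have := L _ (undup_uniq v) uvv.
have vv : count (mem (undup v)) v = size v.
  by apply/eqP; rewrite -all_count; apply/allP => z; rewrite /= mem_undup.
rewrite vv -suv => /eqP; rewrite -all_count => /allP uv.
apply/allP => c; rewrite mem_cat => /orP[/uv|] /=; rewrite ?mem_undup => cv;
  by rewrite cuv.
Qed.

(** The total mass and the counts at fixed levels are integrals of continuous functions and take
    integer values on natural books, so convergence makes them eventually constant. *)
Lemma weak_cvg_eventually_eq : @natural_books R nu ->
  (\forall t \near F, @natural_books R (x t)) -> \forall t \near F, x t = nu.
Proof.
move=> [v nuv] xN.
pose u t := if pselect (exists u, x t = book_of R u) is left e then projT1 (cid e) else [::].
have uE : \forall t \near F, x t = book_of R (u t).
  apply: filterS xN => t xt; rewrite /u; case: pselect => //= e.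
  by case: cid.
have su : \forall t \near F, size (u t) = size v.
  apply: near_natr_eq.
  have c1 : continuous (fun _ : R => 1 : R) by move=> ?; exact: cvg_cst.
  have b1 : exists M : R, forall y : R, `|1 : R| <= M by exists `|1|.
  have := mass_cvg xnu c1 (fun=> ler01) b1.
  rewrite nuv mass_book big_const_seq count_predT iter_addr_0.
  apply: cvg_trans; apply: near_eq_cvg; apply: filterS uE => t ->.
  by rewrite mass_book big_const_seq count_predT iter_addr_0.
have cu (c : nat) : \forall t \near F, count_mem c (u t) = count_mem c v.
  apply: near_natr_eq.
  have := mass_cvg xnu (@continuous_tent c%:R 1) (tent_ge0 c%:R 1)
     (tent_bounded c%:R ltr01).
  rewrite nuv mass_tent_natural.
  apply: cvg_trans; apply: near_eq_cvg; apply: filterS uE => t ->.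
  by rewrite mass_tent_natural.
have cv (l : seq nat) : \forall t \near F, forall c, c \in l -> count_mem c (u t) = count_mem c v.
  elim: l => [|c l IH]; first by apply: filterE.
  apply: filterS2 (cu c) IH => t h1 h2 c'; rewrite inE => /orP[/eqP->//|]; exact: h2.
apply: filterS3 uE su (cv v) => t -> h1 h2; rewrite nuv.
by apply/eq_seq_msetP/perm_map/perm_eq_count.
Qed.

End Filter.

Lemma near_rightP (t : R) (Q : R -> Prop) : (\forall s \near t^'+, Q s) <->
  exists2 e : R, 0 < e & forall s, t < s < t + e -> Q s.
Proof.
split=> [[e /= e0 h]|[e e0 h]]; exists e => //= s.
  move=> /andP[ts st]; apply: h => //=; rewrite distrC gtr0_norm ?subr_gt0//.
  by rewrite ltrBlDl.
move=> /= + ts; rewrite distrC gtr0_norm ?subr_gt0// ltrBlDl => st.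
by apply: h; rewrite ts.
Qed.

Lemma near_leftP (t : R) (Q : R -> Prop) : (\forall s \near t^'-, Q s) <->
  exists2 e : R, 0 < e & forall s, t - e < s < t -> Q s.
Proof.
split=> [[e /= e0 h]|[e e0 h]]; exists e => //= s.
  move=> /andP[ts st]; apply: h => //=; rewrite gtr0_norm ?subr_gt0//.
  by rewrite ltrBlDr -ltrBlDl.
move=> /= + ts; rewrite gtr0_norm ?subr_gt0// ltrBlDr -ltrBlDl => st.
by apply: h; rewrite ts st.
Qed.

Variable x : R -> point_measure R.
Hypothesis x_cadlag : pm_cadlag x.
Hypothesis x_rational : forall q : rat, 0 <= ratr q :> R -> @natural_books R (x (ratr q)).

(** Almost sure statements can be combined over the rational times only; right continuity carries
    them to every time. *)
Lemma cadlag_natural t : 0 <= t -> @natural_books R (x t).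
Proof.
move=> t0; apply: (@weak_cvg_natural _ _ _ _ (x_cadlag.1 t t0)) => A /near_rightP[e e0 hA].
have [q] := rat_in_itvoo (ltr_pwDr e0 (lexx t)).
rewrite in_itv/= => tq; exists (ratr q); first exact: hA.
by apply: x_rational; apply: le_trans t0 (ltW _); case/andP: tq.
Qed.

Lemma cadlag_right t : 0 <= t ->
  exists2 e : R, 0 < e & forall s, t <= s < t + e -> x s = x t.
Proof.
move=> t0.
have [|e e0 he] := (near_rightP _ _).1
    (@weak_cvg_eventually_eq _ _ _ _ (x_cadlag.1 t t0) (cadlag_natural t0) _).
  by apply/near_rightP; exists 1 => // s /andP[ts _];
    apply: cadlag_natural; apply: le_trans (ltW ts).
exists e => // s; rewrite le_eqVlt => /andP[/predU1P[->//|ts] st].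
by apply: he; rewrite ts.
Qed.

Lemma cadlag_left t : 0 < t ->
  exists nu, exists2 e : R, 0 < e <= t & forall s, t - e < s < t -> x s = nu.
Proof.
move=> t0; have [nu xnu] := x_cadlag.2 t t0.
have nuN : @natural_books R nu.
  apply: (@weak_cvg_natural _ _ _ _ xnu) => A /near_leftP[e e0 hA].
  have h : Num.max 0 (t - e) < t by rewrite gt_max t0/= gtrBl.
  have [q] := rat_in_itvoo h.
  rewrite in_itv/= gt_max => /andP[/andP[q0 tq] qt]; exists (ratr q).
    by apply: hA; rewrite tq.
  by apply: x_rational; exact: ltW.
have [|e e0 he] := (near_leftP _ _).1 (@weak_cvg_eventually_eq _ _ _ _ xnu nuN _).
  apply/near_leftP; exists t => // s; rewrite subrr => /andP[s0 _].
  by apply: cadlag_natural; exact: ltW.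
exists nu, (Num.min e t); first by rewrite lt_min e0 t0 ge_min lexx orbT.
move=> s /andP[ts st]; apply: he; rewrite st andbT; apply: le_lt_trans ts.
by rewrite lerD2l lerN2 ge_min lexx.
Qed.

End StepPaths.

(** * Reading an excursion off a sampled path *)

Section ReadingExcursions.
Variables (a : nat) (G : nat -> nat).
Implicit Types (C : pred (seq nat)) (Cs : seq (pred (seq nat))).

Lemma test_excursions_below C Cs k K n : (k <= K < k + n)%N ->
  (forall i, (k <= i < K)%N -> (G i <= a)%N) -> (a < G K)%N ->
  test_excursions a (C :: Cs) None [seq G i | i <- iota k n] =
  test_excursions a (C :: Cs) (Some [:: G K - a]%N) [seq G i | i <- iota K.+1 (k + n - K.+1)].
Proof.
elim: n k => [|n IH] k; first by rewrite addn0; lia.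
move=> /andP[kK Kn] below above.
have [kKE|kK'] := eqVneq k K.
  by rewrite /= kKE leqNgt above /= addnS subSS addKn.
rewrite /= (below k) ?leqnn ?ltn_neqAle ?kK'//= IH; first by rewrite addSnnS.
- by move: kK kK' Kn; lia.
- by move=> i ik; apply: below; move: ik; lia.
- exact: above.
Qed.

Lemma test_excursions_above C Cs q k D n : (k <= D < k + n)%N ->
  (forall i, (k <= i < D)%N -> (a < G i)%N) -> (G D <= a)%N ->
  test_excursions a (C :: Cs) (Some q) [seq G i | i <- iota k n] =
  C (q ++ [seq G i - a | i <- iota k (D.+1 - k)])%N &&
  test_excursions a Cs None [seq G i | i <- iota D.+1 (k + n - D.+1)].
Proof.
elim: n k q => [|n IH] k q; first by rewrite addn0; lia.
move=> /andP[kD Dn] above below.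
have [kDE|kD'] := eqVneq k D.
  by rewrite kDE subSnn /= below addnS subSS addKn cats1.
have -> : (D.+1 - k = (D.+1 - k.+1).+1)%N by move: kD kD'; lia.
rewrite /= leqNgt (above k) ?leqnn ?ltn_neqAle ?kD'//= IH; first by rewrite addSnnS cat_rcons.
- by move: kD kD' Dn; lia.
- by move=> i ik; apply: above; move: ik; lia.
- exact: below.
Qed.

End ReadingExcursions.

(** * Excursions of a step path *)

Section PricePath.
Variable R : realType.
Implicit Types (F : R -> nat) (s t u h : R).

Definition step_path F :=
  (forall t, 0 <= t -> exists2 e : R, 0 < e & forall s, t <= s < t + e -> F s = F t) /\
  (forall t, 0 < t -> exists n, exists2 e : R, 0 < e <= t &
     forall s, t - e < s < t -> F s = n).

Lemma step_path_cadlag F (f : R -> R) (c : R) : step_path F ->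
  (forall t, 0 <= t -> f t = (F t)%:R - c) -> cadlag f.
Proof.
move=> [FR FL] fF; split=> t t0.
  have [e e0 he] := FR t t0; apply: cvg_near_cst; apply/near_rightP; exists e => // s /andP[ts st].
  by rewrite !fF ?he ?(ltW ts)// (le_trans t0)// ltW.
have [n [e /andP[e0 et] he]] := FL t t0.
apply/cvg_ex; exists (n%:R - c); apply: cvg_near_cst; apply/near_leftP; exists e => // s st.
by rewrite fF ?he//; apply: le_trans (_ : t - e <= s); rewrite ?subr_ge0// ltW//; case/andP: st.
Qed.

Lemma step_path_stopped F g d : 0 <= g <= d -> step_path F ->
  step_path (fun t => F (Num.min (g + t) d)).
Proof.
move=> /andP[g0 gd] [FR FL]; split=> t t0.
  have [gtd|dgt] := ltP (g + t) d; last first.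
    exists 1 => // s /andP[ts _]; congr F.
    by rewrite !min_r// (le_trans dgt)// lerD2l.
  have [e e0 he] := FR (g + t) (addr_ge0 g0 t0).
  exists (Num.min e (d - (g + t))); first by rewrite lt_min e0 subr_gt0.
  move=> s /andP[ts]; rewrite -ltrBlDl lt_min => /andP[st1 st2].
  rewrite min_l; last by lra.
  by apply: he; lra.
have [dgt|gtd] := ltP d (g + t).
  exists (F d), (Num.min t (g + t - d)); first by rewrite lt_min t0 subr_gt0 dgt ge_min lexx.
  move=> s /andP[st _]; congr F; rewrite min_r//.
  have : Num.min t (g + t - d) <= g + t - d by rewrite ge_min lexx orbT.
  by lra.
have [n [e /andP[e0 et] he]] := FL (g + t) (ltr_wpDl g0 t0).
exists n, (Num.min e t); first by rewrite lt_min e0 t0 ge_min lexx orbT.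
move=> s /andP[ts st].
have : Num.min e t <= e by rewrite ge_min lexx.
by move=> h; rewrite min_l; [apply: he|]; lra.
Qed.

(** The infimum of the hitting times is attained, because the path is constant just to the right of
    it. *)
Lemma first_hitting F (A : pred nat) s : step_path F -> 0 <= s ->
  (exists2 t, s <= t & A (F t)) ->
  exists u, [/\ s <= u, A (F u) & forall t, s <= t < u -> ~~ A (F t)].
Proof.
move=> [FR _] s0 [t0 st0 At0].
pose S : set R := [set t | s <= t /\ A (F t)].
have St0 : S t0 by [].
have lbS : has_lbound S by exists s => t [].
have infS : has_inf S by split => //; exists t0.
exists (inf S).
have su : s <= inf S by apply: lb_le_inf => [|t []//]; exists t0.
have lt_inf t : s <= t < inf S -> ~~ A (F t).
  move=> /andP[st tu]; apply: contraTN tu => At; rewrite -leNgt.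
  by apply: ge_inf.
split=> //; have [e e0 he] := FR (inf S) (le_trans s0 su).
have [t [st At] te] := inf_adherent e0 infS.
have iSt : inf S <= t by apply: ge_inf.
by rewrite -(he t)// iSt.
Qed.

Section Excursions.
Variables (a : nat) (F : R -> nat).
Hypothesis F_step : step_path F.
Hypothesis F_up : forall s, 0 <= s -> exists2 t, s <= t & (a < F t)%N.
Hypothesis F_down : forall s, 0 <= s -> exists2 t, s <= t & (F t <= a)%N.

Definition next_up s : R := xget 0 [set u : R |
  [/\ s <= u, (a < F u)%N & forall t, s <= t < u -> ~~ (a < F t)%N]].

Definition next_down s : R := xget 0 [set u : R |
  [/\ s <= u, (F u <= a)%N & forall t, s <= t < u -> ~~ (F t <= a)%N]].

Lemma next_upP s : 0 <= s -> [/\ s <= next_up s, (a < F (next_up s))%N &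
  forall t, s <= t < next_up s -> (F t <= a)%N].
Proof.
move=> s0; have [h1 h2 h3] := xgetPex 0 (first_hitting F_step s0 (F_up s0)).
by split => // t /h3; rewrite -leqNgt.
Qed.

Lemma next_downP s : 0 <= s -> [/\ s <= next_down s, (F (next_down s) <= a)%N &
  forall t, s <= t < next_down s -> (a < F t)%N].
Proof.
move=> s0; have [h1 h2 h3] :=
  xgetPex 0 (@first_hitting _ (fun k => k <= a)%N _ F_step s0 (F_down s0)).
by split => // t /h3; rewrite -ltnNge.
Qed.

Fixpoint start n : R := next_up (if n is n'.+1 then next_down (start n') else 0).

Definition stop n : R := next_down (start n).

Definition before n : R := if n is n'.+1 then stop n' else 0.

Lemma startE n : start n = next_up (before n). Proof. by case: n. Qed.

Lemma start_ge0 n : 0 <= start n.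
Proof.
elim: n => [|n IH] /=; first by have [] := next_upP (lexx 0).
have [h1 _ _] := next_downP IH; have := le_trans IH h1 => h2.
by have [h3 _ _] := next_upP h2; exact: le_trans h2 h3.
Qed.

Lemma stop_ge0 n : 0 <= stop n.
Proof. by have [h1 _ _] := next_downP (start_ge0 n); exact: le_trans (start_ge0 n) h1. Qed.

Lemma before_ge0 n : 0 <= before n. Proof. by case: n => [|n] //=; exact: stop_ge0. Qed.

Lemma price_start n : (a < F (start n))%N.
Proof. by rewrite startE; have [] := next_upP (before_ge0 n). Qed.

Lemma price_before n t : before n <= t < start n -> (F t <= a)%N.
Proof. by rewrite startE; have [_ _] := next_upP (before_ge0 n); apply. Qed.

Lemma price_stop n : (F (stop n) <= a)%N.
Proof. by have [] := next_downP (start_ge0 n). Qed.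

Lemma price_during n t : start n <= t < stop n -> (a < F t)%N.
Proof. by have [_ _] := next_downP (start_ge0 n); apply. Qed.

Lemma start_lt_stop n : start n < stop n.
Proof.
have [h1 _ _] := next_downP (start_ge0 n); rewrite lt_neqAle h1 andbT.
by apply: contraTneq (price_start n) => ->; rewrite -leqNgt price_stop.
Qed.

Hypothesis F0 : (F 0 <= a)%N.

Lemma price_before_le n : (F (before n) <= a)%N.
Proof. by case: n => [|n] //=; exact: price_stop. Qed.

Lemma before_lt_start n : before n < start n.
Proof.
rewrite startE; have [h1 h2 _] := next_upP (before_ge0 n).
rewrite lt_neqAle h1 andbT; apply: contraTneq h2 => <-.
by rewrite -leqNgt price_before_le.
Qed.

Lemma start_ltS n : start n < start n.+1.
Proof. exact: lt_trans (start_lt_stop n) (before_lt_start n.+1). Qed.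

(** If the starts were bounded, the path would be both above [a] and at most [a] arbitrarily close
    to the left of their supremum, where it is constant. *)
Lemma start_unbounded t : exists n, t < start n.
Proof.
apply: contrapT => /forallNP tn.
have bnd n : start n <= t by rewrite leNgt; apply/negP.
pose S := range start.
have hS : has_sup S by split; [exists (start 0), 0%N | exists t => _ [n _ <-]].
have lts n : start n < sup S.
  by apply: lt_le_trans (start_ltS n) _; apply: ub_le_sup => //; [exact: hS.2 | exists n.+1].
have s0 : 0 < sup S by apply: le_lt_trans (start_ge0 0) (lts 0%N).
have [n [e /andP[e0 _] he]] := F_step.2 _ s0.
have [_ [k _ <-] ke] := sup_adherent e0 hS.
have h1 := he (start k); have h2 := he (stop k).
have := price_start k; have := price_stop k.
rewrite h1 ?ke ?lts// h2; first by lia.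
rewrite (lt_trans ke (start_lt_stop k)) /=.
exact: lt_trans (before_lt_start k.+1) (lts k.+1).
Qed.

Hypothesis F_jump : forall t e n, 0 < e <= t ->
  (forall s, t - e < s < t -> F s = n) -> (n <= (F t).+1)%N.

(** Just before [stop n] the price exceeds [a], and it falls by at most one, so it cannot jump over
    [a]. This makes the shifted path end at 0. *)
Lemma price_stop_eq n : F (stop n) = a.
Proof.
apply/eqP; rewrite eqn_leq price_stop /=.
have s0 : 0 < stop n by apply: le_lt_trans (start_ge0 n) (start_lt_stop n).
have [k [e ee he]] := F_step.2 _ s0.
rewrite -ltnS; apply: leq_trans (F_jump ee he).
have /andP[e0 _] := ee.
have lt : Num.max (start n) (stop n - e) < stop n by rewrite gt_max start_lt_stop gtrBl.
have [u] := rat_in_itvoo lt; rewrite in_itv/= gt_max => /andP[/andP[u1 u2] u3].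
by rewrite -(he (ratr u)) ?u2// (price_during (n := n))// u3 ltW.
Qed.

Definition excursion_path n t : R := (F (Num.min (start n + t) (stop n)))%:R - a%:R.

Lemma excursion_path_zeta n : zeta (excursion_path n) = (stop n - start n)%:E.
Proof.
have sd := start_lt_stop n.
apply/le_anti/andP; split.
  apply: ereal_inf_lbound; exists (stop n - start n) => //=.
  by rewrite subr_gt0 sd /excursion_path (addrC (start n)) subrK minxx price_stop_eq subrr.
apply: le_ereal_inf_tmp => _ [t [t0 et] <-]; rewrite lee_fin leNgt; apply/negP => td.
move: et; rewrite /excursion_path min_l; last by lra.
have : (a < F (start n + t))%N by apply: (price_during (n := n)); apply/andP; split; lra.
move=> h /eqP; rewrite subr_eq0 eqr_nat; lia.
Qed.

Variable f : R -> R.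
Hypothesis fF : forall t, 0 <= t -> f t = (F t)%:R.

Lemma left_limit_step t n e : 0 < e <= t ->
  (forall s, t - e < s < t -> F s = n) -> left_limit f t = n%:R.
Proof.
move=> /andP[e0 et] he; rewrite /left_limit gt_eqF; last by apply: lt_le_trans et.
apply: cvg_lim => //; apply: cvg_near_cst; apply/near_leftP; exists e => // s st.
by rewrite fF ?he//; apply: le_trans (_ : t - e <= s); rewrite ?subr_ge0// ltW//; case/andP: st.
Qed.

Lemma excursion_pathP n : excursion_above f a%:R (start n) (stop n) (excursion_path n).
Proof.
have sd := start_lt_stop n; have s0 := start_ge0 n.
have pos : 0 < start n by apply: le_lt_trans (before_ge0 n) (before_lt_start n).
split; first by rewrite s0 ltW.
split; first by move=> t t0; rewrite fF// le_min stop_ge0 addr_ge0.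
split.
  split.
  - apply: (step_path_cadlag (F := fun t => F (Num.min (start n + t) (stop n)))) => //.
    by apply: step_path_stopped => //; rewrite s0 ltW.
  - by rewrite excursion_path_zeta lte_fin subr_gt0 sd ltry.
  - move=> t t0; rewrite excursion_path_zeta /= /excursion_path min_r; last by lra.
    by rewrite price_stop_eq subrr.
split.
  move=> t t0; rewrite /excursion_path subr_ge0 ler_nat.
  have [h|h] := ltP (start n + t) (stop n); last by rewrite price_stop_eq.
  by apply/ltnW/(price_during (n := n)); rewrite h lerDl t0.
have [k [e ee he]] := F_step.2 _ pos.
rewrite (left_limit_step ee he) ler_nat.
have /andP[e0 _] := ee.
have lt : Num.max (before n) (start n - e) < start n by rewrite gt_max before_lt_start gtrBl.
have [u] := rat_in_itvoo lt; rewrite in_itv/= gt_max => /andP[/andP[u1 u2] u3].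
by rewrite -(he (ratr u)) ?u2// (price_before (n := n))// u3 ltW.
Qed.

(** An excursion cannot begin with the price below [a], being nonnegative, nor at [a], where it
    would vanish on a right neighbourhood of 0 and have [zeta] equal to 0. So the price exceeds [a]
    at [g] while its left limit there does not, which happens only at a start. *)
Lemma excursion_above_start g d e : excursion_above f a%:R g d e -> exists n, g = start n.
Proof.
move=> [/andP[g0 gd] [eE [[_ /andP[ez _] _] [e_ge0 gleft]]]].
have ag : (a < F g)%N.
  rewrite ltnNge; apply/negP => Fga.
  have Fg : F g = a.
    apply/eqP; rewrite eqn_leq Fga /=.
    have := e_ge0 0 (lexx 0); rewrite eE// addr0 min_l// fF// subr_ge0 ler_nat.
    by [].
  have [r r0 hr] := F_step.1 g g0.
  have e0 t : 0 < t < r -> e t = 0.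
    move=> /andP[t0 tr]; rewrite eE ?ltW// fF; last first.
      by rewrite le_min addr_ge0 ?(ltW t0) ?(le_trans g0 gd).
    rewrite hr ?Fg ?subrr//; apply/andP; split; first by rewrite le_min gd lerDl ltW.
    by rewrite gt_min ltrD2l tr.
  have zle t : 0 < t < r -> (zeta e <= t%:E)%E.
    by move=> tr; apply: ereal_inf_lbound; exists t => //; split; [case/andP: tr | exact: e0].
  case zE : (zeta e) ez zle => [z| |] // ez zle.
    have z0 : 0 < z by rewrite -lte_fin.
    have tr : 0 < Num.min (z / 2) (r / 2) < r.
      rewrite lt_min gt_min; apply/andP; split; first by apply/andP; split; lra.
      by apply/orP; right; lra.
    by have := zle _ tr; rewrite lee_fin le_min => /andP[+ _]; lra.
  have tr : 0 < r / 2 < r by apply/andP; split; lra.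
  by have := zle _ tr; rewrite leye_eq.
have gpos : 0 < g.
  rewrite lt_neqAle g0 andbT; apply: contraTneq ag => <-.
  by rewrite -leqNgt.
have [k [r rr hr]] := F_step.2 _ gpos.
move: gleft; rewrite (left_limit_step rr hr) ler_nat => ka.
have /andP[r0 _] := rr.
have [n gn nmin] := ex_minnP (start_unbounded g).
case: n gn nmin => [|n] gn nmin.
  by move: ag; rewrite ltnNge (price_before (n := 0))//= g0.
have ng : start n <= g by rewrite leNgt; apply/negP => /nmin; rewrite ltnn.
exists n; apply/eqP; rewrite eq_le ng andbT leNgt; apply/negP => ng'.
have [sg|gs] := leP (stop n) g.
  by move: ag; rewrite ltnNge (price_before (n := n.+1))//= sg.
have lt : Num.max (start n) (g - r) < g by rewrite gt_max ng' gtrBl.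
have [u] := rat_in_itvoo lt; rewrite in_itv/= gt_max => /andP[/andP[u1 u2] u3].
have := @price_during n (ratr u); rewrite hr ?u2// ltnNge ka => /(_ _) h.
by apply/notF/h; rewrite (ltW u1) (lt_trans u3).
Qed.

Lemma successive_excursions_path : successive_excursions f a%:R excursion_path.
Proof.
exists start; split; first exact: start_ltS.
- by move=> n; exists (stop n); exact: excursion_pathP.
- exact: excursion_above_start.
Qed.

End Excursions.
End PricePath.

(** * Excursions as limits of their samples on the mesh *)

Section MeshLimit.
Variable R : realType.
Implicit Types (F : R -> nat) (t g d h : R) (m : nat).

(** With [mesh_size] steps the horizon is [m + 1], in the limit long enough for any finite number of
    excursions, while the accumulated error is of order [1 / (m + 1)]. *)
Definition mesh_step m : R := (m.+1%:R ^+ 2)^-1.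

Definition mesh_size m : nat := (m.+1 ^ 3)%N.

Lemma mesh_step_gt0 m : 0 < mesh_step m.
Proof. by rewrite invr_gt0 exprn_gt0// ltr0n. Qed.

Lemma mesh_step_lt eps : 0 < eps -> exists m0, forall m, (m0 <= m)%N -> mesh_step m < eps.
Proof.
move=> e0; have [m0 hm] := inv_succ_lt e0; exists m0 => m mm.
apply: le_lt_trans (hm _ mm); rewrite lef_pV2 ?posrE ?ltr0n ?exprn_gt0 ?ltr0n//.
by rewrite expr2 ler_peMl ?ler1n.
Qed.

Lemma mesh_horizon m : (mesh_size m)%:R * mesh_step m = m.+1%:R.
Proof.
rewrite /mesh_size /mesh_step natrX exprS mulfK// expf_neq0// pnatr_eq0//.
Qed.

Lemma mesh_horizon_ge (c : R) : exists m0, forall m, (m0 <= m)%N ->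
  c <= (mesh_size m)%:R * mesh_step m.
Proof.
exists (Num.bound c) => m cm; rewrite mesh_horizon.
apply: le_trans (ler_norm c) (le_trans (ltW (archi_boundP (normr_ge0 c))) _).
have -> : Num.bound `|c| = Num.bound c by rewrite /Num.bound normr_id.
by rewrite ler_nat ltnW.
Qed.

Lemma mesh_error_le (c eps : R) : 0 <= c -> 0 < eps -> exists m0, forall m, (m0 <= m)%N ->
  (mesh_size m)%:R * (c * mesh_step m ^+ 2) <= eps.
Proof.
move=> c0 e0; have d0 : 0 < eps / (c + 1) by rewrite divr_gt0// ltr_wpDl.
have [m0 hm] := inv_succ_lt d0; exists m0 => m mm.
have -> : (mesh_size m)%:R * (c * mesh_step m ^+ 2) =
   c * mesh_step m * ((mesh_size m)%:R * mesh_step m) by ring.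
have mn : m.+1%:R != 0 :> R by rewrite pnatr_eq0.
rewrite mesh_horizon /mesh_step expr2 invfM -mulrA divfK//.
have := hm _ mm; rewrite ltr_pdivlMr; last by rewrite ltr_wpDl.
move=> /ltW; apply: le_trans; rewrite mulrDr mulr1 mulrC lerDl.
by rewrite invr_ge0.
Qed.

Lemma grid_point g h : 0 <= g -> 0 < h -> exists K : nat, g <= K%:R * h < g + h.
Proof.
move=> g0 h0; have /andP[n1 n2] := truncn_itv (divr_ge0 g0 (ltW h0)).
set n := Num.truncn _ in n1 n2; rewrite ler_pdivlMr// in n1; rewrite ltr_pdivrMr// in n2.
have [ng|ng] := eqVneq (n%:R * h) g; first by exists n; rewrite ng lexx ltrDl.
by exists n.+1; rewrite (ltW n2) natrSM addrC ltrD2r lt_neqAle ng.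
Qed.

(* The first index [j] with [t < j h]. *)
Definition mesh_index h t : nat := (Num.truncn (t / h)).+1.

Lemma mesh_indexP h t : 0 < h -> 0 <= t -> t < (mesh_index h t)%:R * h <= t + h.
Proof.
move=> h0 t0; have /andP[n1 n2] := truncn_itv (divr_ge0 t0 (ltW h0)).
rewrite ler_pdivlMr// in n1; rewrite ltr_pdivrMr// in n2.
by rewrite /mesh_index n2 natrSM addrC lerD2r.
Qed.

(* [(ts, Q)] stands for the set of the paths [f] such that [Q] holds for the
   list of the [f t], [t] in [ts]. *)
Definition cylinder : Type := seq R * (seq R -> bool).

Definition cylinder_test (C : cylinder) (f : R -> R) : bool := C.2 [seq f t | t <- C.1].

Definition mesh_test h (C : cylinder) : pred (seq nat) :=
  fun q => C.2 [seq (nth 0%N q (mesh_index h t))%:R | t <- C.1].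

(** The time read for [t] is [(K + j) * h], strictly between [g + t] and [g + t + 2 * h], hence in
    the interval to the right of [g + t] where [F] is constant. If [d <= g + t], the index points
    either just after [d] or past the end of the list, where the default 0 of [nth] is the value of
    the stopped excursion. *)
Lemma mesh_value_limit (a : nat) F g d t : step_path F -> 0 <= g < d ->
  (forall u, g <= u < d -> (a < F u)%N) -> F d = a -> 0 <= t ->
  exists2 h0, 0 < h0 & forall h (K D : nat), 0 < h < h0 ->
    g <= K%:R * h < g + h -> d <= D%:R * h < d + h ->
    (nth 0%N [seq (F (i%:R * h)%R - a)%N | i <- iota K (D.+1 - K)%N] (mesh_index h t))%:R
    = (F (Num.min (g + t) d))%:R - a%:R :> R.
Proof.
move=> [FR _] /andP[g0 gd] Fa Fd t0.
have nthE h (K D j : nat) : nth 0%N [seq (F (i%:R * h)%R - a)%N | i <- iota K (D.+1 - K)%N] j =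
    if (K + j <= D)%N then (F ((K + j)%:R * h)%R - a)%N else 0%N.
  case: ifP => KD.
    rewrite (nth_map 0%N) ?size_iota; last by lia.
    by rewrite nth_iota//; lia.
  by rewrite nth_default// size_map size_iota; lia.
have [gtd|dgt] := ltP (g + t) d.
  have [e e0 he] := FR (g + t) (addr_ge0 g0 t0).
  exists (Num.min (e / 2) ((d - g - t) / 2)).
    by rewrite lt_min; apply/andP; split; lra.
  move=> h K D /andP[h0]; rewrite lt_min => /andP[he1 he2] /andP[K1 K2] /andP[D1 D2].
  have /andP[j1 j2] := mesh_indexP h0 t0; set j := mesh_index h t in j1 j2 *.
  have KjD : (K + j < D)%N.
    by rewrite -(ltr_nat R) -(ltr_pM2r h0) natrD mulrDl; lra.
  rewrite nthE ltnW// he; last by rewrite natrD mulrDl; apply/andP; split; lra.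
  by rewrite natrB// ltnW// Fa// gtd lerDl t0.
have [e e0 he] := FR d (ltW (le_lt_trans g0 gd)).
exists e => // h K D /andP[h0 he1] /andP[K1 K2] /andP[D1 D2].
have /andP[j1 j2] := mesh_indexP h0 t0; set j := mesh_index h t in j1 j2 *.
rewrite Fd subrr nthE; case: ifP => // KD; rewrite he ?Fd ?subnn//.
have : (K + j)%:R * h <= D%:R * h by rewrite ler_pM2r// ler_nat.
by rewrite natrD mulrDl => h1; apply/andP; split; lra.
Qed.

Lemma mesh_test_limit (C : cylinder) (a : nat) F g d : step_path F -> 0 <= g < d ->
  (forall u, g <= u < d -> (a < F u)%N) -> F d = a -> all (fun t => 0 <= t) C.1 ->
  exists2 h0, 0 < h0 & forall h (K D : nat), 0 < h < h0 ->
    g <= K%:R * h < g + h -> d <= D%:R * h < d + h ->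
    mesh_test h C [seq (F (i%:R * h)%R - a)%N | i <- iota K (D.+1 - K)%N]
    = cylinder_test C (fun t => (F (Num.min (g + t) d))%:R - a%:R).
Proof.
move=> Fs gd Fa Fd; rewrite /mesh_test /cylinder_test.
suff : all (fun t => 0 <= t) C.1 -> exists2 h0, 0 < h0 & forall h (K D : nat), 0 < h < h0 ->
    g <= K%:R * h < g + h -> d <= D%:R * h < d + h ->
    [seq (nth 0%N [seq (F (i%:R * h)%R - a)%N | i <- iota K (D.+1 - K)%N]
       (mesh_index h t))%:R | t <- C.1]
    = [seq (F (Num.min (g + t) d))%:R - a%:R :> R | t <- C.1].
  move=> /[apply] -[h0 h00 hh]; exists h0 => // h K D h1 h2 h3.
  by rewrite hh.
elim: C.1 => [|t ts IH] /=; first by exists 1.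
move=> /andP[t0 /IH[h1 h10 hh1]].
have [h2 h20 hh2] := mesh_value_limit Fs gd Fa Fd t0.
exists (Num.min h1 h2); first by rewrite lt_min h10.
move=> h K D; rewrite lt_min => /andP[h0 /andP[hlt1 hlt2]] hK hD.
by rewrite hh1 ?h0// hh2 ?h0.
Qed.

Lemma first_excursion_limit (C : cylinder) F d : step_path F -> 0 < d ->
  (forall u, 0 <= u < d -> (0 < F u)%N) -> F d = 0%N -> F 0 = 1%N ->
  all (fun t => 0 <= t) C.1 ->
  exists m0, forall m, (m0 <= m)%N ->
    test_excursions 0 [:: mesh_test (mesh_step m) C] (Some [:: 1%N])
      [seq F (i%:R * mesh_step m) | i <- iota 1 (mesh_size m)]
    = cylinder_test C (fun t => (F (Num.min t d))%:R).
Proof.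
move=> Fs d0 Fpos Fd F0 C0.
have gd : 0 <= (0 : R) < d by rewrite lexx d0.
have [h0 h00 hh] := mesh_test_limit Fs gd Fpos Fd C0.
have [e e0 he] := Fs.1 d (ltW d0).
have h1 : 0 < Num.min h0 (Num.min e 1) by rewrite !lt_min h00 e0 ltr01.
have [m1 hm1] := mesh_step_lt h1; have [m2 hm2] := mesh_horizon_ge (d + 1).
exists (maxn m1 m2) => m; rewrite geq_max => /andP[/hm1 hs /hm2 hN].
move: hs hN; set h := mesh_step m; rewrite !lt_min => /andP[hh0 /andP[hhe hh1]] hN.
have h_gt0 : 0 < h := mesh_step_gt0 m.
have [D /andP[D1 D2]] := grid_point (ltW d0) h_gt0.
have D0 : (0 < D)%N.
  by rewrite -(ltr_nat R) -(ltr_pM2r h_gt0) mul0r; apply: lt_le_trans D1.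
have DN : (D < 1 + mesh_size m)%N.
  rewrite add1n ltnS ltnW// -(ltr_nat R) -(ltr_pM2r h_gt0); lra.
have FD : F (D%:R * h) = 0%N by rewrite he ?Fd// D1; lra.
rewrite (@test_excursions_above 0 (fun i => F (i%:R * h)) _ _ _ _ D) ?D0 ?FD//; last first.
  move=> i /andP[i1 iD]; apply: Fpos; rewrite mulr_ge0 ?(ltW h_gt0)//=.
  rewrite ltNge; apply/negP => di.
  have : i.+1%:R * h <= D%:R * h by rewrite ler_pM2r// ler_nat.
  by rewrite natrSM; lra.
rewrite test_excursions_nil andbT.
rewrite (_ : cylinder_test _ _ =
  cylinder_test C (fun t => (F (Num.min (0 + t) d))%:R - 0%:R)); last first.
  by congr C.2; apply: eq_map => t; rewrite add0r subr0.
(* Here [K = 0]: the sampled list begins with [F 0 = 1], the value stored as prefix in the test. *)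
rewrite -(hh h 0%N D) ?h_gt0 ?mul0r ?lexx ?add0r ?D1//; congr (mesh_test h C _).
by rewrite subn0 /= mul0r F0 subSS subn0.
Qed.

Section Successive.
Variables (a : nat) (F : R -> nat).
Hypothesis F_step : step_path F.
Hypothesis F_up : forall s, 0 <= s -> exists2 t, s <= t & (a < F t)%N.
Hypothesis F_down : forall s, 0 <= s -> exists2 t, s <= t & (F t <= a)%N.
Hypothesis F0 : (F 0 <= a)%N.
Hypothesis F_jump : forall (t e : R) n, 0 < e <= t ->
  (forall s, t - e < s < t -> F s = n) -> (n <= (F t).+1)%N.

(** The sample is entered at [k + 1], where [k * h] is the first grid point at or after the end of
    the previous excursion. The rank [m0] must not depend on [k], since the induction uses it at the
    grid index [D] of the next stop, which varies with [m]. *)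
Lemma excursions_limit_from (Cs : seq cylinder) (n : nat) :
  all (fun C : cylinder => all (fun t => 0 <= t) C.1) Cs ->
  exists m0, forall m, (m0 <= m)%N -> forall k : nat,
    before a F n <= k%:R * mesh_step m < before a F n + mesh_step m ->
    test_excursions a [seq mesh_test (mesh_step m) C | C <- Cs] None
      [seq F (i%:R * mesh_step m) | i <- iota k.+1 (mesh_size m - k)%N]
    = all (fun iC => cylinder_test iC.2 (excursion_path a F iC.1)) (zip (iota n (size Cs)) Cs).
Proof.
elim: Cs n => [|C Cs IH] n /=; first by exists 0%N => m _ k _; rewrite test_excursions_nil.
move=> /andP[C0 /(IH n.+1)[m3 hm3]].
set b := before a F n; set g := start a F n; set d := stop a F n.
have b0 : 0 <= b by exact: before_ge0.
have bg : b < g by exact: before_lt_start.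
have g0 : 0 <= g by exact: start_ge0.
have gd : g < d by exact: start_lt_stop.
have d0 : 0 <= d by exact: stop_ge0.
have Fd : F d = a by exact: price_stop_eq.
have Fdur u : g <= u < d -> (a < F u)%N by exact: price_during.
have g0d : 0 <= g < d by rewrite g0.
have [h0 h00 hh] := mesh_test_limit F_step g0d Fdur Fd C0.
have [e1 e10 he1] := F_step.1 d d0.
(* A mesh finer than [g - b] and [d - g] separates the grid indices [k < K < D] of three successive
   endpoints; the other bounds serve the sampling, the value at [D] and the horizon. *)
have hmin : 0 < Num.min (Num.min h0 (Num.min e1 1)) (Num.min (d - g) (g - b)).
  by rewrite !lt_min h00 e10 ltr01 !subr_gt0 gd.
have [m1 hm1] := mesh_step_lt hmin; have [m2 hm2] := mesh_horizon_ge (d + 1).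
exists (maxn (maxn m1 m2) m3) => m; rewrite !geq_max => /andP[/andP[/hm1 hs /hm2 hN] /hm3].
move: hs hN; set h := mesh_step m; rewrite !lt_min.
move=> /andP[/andP[hh0 /andP[hhe hh1]] /andP[hdg hgb]] hN IHm k /andP[k1 k2].
have h_gt0 : 0 < h := mesh_step_gt0 m.
have [K /andP[K1 K2]] := grid_point g0 h_gt0.
have [D /andP[D1 D2]] := grid_point d0 h_gt0.
have lt_grid (i j : nat) : i%:R * h < j%:R * h -> (i < j)%N by rewrite ltr_pM2r// ltr_nat.
have le_grid (i j : nat) : (i < j)%N -> i%:R * h + h <= j%:R * h.
  by move=> ij; rewrite addrC -natrSM ler_pM2r// ler_nat.
have kK : (k < K)%N by apply: lt_grid; lra.
have KD : (K < D)%N by apply: lt_grid; lra.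
have DN : (D < mesh_size m)%N by apply: lt_grid; lra.
have FK : (a < F (K%:R * h)%R)%N by apply: Fdur; apply/andP; split; lra.
have FD : F (D%:R * h) = a by rewrite he1 ?Fd// D1; lra.
have DN' := ltnW DN.
have KN := leq_trans (ltnW KD) DN'; have kN := leq_trans (ltnW kK) KN.
have E (i : nat) : (i <= mesh_size m)%N -> (i.+1 + (mesh_size m - i) = (mesh_size m).+1)%N.
  by move=> im; rewrite addSn subnKC.
rewrite (@test_excursions_below a (fun i => F (i%:R * h)) _ _ _ K); last 3 first.
- by rewrite E// kK ltnS.
- move=> i /andP[ik iK]; have := le_grid _ _ ik; have := le_grid _ _ iK => h1 h2.
  by apply: (price_before F_step F_up F_down (n := n)); apply/andP; split; rewrite -?/b -?/g; lra.
- exact: FK.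
rewrite E// subSS (@test_excursions_above a (fun i => F (i%:R * h)) _ _ _ _ D); last 3 first.
- by rewrite E// KD ltnS.
- move=> i /andP[ik iD]; have := le_grid _ _ ik; have := le_grid _ _ iD => h1 h2.
  by apply: Fdur; apply/andP; split; lra.
- by rewrite FD.
congr andb.
  rewrite -[RHS](hh h K D) ?h_gt0 ?K1 ?D1 ?hh0//; congr (mesh_test h C _).
  by rewrite subSS subSn// ltnW.
rewrite E// subSS.
by apply: IHm; rewrite /before -/d D1.
Qed.

Lemma excursions_limit (Cs : seq cylinder) :
  all (fun C : cylinder => all (fun t => 0 <= t) C.1) Cs ->
  exists m0, forall m, (m0 <= m)%N ->
    test_excursions a [seq mesh_test (mesh_step m) C | C <- Cs] None
      [seq F (i%:R * mesh_step m) | i <- iota 1 (mesh_size m)]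
    = all (fun iC => cylinder_test iC.2 (excursion_path a F iC.1)) (zip (iota 0 (size Cs)) Cs).
Proof.
move=> /(@excursions_limit_from _ 0)[m0 hm]; exists m0 => m /hm /(_ 0%N).
by rewrite subn0 /before mul0r lexx add0r mesh_step_gt0; apply.
Qed.

End Successive.
End MeshLimit.

(** * Almost sure behaviour of the price *)

Section AlmostSure.
Context (R : realType) (d : measure_display) (T : measurableType d) (P : probability T R).

Lemma ae_forall_countable (I : countType) (Q : I -> T -> Prop) :
  (forall i, {ae P, forall w, Q i w}) -> {ae P, forall w, forall i, Q i w}.
Proof.
move=> hQ; pose Q' n w := if @pickle_inv I n is Some i then Q i w else True.
have hQ' : {ae P, forall w, forall n, Q' n w}.
  by apply: ae_foralln => n; rewrite /Q'; case: pickle_inv => [i|]; [exact: hQ|exact: aeW].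
by apply: filterS hQ' => w h i; have := h (choice.pickle i); rewrite /Q' pickleK_inv.
Qed.

Lemma measurable_liminf_set (E : nat -> set T) : (forall m, measurable (E m)) ->
  measurable [set w | exists m0, forall m, (m0 <= m)%N -> E m w].
Proof.
move=> mE; rewrite (_ : [set w | _] = \bigcup_m0 \bigcap_(m in [set m | (m0 <= m)%N]) E m).
  apply: bigcupT_measurable => m0; apply: bigcap_measurable => //; exists m0.
  exact: leqnn.
by apply/seteqP; split => w [m0]; [move=> h; exists m0 | move=> _ h; exists m0].
Qed.

(** Fatou's lemma for events: the sets [A] intersected with all [E m], [m >= k], increase to [A]
    with [k]. *)
Lemma prob_liminf_le (A : set T) (E : nat -> set T) (eps : R) :
  measurable A -> (forall m, measurable (E m)) -> 0 < eps ->
  (forall w, A w -> exists m0, forall m, (m0 <= m)%N -> E m w) ->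
  exists m0, forall m, (m0 <= m)%N -> (P A <= P (E m) + eps%:E)%E.
Proof.
move=> mA mE e0 AE.
pose F k := A `&` \bigcap_(m in [set m | (k <= m)%N]) E m.
have mF k : measurable (F k).
  apply: measurableI => //; apply: bigcap_measurable => //; exists k; exact: leqnn.
have FA : \bigcup_k F k = A.
  apply/seteqP; split => [w [k _ []]//|w Aw].
  by have [k hk] := AE w Aw; exists k => //; split => // m /hk.
have Fnd : nondecreasing_seq F.
  move=> i j ij; apply/subsetPset => w [Aw h]; split => // m /= jm.
  by apply: h; exact: leq_trans jm.
have mUF : measurable (\bigcup_k F k) by exact: bigcupT_measurable.
have := @nondecreasing_cvg_mu _ _ _ P F mF mUF Fnd; rewrite FA => cF.
have PA : P A \is a fin_num by exact: fin_num_measure.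
have lt : (P A - eps%:E < P A)%E by rewrite lteBlDr// lteDl// lte_fin.
have [m0 _ hm] := cF _ (open_ereal_gt' lt); exists m0 => m m0m.
have {}hm : (P A - eps%:E < P (F m))%E := hm m m0m.
have FE : (P (F m) <= P (E m))%E.
  by apply: le_measure; rewrite ?inE// => w [_]; apply; exact: leqnn.
by rewrite -leeBlDr//; apply: le_trans (ltW hm) FE.
Qed.

(** The bad event is not known to be measurable, so it is only covered, up to a null set, by the
    measurable lower limit of the [E m]. *)
Lemma ae_not_liminf (bad : T -> Prop) (E : nat -> set T) :
  (forall m, measurable (E m)) ->
  (forall eps : R, 0 < eps -> exists m0, forall m, (m0 <= m)%N -> (P (E m) <= eps%:E)%E) ->
  {ae P, forall w, bad w -> exists m0, forall m, (m0 <= m)%N -> E m w} ->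
  {ae P, forall w, ~ bad w}.
Proof.
move=> mE hE badE.
pose L := [set w | exists m0, forall m, (m0 <= m)%N -> E m w].
have mL : measurable L by exact: measurable_liminf_set.
have L0 : P L = 0%E.
  apply/le_anti/andP; split => //; apply/lee_addgt0Pr => e e0; rewrite add0e.
  have e20 : 0 < e / 2 by rewrite divr_gt0.
  have [m1 h1] := @prob_liminf_le L E _ mL mE e20 (fun w h => h).
  have [m2 h2] := hE _ e20.
  have := h1 (maxn m1 m2) (leq_maxl _ _) => /le_trans; apply.
  have := h2 (maxn m1 m2) (leq_maxr _ _) => h; rewrite [in leRHS](splitr e) EFinD.
  by rewrite leeD2r.
have Lae : {ae P, forall w, ~ L w}.
  by exists L; split => // w /= /contrapT.
by apply: filterS2 badE Lae => w h1 h2 /h1.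
Qed.

Lemma ae_measurable_set (Q : T -> Prop) : {ae P, forall w, Q w} ->
  exists G : set T, [/\ measurable G, P (~` G) = 0%E & forall w, G w -> Q w].
Proof.
move=> [N [mN N0 QN]]; exists (~` N); split; [exact: measurableC | by rewrite setCK |].
by move=> w Nw; apply: contrapT => Qw; apply: Nw; apply: QN.
Qed.

End AlmostSure.

Section BookProcess.
Context (R : realType) (lam : R).
Context (dJ : measure_display) (TJ : measurableType dJ) (PJ : probability TJ R).
Variables (J : {RV PJ >-> R}) (jstar : nat).
Hypothesis lam_gt0 : 0 < lam.
Hypothesis EJ_gt0 : (0 < 'E_PJ[J])%E.
Hypothesis J_range : {ae PJ, forall w, exists k : int,
  (- jstar%:Z <= k <= 1)%R /\ J w = k%:~R}.
Context (d : measure_display) (T : measurableType d) (P : probability T R).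
Variables (sigma : seq nat) (X : R -> T -> pmT R).
Hypothesis X_law : order_book lam J P (book_of R sigma) X.

Local Notation p := (@jump_prob R dJ TJ PJ J jstar).
Local Notation Pr m := (euler_prob lam (mesh_step R m) p (mesh_size m)).

Definition price_nat (w : T) (t : R) : nat := Num.truncn (price (X t w)).

Lemma price_natE w t s : X t w = book_of R s -> price_nat w t = top s.
Proof. by move=> e; rewrite /price_nat e price_book natrK. Qed.

Let mX t : 0 <= t -> measurable_fun setT (X t).
Proof. by case: X_law => h _ _ _; exact: h. Qed.

Let X0 : {ae P, forall w, X 0 w = book_of R sigma}. Proof. by case: X_law. Qed.

Lemma ae_natural t : 0 <= t -> {ae P, forall w, @natural_books R (X t w)}.
Proof.
move=> t0; have [_ _ _ [kappa [ksemi kgen markov]]] := X_law.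
have mN : measurable (~` @natural_books R).
  by apply: measurableC; exact: measurable_natural_books.
exists (X t @^-1` (~` @natural_books R)); split => //.
  by rewrite -[X in measurable X]setTI; exact: mX.
have hT : history X 0 setT by exact: (@measurableT _ (g_sigma_algebraType _)).
have := markov t 0 t0 (lexx 0) setT hT _ mN.
rewrite setTI add0r => ->.
rewrite (@ae_eq_integral _ _ _ _ _ (cst 0%E)) ?integral_cst ?mul0e//.
  exact: (measurableT_comp (measurable_kernel (kappa t) _ mN) (mX (lexx 0))).
apply: filterS X0 => w -> _ /=.
exact: (kernel_natural J_range lam_gt0 ksemi kgen).
Qed.

Lemma ae_paths : {ae P, forall w, X 0 w = book_of R sigma /\
  (forall t, 0 <= t -> @natural_books R (X t w)) /\ step_path (price_nat w)}.
Proof.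
have rat_ae : {ae P, forall w, forall q : rat, 0 <= ratr q :> R -> @natural_books R (X (ratr q) w)}.
  apply: ae_forall_countable => q; have [q0|q0] := pselect (0 <= ratr q :> R).
    by apply: filterS (ae_natural q0).
  by apply: aeW.
apply: filterS2 X0 rat_ae => w Xw0 Xq; split => //.
have cad : pm_cadlag (X ^~ w) by case: X_law => _ + _ _; exact.
split; first exact: (cadlag_natural cad Xq).
split=> t t0.
  have [e e0 he] := cadlag_right cad Xq t0; exists e => // s st.
  by rewrite /price_nat he.
have [nu [e ee he]] := cadlag_left cad Xq t0.
by exists (Num.truncn (price nu)), e => // s st; rewrite /price_nat he.
Qed.

Lemma mesh_event_price w t h N (B : pred (seq nat)) : 0 <= t -> 0 <= h ->
  (forall t, 0 <= t -> @natural_books R (X t w)) ->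
  mesh_event X t h N 0 B w <->
  B [seq price_nat w (t + i%:R * h) | i <- iota 1 N].
Proof.
move=> t0 h0 Xw; rewrite mesh_eventP.
have E ss : size ss = N ->
    (forall i, (i < N)%N -> X (t + (0 + i).+1%:R * h) w = book_of R (nth [::] ss i)) ->
    [seq top s | s <- ss] = [seq price_nat w (t + i%:R * h) | i <- iota 1 N].
  move=> sN hs; apply: (@eq_from_nth _ 0%N); first by rewrite !size_map size_iota.
  move=> i; rewrite size_map sN => iN.
  rewrite (nth_map [::]) ?sN// (nth_map 0%N) ?size_iota// nth_iota// add1n.
  by rewrite (price_natE (hs i iN)).
split=> [[ss [sN hs]]|BX]; first by rewrite (E ss).
have [f hf] : {f : nat -> seq nat & forall i, X (t + i.+1%:R * h) w = book_of R (f i)}.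
  apply: (@choice _ _ (fun i s => X (t + i.+1%:R * h) w = book_of R s)) => i.
  by have [s Xs] := Xw _ (addr_ge0 t0 (mulr_ge0 (ler0n R i.+1) h0)); exists s.
have hs (i : nat) : (i < N)%N -> X (t + (0 + i).+1%:R * h) w = book_of R (nth [::] (mkseq f N) i).
  by move=> iN; rewrite nth_mkseq// add0n hf.
exists (mkseq f N); split; [exact: size_mkseq | exact: hs |].
by rewrite (E (mkseq f N)) ?size_mkseq.
Qed.

Lemma small_mesh : exists m0, forall m, (m0 <= m)%N -> 2 * lam * mesh_step R m <= 1.
Proof.
have h0 : 0 < (2 * lam)^-1 by rewrite invr_gt0 mulr_gt0.
have [m0 hm] := mesh_step_lt h0; exists m0 => m /hm /ltW.
by rewrite -(ler_pM2l (_ : 0 < 2 * lam)) ?mulr_gt0// mulfV// mulf_neq0 ?gt_eqF.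
Qed.

(** [B] may depend on [m], because a cylinder is tested through the mesh; the error bound does not
    involve it. *)
Lemma prob_mesh_le t s B (eps : R) : 0 <= t -> 0 < eps ->
  exists m0, forall m, (m0 <= m)%N ->
  (P ([set w | X t w = book_of R s] `&` mesh_event X t (mesh_step R m) (mesh_size m) 0 (B m))
   <= (Pr m (B m) s + eps)%:E)%E.
Proof.
move=> t0 e0; have [_ _ _ [kappa [ksemi kgen markov]]] := X_law.
have [m1 h1] := small_mesh.
have [m2 h2] := mesh_error_le (step_error_ge0 lam) e0.
exists (maxn m1 m2) => m; rewrite geq_max => /andP[/h1 lh /h2 le].
have := @mesh_bound _ lam _ _ _ _ jstar lam_gt0 J_range _ ksemi kgen _ _ P X mX markov
  t (mesh_step R m) (mesh_size m) 0 [set w | X t w = book_of R s] s (B m) t0 (mesh_step_gt0 R m) lh.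
have hb : history X t [set w | X t w = book_of R s] by exact: history_book.
rewrite !mul0r addr0 => /(_ hb (fun w h => h)) /le_trans; apply.
have Pr0 : 0 <= Pr m (B m) s.
  apply: euler_prob_ge0 => //;
    [exact: ltW | exact: ltW (mesh_step_gt0 _ _) | | exact: (sum_jump_prob J_range)].
  exact: jump_prob_ge0.
apply: (@le_trans _ _ (1 * (Pr m (B m) s + eps)%:E)%E); last by rewrite mul1e.
apply: lee_pmul => //.
- rewrite lee_fin addr_ge0// mulr_ge0// mulr_ge0 ?step_error_ge0//.
  exact: exprn_ge0 (ltW (mesh_step_gt0 _ _)).
- by apply: probability_le1; exact: measurable_book_event.
- by rewrite lee_fin lerD2l.
Qed.

Lemma measurable_mesh_part t s m B : 0 <= t -> measurable
  ([set w | X t w = book_of R s] `&` mesh_event X t (mesh_step R m) (mesh_size m) 0 B).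
Proof.
move=> t0; apply: measurableI; first exact: measurable_book_event.
by apply: measurable_mesh_event => //; exact: ltW (mesh_step_gt0 _ _).
Qed.

(** From any book at any integer time, the chain is unlikely to stay in [A] up to the horizon. There
    are countably many such pairs, and every time lies below an integer, so the exceptional set can
    be taken the same for all times. *)
Lemma ae_leave (A : pred nat) :
  (forall s (eps : R), A (top s) -> 0 < eps -> exists m0, forall m, (m0 <= m)%N ->
     Pr m (all A) s <= eps) ->
  {ae P, forall w, forall s, 0 <= s -> exists2 t, s <= t & ~~ A (price_nat w t)}.
Proof.
move=> hA.
have H (u : nat) (s : seq nat) : {ae P, forall w,
    ~ (X u%:R w = book_of R s /\ forall t, u%:R <= t -> A (price_nat w t))}.
  have [As|As] := boolP (A (top s)); last first.
    apply: aeW => w [Xw /(_ u%:R (lexx _))]; rewrite (price_natE Xw).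
    exact/negP.
  have u0 : 0 <= u%:R :> R by [].
  apply: (@ae_not_liminf _ _ _ _ _ (fun m => [set w | X u%:R w = book_of R s] `&`
     mesh_event X u%:R (mesh_step R m) (mesh_size m) 0 (all A))).
  - by move=> m; exact: measurable_mesh_part.
  - move=> eps e0; have e20 : 0 < eps / 2 by rewrite divr_gt0.
    have [m1 h1] := @prob_mesh_le u%:R s (fun=> all A) _ u0 e20.
    have [m2 h2] := hA s _ As e20.
    exists (maxn m1 m2) => m; rewrite geq_max => /andP[/h1 + /h2 hm].
    by move=> /le_trans; apply; rewrite lee_fin [leRHS](splitr eps) lerD2r.
  - apply: filterS ae_paths => w [_ [Xn _]] [Xw hw]; exists 0%N => m _; split => //.
    apply/mesh_event_price => //; first exact: ltW (mesh_step_gt0 _ _).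
    apply/allP => _ /mapP[i _ ->]; apply: hw.
    by rewrite lerDl mulr_ge0// ltW// mesh_step_gt0.
have H' : {ae P, forall w, forall us : nat * seq nat,
    ~ (X us.1%:R w = book_of R us.2 /\ forall t, us.1%:R <= t -> A (price_nat w t))}.
  by apply: ae_forall_countable => us; exact: H.
apply: filterS2 H' ae_paths => w hw [_ [Xn _]] s s0.
have [r Xr] := Xn (Num.bound s)%:R (ler0n _ _).
apply: contrapT => h; apply: (hw (Num.bound s, r)); split => //= t st.
apply: contrapT => /negP At; apply: h; exists t => //.
by apply: le_trans st; exact: ltW (archi_boundP s0).
Qed.

Lemma ae_price_up (a : nat) :
  {ae P, forall w, forall s, 0 <= s -> exists2 t, s <= t & (a < price_nat w t)%N}.
Proof.
have hA s (eps : R) : (top s <= a)%N -> 0 < eps -> exists m0, forall m, (m0 <= m)%N ->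
    Pr m (all (fun q => q <= a)%N) s <= eps; last first.
  apply: filterS (ae_leave hA) => w h s s0.
  have [t st] := h s s0; rewrite -ltnNge => At; by exists t.
move=> sa e0.
have p0 := jump_prob0_gt0 J_range EJ_gt0.
set c := (1 + (p ord0)^-1) ^+ a.+1 / lam.
have [m1 h1] := small_mesh; have [m2 h2] := mesh_horizon_ge (c / eps).
exists (maxn m1 m2) => m; rewrite geq_max => /andP[/h1 lh /h2 hm].
have hN : 0 < (mesh_size m)%:R * mesh_step R m.
  by rewrite mesh_horizon ltr0n.
have := @euler_prob_stay_below R lam (mesh_step R m) _ p (ltW lam_gt0) (ltW (mesh_step_gt0 _ _))
  lh (@jump_prob_ge0 _ _ _ _ _ _) (sum_jump_prob J_range) a (mesh_size m) s p0 lam_gt0 sa.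
rewrite -/c [mesh_step _ _ * _]mulrC -ler_pdivlMl// => /le_trans; apply.
by rewrite ler_pdivrMl// -ler_pdivrMr.
Qed.

Lemma ae_price_down (a : nat) :
  {ae P, forall w, forall s, 0 <= s -> exists2 t, s <= t & (price_nat w t <= a)%N}.
Proof.
have hA s (eps : R) : (a < top s)%N -> 0 < eps -> exists m0, forall m, (m0 <= m)%N ->
    Pr m (all (fun q => a < q)%N) s <= eps; last first.
  apply: filterS (ae_leave hA) => w h s s0.
  have [t st] := h s s0; rewrite -leqNgt => At; by exists t.
move=> sa e0.
(* The term [size s / L] is made at most [eps / 2] through [L] alone; the horizon is chosen
   afterwards, since [c] grows with [L]. *)
have [L0 hL0] : exists L0 : nat, 2 * (size s)%:R / eps <= L0%:R.
  by exists (Num.bound (2 * (size s)%:R / eps)); apply/ltW/archi_boundP; rewrite divr_ge0// ltW.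
pose L := maxn (maxn 1 L0) (size s).
have L1 : (0 < L)%N by rewrite !leq_max.
have sL : (size s <= L)%N by rewrite leq_maxr.
have Lpos : 0 < L%:R :> R by rewrite ltr0n.
set c := (size s)%:R * L%:R / (2 * lam).
have [m1 h1] := small_mesh; have [m2 h2] := mesh_horizon_ge (2 * c / eps).
exists (maxn m1 m2) => m; rewrite geq_max => /andP[/h1 lh /h2 hm].
have hN : 0 < (mesh_size m)%:R * mesh_step R m by rewrite mesh_horizon ltr0n.
have := @euler_prob_stay_above R lam (mesh_step R m) _ p (ltW lam_gt0) (ltW (mesh_step_gt0 _ _))
  lh (@jump_prob_ge0 _ _ _ _ _ _) (sum_jump_prob J_range) a (mesh_size m) L s lam_gt0 L1 sa sL.
rewrite -/c [mesh_step _ _ * _]mulrC -ler_pdivlMl// => /le_trans; apply.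
set H := (mesh_size m)%:R * _ in hN hm *.
rewrite mulrDr [eps](splitr eps) -mulrA mulKf ?gt_eqF//; apply: lerD.
  have : 2 * (size s)%:R / eps <= L%:R by apply: le_trans hL0 _; rewrite ler_nat /L; lia.
  by rewrite !ler_pdivrMr//; lra.
by move: hm; rewrite ler_pdivrMr// ler_pdivrMl//; lra.
Qed.

Lemma path_map_iota (r : rel nat) (G : nat -> nat) N i : (i < N)%N ->
  path r (G 0%N) [seq G j | j <- iota 1 N] -> r (G i) (G i.+1).
Proof.
move=> iN /(pathP 0%N) /(_ i); rewrite size_map size_iota => /(_ iN).
rewrite -[G 0%N :: _]/[seq G j | j <- iota 0 N.+1].
by rewrite (nth_map 0%N) ?size_iota 1?ltnW// (nth_map 0%N) ?size_iota// !nth_iota// ltnW.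
Qed.

(** A fall by two or more at [t] shows between two consecutive mesh points around [t] as soon as the
    mesh is finer than the intervals of constancy on both sides; for the chain such a fall has
    probability 0. *)
Lemma ae_price_jump : no_gap sigma ->
  {ae P, forall w, forall (t e : R) n, 0 < e <= t ->
    (forall s, t - e < s < t -> price_nat w s = n) -> (n <= (price_nat w t).+1)%N}.
Proof.
move=> sg.
pose B := fun l => ~~ path (fun q r => q <= r.+1)%N (top sigma) l.
have : {ae P, forall w, ~ (exists t e n, [/\ 0 < e <= t,
    forall s, t - e < s < t -> price_nat w s = n & ~ (n <= (price_nat w t).+1)%N])}.
  apply: (@ae_not_liminf _ _ _ _ _ (fun m => [set w | X 0 w = book_of R sigma] `&`
     mesh_event X 0 (mesh_step R m) (mesh_size m) 0 B)).
  - by move=> m; exact: measurable_mesh_part.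
  - move=> eps e0; have [m1 h1] := @prob_mesh_le 0 sigma (fun=> B) _ (lexx 0) e0.
    have [m2 h2] := small_mesh.
    exists (maxn m1 m2) => m; rewrite geq_max => /andP[/h1 + /h2 lh].
    rewrite (euler_prob_price_drop (ltW lam_gt0) (ltW (mesh_step_gt0 _ _)) lh
      (@jump_prob_ge0 _ _ _ _ _ _) (sum_jump_prob J_range) _ sg).
    by rewrite add0r.
  - apply: filterS ae_paths => w [Xw0 [Xn [FR _]]] [t [e [n [/andP[e0 et] he hn]]]].
    have t0 : 0 < t by exact: lt_le_trans et.
    have [e' e'0 he'] := FR t (ltW t0).
    have emin : 0 < Num.min (Num.min e e') 1 by rewrite !lt_min e0 e'0 ltr01.
    have [m1 h1] := mesh_step_lt emin; have [m2 h2] := mesh_horizon_ge (t + 1).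
    exists (maxn m1 m2) => m; rewrite geq_max => /andP[/h1 + /h2 hN].
    move: hN; set h := mesh_step R m; rewrite !lt_min => hN /andP[/andP[h_e h_e'] h_1].
    have h0 : 0 < h := mesh_step_gt0 R m.
    split => //; apply/mesh_event_price => //; first exact: ltW.
    apply/negP => hp; apply: hn.
    have [[|K] /andP[K1 K2]] := grid_point (ltW t0) h0; first by move: K1; lra.
    have KN : (K < mesh_size m)%N.
      by rewrite -(ltr_nat R) -(ltr_pM2r h0); move: K2; rewrite natrSM; lra.
    have := @path_map_iota (fun q r => q <= r.+1)%N (fun i => price_nat w (0 + i%:R * h)) _ _ KN.
    rewrite !add0r mul0r (price_natE Xw0) => /(_ hp).
    rewrite (he' (K.+1%:R * h)); last by rewrite K1; lra.
    rewrite (he (K%:R * h))//; move: K1 K2; rewrite natrSM => K1 K2.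
    by apply/andP; split; lra.
apply: filterS => w hw t e n et he; apply: contrapT => hn; apply: hw.
by exists t, e, n; split.
Qed.

End BookProcess.

(** * Laws of random paths and products of cylinder probabilities *)

Section Cylinders.
Variable R : realType.
Implicit Types (C : cylinder R) (A : set (pathT R)).

Definition cylinder_set C : set (pathT R) := [set f | cylinder_test C f].

Definition nonneg_times C : bool := all (fun t => 0 <= t) C.1.

Definition cylinder_compl C : cylinder R := (C.1, fun l => ~~ C.2 l).

(** The test of a cylinder is an arbitrary predicate, so measurability is a separate requirement.
    Two such sets intersect in a cylinder over the concatenated times. *)
Definition measurable_cylinders : set (set (pathT R)) :=
  [set A | measurable A /\ exists2 C, nonneg_times C & A = cylinder_set C].

Lemma measurable_cylindersI : setI_closed measurable_cylinders.
Proof.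
move=> A B [mA [[ts Q] Cts AE]] [mB [[us S] Cus BE]]; split; first exact: measurableI.
rewrite AE BE.
exists (ts ++ us, fun l => Q (take (size ts) l) && S (drop (size ts) l)).
  by rewrite /nonneg_times all_cat; apply/andP.
apply/seteqP; split => f; rewrite /cylinder_set /= /cylinder_test /= map_cat.
  by move=> [h1 h2]; rewrite take_size_cat ?size_map// drop_size_cat ?size_map// h1.
by rewrite take_size_cat ?size_map// drop_size_cat ?size_map// => /andP[].
Qed.

Lemma coordinate_cylinder t (B : set R) : [set f : pathT R | B (f t)] =
  cylinder_set ([:: t], fun l => `[< B (head 0 l) >]).
Proof. by apply/seteqP; split => f /= h; exact/asboolP. Qed.

Lemma measurable_cylindersE : @measurable _ (pathT R) = <<s measurable_cylinders >>.
Proof.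
apply/seteqP; split.
  apply: sub_sigma_algebra2 => _ [t [B [t0 mB ->]]]; split.
    by apply: sub_sigma_algebra; exists t, B.
  exists ([:: t], fun l => `[< B (head 0 l) >]); last exact: coordinate_cylinder.
  by rewrite /nonneg_times /= t0.
apply: smallest_sub; last by move=> A [].
split; [exact: measurable0 | by move=> A mA; apply: measurableD |].
by move=> F mF; exact: bigcup_measurable.
Qed.

Lemma measure_cylinder_unique (m1 m2 : {measure set (pathT R) -> \bar R}) :
  (forall C, nonneg_times C -> measurable (cylinder_set C) ->
     m1 (cylinder_set C) = m2 (cylinder_set C)) ->
  (m1 setT < +oo)%E -> forall A, measurable A -> m1 A = m2 A.
Proof.
move=> m12 m1oo A mA.
apply: (measure_unique measurable_cylinders (fun=> setT) measurable_cylindersE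
  measurable_cylindersI _ _ m1 m2) => //.
- move=> _; split; first exact: measurableT.
  by exists ([::], fun=> true); rewrite // /cylinder_set /cylinder_test /=; apply/seteqP.
- by rewrite bigcup_const//; exists 0%N.
- by move=> B [mB [C C0 BC]]; rewrite BC; apply: m12 => //; rewrite -BC.
Qed.

Lemma measurable_random_path d (T : measurableType d) (Y : T -> pathT R) :
  (forall C, nonneg_times C -> measurable [set w | cylinder_test C (Y w)]) ->
  measurable_fun setT Y.
Proof.
move=> hY.
apply: (@measurability _ _ _ _ _ Y (@coordinate_events R)) => // _ [_ [t [B [t0 mB ->]]] <-].
rewrite setTI -[X in _ @^-1` X]/[set f : pathT R | B (f t)] coordinate_cylinder.
by apply: hY; rewrite /nonneg_times /= t0.
Qed.

End Cylinders.

Section IidFromProducts.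
Context (R : realType) (d : measure_display) (T : measurableType d) (P : probability T R).
Variables (mu : probability (pathT R) R) (Y : nat -> T -> pathT R).
Hypothesis mY : forall n, measurable_fun setT (Y n).

Let mYA n (A : set (pathT R)) : measurable A -> measurable (Y n @^-1` A).
Proof. by move=> mA; rewrite -[X in measurable X]setTI; exact: mY. Qed.

Hypothesis prod_cylinders : forall (n : nat) (C : nat -> cylinder R),
  (forall i, nonneg_times (C i)) -> (forall i, measurable (cylinder_set (C i))) ->
  P (\bigcap_(i in `I_n) Y i @^-1` cylinder_set (C i)) =
  (\prod_(i < n) mu (cylinder_set (C i)))%E.

(** Cylinders are replaced by measurable sets one coordinate at a time: in [H k] the coordinates
    from [k] on are still cylinders. With the other coordinates fixed, both sides are finite
    measures of the [k]-th event that agree on measurable cylinders. *)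
Lemma prod_measurable (n : nat) (D : nat -> set (pathT R)) :
  (forall i, measurable (D i)) ->
  P (\bigcap_(i in `I_n) Y i @^-1` D i) = (\prod_(i < n) mu (D i))%E.
Proof.
move=> mD.
pose upd (D : nat -> set (pathT R)) k A i := if i == k then A else D i.
have updE (E : nat -> set (pathT R)) k A : (n <= k)%N ->
    \bigcap_(i in `I_n) Y i @^-1` upd E k A i = \bigcap_(i in `I_n) Y i @^-1` E i /\
    (\prod_(i < n) mu (upd E k A i) = \prod_(i < n) mu (E i))%E.
  move=> nk; split.
    by apply: eq_bigcapr => i /= iN; rewrite /upd ltn_eqF// (leq_trans iN).
  by apply: eq_bigr => i _; rewrite /upd ltn_eqF// (leq_trans (ltn_ord i)).
have H k : forall E : nat -> set (pathT R), (forall i, measurable (E i)) ->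
    (forall i, (k <= i)%N -> exists2 C, nonneg_times C & E i = cylinder_set C) ->
    P (\bigcap_(i in `I_n) Y i @^-1` E i) = (\prod_(i < n) mu (E i))%E.
  elim: k => [|k IH] E mE hE.
    have [C hC] : {C : nat -> cylinder R &
      forall i, nonneg_times (C i) /\ E i = cylinder_set (C i)}.
      apply: (@choice _ _ (fun i C => nonneg_times C /\ E i = cylinder_set C)) => i.
      by have [C C0 EC] := hE i (leq0n i); exists C.
    have -> : E = fun i => cylinder_set (C i) by apply/funext => i; case: (hC i).
    apply: prod_cylinders => i; first by case: (hC i).
    by have [_ <-] := hC i.
  have mupd A : measurable A -> forall i, measurable (upd E k A i).
    by move=> mA i; rewrite /upd; case: eqP.
  have hupd C : nonneg_times C -> measurable (cylinder_set C) ->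
      P (\bigcap_(i in `I_n) Y i @^-1` upd E k (cylinder_set C) i) =
      (\prod_(i < n) mu (upd E k (cylinder_set C) i))%E.
    move=> C0 mC; apply: IH; first exact: mupd.
    move=> i ki; rewrite /upd; case: eqP => [_|/eqP ik]; first by exists C.
    by apply: hE; rewrite ltn_neqAle eq_sym ik.
  have [nk|kn] := leqP n k.
    have triv : nonneg_times (([::], fun=> true) : cylinder R) by [].
    have trivE : cylinder_set (([::], fun=> true) : cylinder R) = setT by apply/seteqP.
    have := hupd _ triv; rewrite trivE => /(_ measurableT).
    by have [-> ->] := updE E k setT nk.
  pose B := \bigcap_(i in [set i | (i < n)%N /\ i != k]) Y i @^-1` E i.
  have mB : measurable B.
    by apply: bigcap_measurableType => i _; exact: mYA.
  have capE A : \bigcap_(i in `I_n) Y i @^-1` upd E k A i = Y k @^-1` A `&` B.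
    apply/seteqP; split => w.
      move=> h; split; first by have := h k kn; rewrite /= /upd eqxx.
      by move=> i [iN ik]; have := h i iN; rewrite /= /upd (negbTE ik).
    move=> [Ak Bw] i iN; rewrite /= /upd; case: eqP => [->//|/eqP ik].
    exact: Bw.
  pose c := (\prod_(i < n | i != Ordinal kn) mu (E i))%E.
  have prodE A : (\prod_(i < n) mu (upd E k A i) = mu A * c)%E.
    rewrite (bigD1 (Ordinal kn))//= /upd eqxx; congr (_ * _)%E.
    apply: eq_bigr => i ik; rewrite ifN//.
  have c0 : (0 <= c)%E by apply: prode_ge0 => i _; exact: measure_ge0.
  have cfin : c \is a fin_num.
    by apply: prode_fin_num => i _; exact: fin_num_measure.
  have [r r0 cr] : exists2 r : R, 0 <= r & c = r%:E.
    by exists (fine c); [exact: fine_ge0 | rewrite fineK].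
  have E_upd : E = upd E k (E k) by apply/funext => i; rewrite /upd; case: eqP => // ->.
  rewrite {1}E_upd capE E_upd prodE /upd eqxx cr muleC.
  apply: (@measure_cylinder_unique R (pushforward (mrestr P mB) (Y k))
    (mscale (NngNum r0) mu)) => //.
  - move=> C C0 mC; have := hupd C C0 mC; rewrite capE prodE cr muleC.
    exact.
  - rewrite /pushforward /mrestr -ge0_fin_numE//; apply: fin_num_measure.
    by rewrite preimage_setT.
pose D' i := if (i < n)%N then D i else setT.
have -> : \bigcap_(i in `I_n) Y i @^-1` D i = \bigcap_(i in `I_n) Y i @^-1` D' i.
  by apply: eq_bigcapr => i /= iN; rewrite /D' iN.
rewrite (H n D').
- by apply: eq_bigr => i _; rewrite /D' ltn_ord.
- by move=> i; rewrite /D'; case: ifP.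
- move=> i ni; rewrite /D' ltnNge ni /=; exists ([::], fun=> true) => //.
  by apply/seteqP.
Qed.

(** Padding with [setT] turns a single index, or any finite set of indices, into an initial
    segment. *)
Lemma iid_from_products : iid_with_law P Y mu.
Proof.
have law n : random_path_with_law P (Y n) mu.
  split => // A mA.
  pose D i := if i == n then A else setT.
  have mD i : measurable (D i) by rewrite /D; case: eqP.
  have := prod_measurable n.+1 mD.
  have -> : \bigcap_(i in `I_n.+1) Y i @^-1` D i = Y n @^-1` A.
    apply/seteqP; split => w; first by move=> /(_ n (ltnSn n)); rewrite /= /D eqxx.
    by move=> Aw i _; rewrite /= /D; case: eqP => [->|].
  rewrite big_ord_recr/= /D eqxx big1 ?mul1e// => i _.
  by rewrite ltn_eqF//= probability_setT.
split => // F C mC.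
pose n := (\max_(i <- F) i).+1.
have Fn i : i \in F -> (i < n)%N.
  by move=> iF; rewrite ltnS (big_rem i) //= leq_maxl.
pose D i := if i \in F then C i else setT.
have mD i : measurable (D i) by rewrite /D; case: ifP.
have := prod_measurable n mD.
have -> : \bigcap_(i in `I_n) Y i @^-1` D i = \bigcap_(i in [set` F]) (Y i @^-1` C i).
  apply/seteqP; split => w h i /= iF.
    by have := h i (Fn i iF); rewrite /= /D iF.
  by rewrite /D; case: ifPn => // iF'; exact: h.
move=> ->; rewrite -(big_mkord predT (fun i => mu (D i))).
rewrite (eq_big_seq (fun i => P (Y i @^-1` D i))) => [|i _]; last first.
  by rewrite (law i).2.
rewrite (bigID (fun i => i \in F))/= [X in (_ * X)%E]big1 ?mule1; last first.
  by move=> i iF; rewrite /D (negbTE iF) preimage_setT probability_setT.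
rewrite -big_filter (perm_big (enum_fset F)); last first.
  apply: uniq_perm; rewrite ?filter_uniq ?iota_uniq ?fset_uniq// => i.
  rewrite mem_filter mem_index_iota /=; apply/andP/idP => [[]//|iF].
  by split => //; exact: Fn.
by apply: eq_big_seq => i iF; rewrite /D iF.
Qed.

End IidFromProducts.

(** * Measurable versions of the excursions *)

Section Assembly.
Variable R : realType.
Implicit Types (C : cylinder R) (Cs : seq (cylinder R)).

Definition trivial_cylinder : cylinder R := ([::], fun=> true).

(** On [G] the test is the lower limit of measurable events and off [G] it is constant; this yields
    measurability even for tests by arbitrary predicates. *)
Lemma measurable_eventually d (T : measurableType d) (G : set T) (E : nat -> set T)
    (Q : T -> bool) (b : bool) : measurable G -> (forall m, measurable (E m)) ->
  (forall w, G w -> exists m0, forall m, (m0 <= m)%N -> (E m w <-> Q w)) ->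
  (forall w, ~ G w -> Q w = b) -> measurable [set w | Q w].
Proof.
move=> mG mE EQ Qb.
rewrite (_ : [set w | Q w] = (G `&` [set w | exists m0, forall m, (m0 <= m)%N -> E m w])
    `|` (if b then ~` G else set0)).
  apply: measurableU; last by case: b {Qb} => //; exact: measurableC.
  by apply: measurableI => //; exact: measurable_liminf_set.
apply/seteqP; split => w /=.
  move=> Qw; have [Gw|nGw] := pselect (G w).
    have [m0 hm] := EQ w Gw; left; split => //; exists m0 => m mm.
    by apply/(hm m mm).
  by right; rewrite -(Qb w nGw) Qw.
case=> [[Gw [m0 hm]]|].
  by have [m1 hm1] := EQ w Gw; apply/(hm1 (maxn m0 m1) (leq_maxr _ _))/hm; exact: leq_maxl.
by case: b Qb => // Qb nGw; rewrite Qb.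
Qed.

Lemma prob_setI_full d (T : measurableType d) (P : probability T R) (G A : set T) :
  measurable G -> measurable A -> P (~` G) = 0%E -> P (A `&` G) = P A.
Proof.
move=> mG mA G0; have mGC : measurable (~` G) by exact: measurableC.
rewrite [in RHS](_ : A = (A `&` G) `|` (A `&` ~` G)); last first.
  by rewrite -setIUr setUv setIT.
rewrite measureU0//; [exact: measurableI | exact: measurableI |].
apply: (@subset_measure0 _ _ _ P (A `&` ~` G) (~` G)) => //.
exact: measurableI.
Qed.

Lemma all_zip_iota (f : nat -> R -> R) n Cs :
  all (fun iC => cylinder_test iC.2 (f iC.1)) (zip (iota n (size Cs)) Cs) <->
  forall i, (i < size Cs)%N -> cylinder_test (nth trivial_cylinder Cs i) (f (n + i)%N).
Proof.
elim: Cs n => [|C Cs IH] n //=; split.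
  move=> /andP[h0 /IH h] [|i] iC /=; first by rewrite addn0.
  by rewrite addnS -addSn; exact: h.
move=> h; apply/andP; split; first by have := h 0%N isT; rewrite addn0.
by apply/IH => i iC; have := h i.+1 iC; rewrite addnS -addSn.
Qed.

Variable lam : R.
Context (dJ : measure_display) (TJ : measurableType dJ) (PJ : probability TJ R).
Variables (J : {RV PJ >-> R}) (jstar : nat).
Hypothesis lam_gt0 : 0 < lam.
Hypothesis EJ_gt0 : (0 < 'E_PJ[J])%E.
Hypothesis J_range : {ae PJ, forall w, exists k : int,
  (- jstar%:Z <= k <= 1)%R /\ J w = k%:~R}.

Local Notation p := (@jump_prob R dJ TJ PJ J jstar).
Local Notation eta m := (mesh_step R m).

Section First.
Context (d : measure_display) (T : measurableType d) (P : probability T R).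
Variable X : R -> T -> pmT R.
Hypothesis X_law : order_book lam J P (book_of R [:: 1%N]) X.

Definition first_event C m : set T := [set w | X 0 w = book_of R [:: 1%N]] `&`
  mesh_event X 0 (eta m) (mesh_size m) 0
    (test_excursions 0 [:: mesh_test (eta m) C] (Some [:: 1%N])).

(** [Z] is the zero path off a measurable set of probability 1 on which the path properties hold, so
    its tests are measurable. The rank [m0] depends on the path; Fatou's lemma will turn this
    pathwise limit into one of probabilities. *)
Lemma first_excursion_path : exists Z : T -> pathT R,
  [/\ forall C, nonneg_times C -> measurable [set w | cylinder_test C (Z w)],
      {ae P, forall w, forall t, 0 <= t -> Z w t = stop_at_zero (price_path X w) t} &
      {ae P, forall w, forall C, nonneg_times C ->
        exists m0, forall m, (m0 <= m)%N -> (first_event C m w <-> cylinder_test C (Z w))}].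
Proof.
have good : {ae P, forall w, (X 0 w = book_of R [:: 1%N] /\
    (forall t, 0 <= t -> @natural_books R (X t w)) /\ step_path (price_nat X w)) /\
    (forall s, 0 <= s -> exists2 t, s <= t & (price_nat X w t <= 0)%N)}.
  by apply: filterS2 (ae_paths lam_gt0 J_range X_law)
    (ae_price_down lam_gt0 EJ_gt0 J_range X_law 0%N) => w.
have [G [mG G0 Gw]] := ae_measurable_set good.
pose dn w := next_down 0 (price_nat X w) 0.
pose Z w : pathT R := if pselect (G w) is left _ then
  fun t => (price_nat X w (Num.min t (dn w)))%:R else fun=> 0.
have dnP w : G w -> [/\ 0 < dn w, price_nat X w (dn w) = 0%N,
    price_nat X w 0 = 1%N & forall t, 0 <= t < dn w -> (0 < price_nat X w t)%N].
  move=> /Gw[[X0 [Xn Fs]] Fd].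
  have [h1 h2 h3] := next_downP Fs Fd (lexx 0).
  have F0 : price_nat X w 0 = 1%N by rewrite (price_natE X0) /top big_seq1.
  have Fd0 : price_nat X w (dn w) = 0%N by apply/eqP; rewrite -leqn0.
  split => //; rewrite lt_neqAle h1 andbT; apply/eqP => d0.
  by move: Fd0; rewrite -d0 F0.
have lim w : G w -> forall C, nonneg_times C ->
    exists m0, forall m, (m0 <= m)%N -> (first_event C m w <-> cylinder_test C (Z w)).
  move=> GG C C0; have [d0 Fd F0 Fpos] := dnP w GG.
  have [[X0 [Xn Fs]] _] := Gw w GG.
  have [m0 h] := first_excursion_limit Fs d0 Fpos Fd F0 C0; exists m0 => m mm.
  rewrite /Z; case: pselect => // _; rewrite -(h m mm) /first_event.
  have E : [seq price_nat X w (0 + i%:R * eta m) | i <- iota 1 (mesh_size m)] =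
     [seq price_nat X w (i%:R * eta m) | i <- iota 1 (mesh_size m)].
    by apply: eq_map => i; rewrite add0r.
  rewrite -E; split => [[_] |h1].
    by move/(mesh_event_price _ _ (lexx 0) (ltW (mesh_step_gt0 R m)) Xn).
  by split => //; apply/mesh_event_price => //; exact: ltW (mesh_step_gt0 R m).
exists Z; split.
- move=> C C0; apply: (@measurable_eventually _ _ G (first_event C) _
    (cylinder_test C (fun=> 0))) => //.
  + by move=> m; apply: (measurable_mesh_part X_law).
  + by move=> w GG; exact: lim.
  + by move=> w nG; rewrite /Z; case: pselect.
- exists (~` G); split => //; first exact: measurableC.
  move=> w /= nZ GG; apply: nZ => t t0.
  have [d0 Fd F0 Fpos] := dnP w GG; have [[X0 [Xn Fs]] _] := Gw w GG.
  have fF u : 0 <= u -> price_path X w u = (price_nat X w u)%:R.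
    by move=> u0; have [s Xs] := Xn u u0; rewrite (price_natE Xs) /price_path Xs price_book.
  have zE : zeta (price_path X w) = (dn w)%:E.
    apply/le_anti/andP; split.
      by apply: ereal_inf_lbound; exists (dn w) => //; split => //; rewrite fF ?Fd// ltW.
    apply: le_ereal_inf_tmp => _ [u [u0 fu] <-]; rewrite lee_fin leNgt; apply/negP => ud.
    have := Fpos u; rewrite (ltW u0) ud => /(_ isT).
    by move: fu; rewrite fF ?(ltW u0)// => /eqP; rewrite pnatr_eq0 => /eqP ->.
  rewrite /Z /stop_at_zero zE; case: pselect => // _.
  by rewrite -EFin_min /= fF// le_min t0 ltW.
- exists (~` G); split => //; first exact: measurableC.
  by move=> w /= nl GG; apply: nl => C C0; exact: lim.
Qed.

End First.

(** Only disjointness holds: both tests fail on a list that ends before the excursion does. *)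
Lemma test_excursionsC C q l (h : R) :
  ~~ (test_excursions 0 [:: mesh_test h C] q l &&
      test_excursions 0 [:: mesh_test h (cylinder_compl C)] q l).
Proof.
elim: l q => [//|x l IH] [q|] /=; last exact: IH.
case: ifP => _; last exact: IH.
by rewrite !test_excursions_nil !andbT /mesh_test /=; case: (C.2 _).
Qed.

Local Notation qprob m C :=
  (first_excursion_prob lam (eta m) p (mesh_size m) (mesh_test (eta m) C)).

Section FirstLaw.
Context (d : measure_display) (T : measurableType d) (P : probability T R).
Variable X : R -> T -> pmT R.
Hypothesis X_law : order_book lam J P (book_of R [:: 1%N]) X.
Variable Z : T -> pathT R.
Hypothesis mZ : forall C, nonneg_times C -> measurable [set w | cylinder_test C (Z w)].
Hypothesis Z_limit : {ae P, forall w, forall C, nonneg_times C ->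
  exists m0, forall m, (m0 <= m)%N -> (first_event X C m w <-> cylinder_test C (Z w))}.

Definition cylinder_prob C : R := fine (P [set w | cylinder_test C (Z w)]).

Lemma cylinder_probE C : nonneg_times C ->
  P [set w | cylinder_test C (Z w)] = (cylinder_prob C)%:E.
Proof. by move=> C0; rewrite fineK// fin_num_measure//; exact: mZ. Qed.

Lemma cylinder_prob_compl C : nonneg_times C ->
  cylinder_prob (cylinder_compl C) = 1 - cylinder_prob C.
Proof.
move=> C0; apply: EFin_inj; rewrite EFinB -!cylinder_probE//.
rewrite -probability_setC; last exact: mZ.
by congr (P _); apply/seteqP; split => w h; exact/negP.
Qed.

Lemma cylinder_prob_itv C : nonneg_times C -> 0 <= cylinder_prob C <= 1.
Proof.
move=> C0; rewrite -!lee_fin -cylinder_probE// measure_ge0 /=.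
by apply: probability_le1; exact: mZ.
Qed.

(** Fatou's lemma bounds the probabilities of the chain from below only, so it is applied to the
    complement of [C], whose chain probability is eventually at least [1 - cylinder_prob C - eps].
    As the two tests are disjoint, this bounds that of [C] from above. *)
Lemma first_excursion_prob_le C (eps : R) : nonneg_times C -> 0 < eps ->
  exists m0, forall m, (m0 <= m)%N -> qprob m C <= cylinder_prob C + eps.
Proof.
move=> C0 e0; have e20 : 0 < eps / 2 by rewrite divr_gt0.
have C0' : nonneg_times (cylinder_compl C) by [].
have [G [mG G0 Gw]] := ae_measurable_set Z_limit.
pose A := [set w | cylinder_test (cylinder_compl C) (Z w)].
have mA : measurable A by exact: mZ.
have mE m : measurable (first_event X (cylinder_compl C) m).
  exact: (measurable_mesh_part X_law).
have AE w : (A `&` G) w -> exists m0, forall m, (m0 <= m)%N -> first_event X (cylinder_compl C) m w.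
  move=> [Aw GG]; have [m0 hm] := Gw w GG _ C0'; exists m0 => m mm.
  by apply/(hm m mm).
have [m1 h1] := prob_liminf_le P (measurableI _ _ mA mG) mE e20 AE.
have [m2 h2] := @prob_mesh_le _ lam _ _ _ _ jstar lam_gt0 J_range _ _ P _ _ X_law 0 [:: 1%N]
  (fun m => test_excursions 0 [:: mesh_test (eta m) (cylinder_compl C)] (Some [:: 1%N]))
  _ (lexx 0) e20.
have [m3 h3] := small_mesh lam_gt0.
exists (maxn (maxn m1 m2) m3) => m; rewrite !geq_max => /andP[/andP[/h1 P1 /h2 P2] /h3 lh].
have PA : P (A `&` G) = (1 - cylinder_prob C)%:E.
  by rewrite prob_setI_full// cylinder_probE// cylinder_prob_compl.
have := le_trans P1 (leeD2r (eps / 2)%:E P2).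
rewrite PA -EFinD lee_fin -addrA -splitr.
have := @euler_prob_disjoint R lam (eta m) _ p (ltW lam_gt0) (ltW (mesh_step_gt0 _ _)) lh
  (@jump_prob_ge0 _ _ _ _ _ _) (sum_jump_prob J_range) (mesh_size m) _ _ [:: 1%N]
  (test_excursionsC C (Some [:: 1%N]) ^~ (eta m)).
by rewrite /first_excursion_prob; lra.
Qed.

Lemma prod_first_excursion_prob_le Cs (eps : R) : all (@nonneg_times R) Cs -> 0 < eps ->
  exists m0, forall m, (m0 <= m)%N ->
    \prod_(C <- Cs) qprob m C <= \prod_(C <- Cs) cylinder_prob C + eps.
Proof.
elim: Cs eps => [|C Cs IH] eps.
  by move=> _ e0; exists 0%N => m _; rewrite !big_nil lerDl ltW.
move=> /= /andP[C0 Cs0] e0; have e20 : 0 < eps / 2 by rewrite divr_gt0.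
have [m1 h1] := IH _ Cs0 e20; have [m2 h2] := first_excursion_prob_le C0 e20.
have [m3 h3] := small_mesh lam_gt0.
exists (maxn (maxn m1 m2) m3) => m; rewrite !geq_max => /andP[/andP[/h1 Q1 /h2 Q2] /h3 lh].
have q01 C' : 0 <= qprob m C' <= 1.
  have l0 := ltW lam_gt0; have hh := ltW (mesh_step_gt0 R m).
  have pp := @jump_prob_ge0 _ _ _ _ J jstar; have p1 := sum_jump_prob J_range.
  by rewrite /first_excursion_prob euler_prob_ge0// euler_prob_le1.
rewrite !big_cons; set Q := \prod_(C0 <- Cs) _ in Q1 *.
set M := \prod_(C0 <- Cs) cylinder_prob C0 in Q1 *.
have Q0 : 0 <= Q by apply: prodr_ge0 => C' _; case/andP: (q01 C').
have Q1' : Q <= 1 by apply: Num.Theory.prodr_ile1 => C' _; exact: q01.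
have /andP[mu0 mu1] := cylinder_prob_itv C0.
set x := qprob m C in Q2 *; set mu := cylinder_prob C in Q2 mu0 mu1 *.
apply: (@le_trans _ _ ((mu + eps / 2) * Q)); first by rewrite ler_wpM2r.
rewrite mulrDl [eps in leRHS]splitr addrA; apply: lerD; last by rewrite ler_piMr// ltW.
apply: (@le_trans _ _ (mu * (M + eps / 2))); first by rewrite ler_wpM2l.
by rewrite mulrDr lerD2l ler_piMl// ltW.
Qed.

End FirstLaw.

Section Successive.
Context (d : measure_display) (T : measurableType d) (P : probability T R).
Variables (a : nat) (X : R -> T -> pmT R).
Hypothesis X_law : order_book lam J P (book_of R [::]) X.

Definition excursions_event Cs m : set T := [set w | X 0 w = book_of R [::]] `&`
  mesh_event X 0 (eta m) (mesh_size m) 0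
    (test_excursions a [seq mesh_test (eta m) C | C <- Cs] None).

Lemma excursion_paths : exists e : nat -> T -> pathT R,
  [/\ forall n C, nonneg_times C -> measurable [set w | cylinder_test C (e n w)],
      {ae P, forall w, successive_excursions (price_path X w) a%:R (e ^~ w)} &
      {ae P, forall w, forall Cs, all (@nonneg_times R) Cs ->
        exists m0, forall m, (m0 <= m)%N -> (excursions_event Cs m w <->
          forall i, (i < size Cs)%N -> cylinder_test (nth trivial_cylinder Cs i) (e i w))}].
Proof.
have good : {ae P, forall w, [/\ X 0 w = book_of R [::] /\
    (forall t, 0 <= t -> @natural_books R (X t w)) /\ step_path (price_nat X w),
    forall s, 0 <= s -> exists2 t, s <= t & (a < price_nat X w t)%N,
    forall s, 0 <= s -> exists2 t, s <= t & (price_nat X w t <= a)%N &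
    forall (t e : R) n, 0 < e <= t ->
    (forall s, t - e < s < t -> price_nat X w s = n) -> (n <= (price_nat X w t).+1)%N]}.
  have ng : no_gap [::] by move=> k; rewrite /top big_nil; lia.
  have h1 := ae_paths lam_gt0 J_range X_law.
  have h2 := ae_price_up lam_gt0 EJ_gt0 J_range X_law a.
  have h3 := ae_price_down lam_gt0 EJ_gt0 J_range X_law a.
  have h4 := ae_price_jump lam_gt0 J_range X_law ng.
  by apply: filterS2 (filterI h1 h2) (filterI h3 h4) => w [? ?] [? ?].
have [G [mG G0 Gw]] := ae_measurable_set good.
pose e n w : pathT R := if pselect (G w) is left _ then
  excursion_path a (price_nat X w) n else fun=> 0.
have F0 w : G w -> (price_nat X w 0 <= a)%N.
  by move=> /Gw[[X0 _] _ _ _]; rewrite (price_natE X0) /top big_nil.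
have lim w : G w -> forall Cs, all (@nonneg_times R) Cs ->
    exists m0, forall m, (m0 <= m)%N -> (excursions_event Cs m w <->
      forall i, (i < size Cs)%N -> cylinder_test (nth trivial_cylinder Cs i) (e i w)).
  move=> GG Cs Cs0; have [[X0 [Xn Fs]] Fu Fd Fj] := Gw w GG.
  have [m0 h] := excursions_limit Fs Fu Fd (F0 w GG) Fj Cs0; exists m0 => m mm.
  have E : [seq price_nat X w (0 + i%:R * eta m) | i <- iota 1 (mesh_size m)] =
     [seq price_nat X w (i%:R * eta m) | i <- iota 1 (mesh_size m)].
    by apply: eq_map => i; rewrite add0r.
  have -> : (forall i, (i < size Cs)%N -> cylinder_test (nth trivial_cylinder Cs i) (e i w)) <->
     test_excursions a [seq mesh_test (eta m) C | C <- Cs] None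
      [seq price_nat X w (i%:R * eta m) | i <- iota 1 (mesh_size m)].
    rewrite (h m mm) all_zip_iota; split => H i iC; have := H i iC;
      by rewrite /e; case: pselect.
  rewrite -E; split => [[_] |h1].
    by move/(mesh_event_price _ _ (lexx 0) (ltW (mesh_step_gt0 R m)) Xn).
  by split => //; apply/mesh_event_price => //; exact: ltW (mesh_step_gt0 R m).
exists e; split.
(* Trivial tests on the first [n] excursions isolate the next one. *)
- move=> n C C0; pose Cs := rcons (nseq n trivial_cylinder) C.
  have Cs0 : all (@nonneg_times R) Cs by rewrite all_rcons C0 all_nseq orbT.
  apply: (@measurable_eventually _ _ G (excursions_event Cs) _ (cylinder_test C (fun=> 0))) => //.
  + by move=> m; apply: (measurable_mesh_part X_law).
  + move=> w GG; have [m0 h] := lim w GG Cs Cs0; exists m0 => m mm.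
    apply: (iff_trans (h m mm)); rewrite /Cs size_rcons size_nseq; split => [H|H i].
      by have := H n (ltnSn n); rewrite nth_rcons size_nseq ltnn eqxx.
    rewrite ltnS leq_eqVlt nth_rcons size_nseq => /predU1P[->|ni].
      by rewrite ltnn eqxx.
    by rewrite ni nth_nseq ni.
  + by move=> w nG; rewrite /e; case: pselect.
- exists (~` G); split => //; first exact: measurableC.
  move=> w /= ns GG; apply: ns.
  have [[X0 [Xn Fs]] Fu Fd Fj] := Gw w GG.
  rewrite (_ : e ^~ w = excursion_path a (price_nat X w)); last first.
    by apply/funext => n; rewrite /e; case: pselect.
  apply: successive_excursions_path => //; first exact: F0.
  by move=> t t0; have [s Xs] := Xn t t0; rewrite (price_natE Xs) /price_path Xs price_book.
- exists (~` G); split => //; first exact: measurableC.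
  by move=> w /= nl GG; apply: nl => Cs Cs0; exact: lim.
Qed.

End Successive.

End Assembly.

(** * The joint law of the excursions *)

Section ProductLaw.
Context (R : realType) (lam : R).
Context (dJ : measure_display) (TJ : measurableType dJ) (PJ : probability TJ R).
Variables (J : {RV PJ >-> R}) (jstar a : nat).
Hypothesis lam_gt0 : 0 < lam.
Hypothesis J_range : {ae PJ, forall w, exists k : int,
  (- jstar%:Z <= k <= 1)%R /\ J w = k%:~R}.
Context (d : measure_display) (T : measurableType d) (P : probability T R).
Variable X : R -> T -> pmT R.
Hypothesis X_law : order_book lam J P (book_of R [::]) X.
Context (d1 : measure_display) (T1 : measurableType d1) (P1 : probability T1 R).
Variable X1 : R -> T1 -> pmT R.
Hypothesis X1_law : order_book lam J P1 (book_of R [:: 1%N]) X1.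
Variables (Z : T1 -> pathT R) (e : nat -> T -> pathT R).
Hypothesis mZ : forall C, nonneg_times C -> measurable [set w | cylinder_test C (Z w)].
Hypothesis Z_limit : {ae P1, forall w, forall C, nonneg_times C ->
  exists m0, forall m, (m0 <= m)%N -> (first_event X1 C m w <-> cylinder_test C (Z w))}.
Hypothesis me : forall n C, nonneg_times C -> measurable [set w | cylinder_test C (e n w)].
Hypothesis e_limit : {ae P, forall w, forall Cs, all (@nonneg_times R) Cs ->
  exists m0, forall m, (m0 <= m)%N -> (excursions_event a X Cs m w <->
    forall i, (i < size Cs)%N -> cylinder_test (nth (trivial_cylinder R) Cs i) (e i w))}.
Implicit Types (C : cylinder R) (Cs : seq (cylinder R)).

Local Notation mu := (cylinder_prob P1 Z).

Definition excursions_in Cs : set T := [set w | forall i, (i < size Cs)%N ->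
  cylinder_test (nth (trivial_cylinder R) Cs i) (e i w)].

Lemma measurable_excursions_in Cs : all (@nonneg_times R) Cs -> measurable (excursions_in Cs).
Proof.
move=> Cs0.
rewrite (_ : excursions_in Cs = \bigcap_(i in `I_(size Cs))
  [set w | cylinder_test (nth (trivial_cylinder R) Cs i) (e i w)])//.
by apply: bigcap_measurableType => i iC; apply: me; apply: (all_nthP _ Cs0).
Qed.

(** The three thirds of [eps] pay for Fatou's lemma, for the passage from the book to the chain, and
    for the limit of the product. *)
Lemma excursions_in_le Cs : all (@nonneg_times R) Cs ->
  (P (excursions_in Cs) <= (\prod_(C <- Cs) mu C)%:E)%E.
Proof.
move=> Cs0; apply/lee_addgt0Pr => eps e0.
have e30 : 0 < eps / 3 by rewrite divr_gt0.
have [G [mG G0 Gw]] := ae_measurable_set e_limit.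
have mE := measurable_excursions_in Cs0.
have mEm m : measurable (excursions_event a X Cs m).
  exact: (measurable_mesh_part X_law).
have AE w : (excursions_in Cs `&` G) w ->
    exists m0, forall m, (m0 <= m)%N -> excursions_event a X Cs m w.
  move=> [Aw GG]; have [m0 h] := Gw w GG _ Cs0; exists m0 => m mm.
  by apply/(h m mm).
have [m1 h1] := prob_liminf_le P (measurableI _ _ mE mG) mEm e30 AE.
have [m2 h2] := @prob_mesh_le _ lam _ _ _ _ jstar lam_gt0 J_range _ _ P _ _ X_law 0 [::]
  (fun m => test_excursions a [seq mesh_test (mesh_step R m) C | C <- Cs] None) _ (lexx 0) e30.
have [m3 h3] := small_mesh lam_gt0.
have [m4 h4] := prod_first_excursion_prob_le lam_gt0 J_range X1_law mZ Z_limit Cs0 e30.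
pose m := maxn (maxn m1 m2) (maxn m3 m4).
have Q1 := h1 m (leq_trans (leq_maxl _ _) (leq_maxl _ _)).
have Q2 := h2 m (leq_trans (leq_maxr _ _) (leq_maxl _ _)).
have lh := h3 m (leq_trans (leq_maxl _ _) (leq_maxr _ _)).
have Q4 := h4 m (leq_trans (leq_maxr _ _) (leq_maxr _ _)).
rewrite -(prob_setI_full mG mE G0); apply: le_trans Q1 _.
apply: le_trans (leeD2r (eps / 3)%:E Q2) _; rewrite -!EFinD lee_fin.
have t0 : (top [::] <= a)%N by rewrite /top big_nil.
have := (@euler_prob_excursions R lam (mesh_step R m) _ _ (ltW lam_gt0)
  (ltW (mesh_step_gt0 _ _)) lh (@jump_prob_ge0 _ _ _ _ J jstar) (sum_jump_prob J_range)
  a (mesh_size m)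
  [seq mesh_test (mesh_step R m) C | C <- Cs] [::]).1 t0.
by rewrite big_map; move: Q4; lra.
Qed.

(** The upper bound holds with [C] and with its complement in last place. The two bounds add up to
    the product for [Cs], which by induction is the sum of the two probabilities, so neither
    inequality is strict. *)
Lemma excursions_in_eq Cs : all (@nonneg_times R) Cs ->
  P (excursions_in Cs) = (\prod_(C <- Cs) mu C)%:E.
Proof.
elim/last_ind: Cs => [_|Cs C IH].
  rewrite big_nil (_ : excursions_in [::] = setT) ?probability_setT//.
  by apply/seteqP.
rewrite all_rcons => /andP[C0 Cs0].
have C0' : nonneg_times (cylinder_compl C) by [].
have inE D : excursions_in (rcons Cs D) =
    excursions_in Cs `&` [set w | cylinder_test D (e (size Cs) w)].
  apply/seteqP; split => w; rewrite /excursions_in /= size_rcons.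
    move=> h; split => [i iC|]; first by have := h i (ltnW iC); rewrite nth_rcons iC.
    by have := h (size Cs) (ltnSn _); rewrite nth_rcons ltnn eqxx.
  move=> [h1 h2] i; rewrite ltnS leq_eqVlt nth_rcons => /predU1P[->|iC].
    by rewrite ltnn eqxx.
  by rewrite iC; exact: h1.
have Cs1 : all (@nonneg_times R) (rcons Cs C) by rewrite all_rcons C0.
have Cs2 : all (@nonneg_times R) (rcons Cs (cylinder_compl C)) by rewrite all_rcons C0'.
have le1 := excursions_in_le Cs1; have le2 := excursions_in_le Cs2.
have m1 := measurable_excursions_in Cs1; have m2 := measurable_excursions_in Cs2.
have split : P (excursions_in Cs) =
    (P (excursions_in (rcons Cs C)) + P (excursions_in (rcons Cs (cylinder_compl C))))%E.
  rewrite -measureU//.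
    congr (P _); rewrite !inE -setIUr; apply/seteqP; split => w; last by case.
    by move=> h; split => //; have [h1|h1] := boolP (cylinder_test C (e (size Cs) w)); [left|right].
  apply/seteqP; split => // w; rewrite !inE => -[[_ h1] [_]] /=.
  by move/negP; exact.
have prodE D : \prod_(C' <- rcons Cs D) mu C' = (\prod_(C' <- Cs) mu C') * mu D.
  by rewrite -cats1 big_cat big_seq1.
move: split le1 le2; rewrite IH// !prodE.
have f1 : P (excursions_in (rcons Cs C)) \is a fin_num by exact: fin_num_measure.
have f2 : P (excursions_in (rcons Cs (cylinder_compl C))) \is a fin_num by exact: fin_num_measure.
rewrite -(fineK f1) -(fineK f2) -EFinD !lee_fin => -[].
rewrite (cylinder_prob_compl P1 mZ C0) => h1 h2 h3; congr (_%:E).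
by apply/le_anti/andP; split; lra.
Qed.

End ProductLaw.

Unset Implicit Arguments.
Set Strict Implicit.
Set Printing Implicit Defensive.

Theorem lemma2p3 (R : realType) (lam : R)
    (dJ : measure_display) (TJ : measurableType dJ) (PJ : probability TJ R)
    (J : {RV PJ >-> R}) (jstar : nat) (a : nat)
    (d : measure_display) (T : measurableType d) (P : probability T R)
    (X : R -> T -> pmT R)
    (d1 : measure_display) (T1 : measurableType d1) (P1 : probability T1 R)
    (X1 : R -> T1 -> pmT R)
    (lam_gt0 : 0 < lam)
    (EJ_gt0 : (0 < 'E_PJ[J])%E)
    (J_range : {ae PJ, forall w, exists k : int,
       (- jstar%:Z <= k <= 1)%R /\ J w = k%:~R})
    (X_law : order_book lam J P mset0 X)
    (X1_law : order_book lam J P1 (msetn 1%N 1%:nng) X1) :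
  exists mu : probability (pathT R) R,
    has_law P1 (fun w => stop_at_zero (price_path X1 w)) mu /\
    exists e : nat -> T -> pathT R,
      {ae P, forall w, successive_excursions (price_path X w) a%:R (e ^~ w)} /\
      iid_with_law P e mu.
Proof.
rewrite -book_of_nil in X_law; rewrite -(@book_of1 R 1)// in X1_law.
have [Z [mZ Zpath Zlim]] := first_excursion_path lam_gt0 EJ_gt0 J_range X1_law.
have [e [me epath elim]] := excursion_paths lam_gt0 EJ_gt0 J_range a X_law.
have mZ' : measurable_fun setT Z by exact: measurable_random_path.
have me' n : measurable_fun setT (e n) by apply: measurable_random_path => C; exact: me.
(* The common law is that of the measurable version [Z], which almost surely agrees with the stopped
   price path at nonnegative times. *)
pose Zm : {mfun T1 >-> pathT R} := mfun_Sub (mem_set mZ').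
exists (distribution P1 Zm); split.
  exists Z; split; last by split.
  by apply: filterS Zpath => w h t t0; exact: h.
exists e; split => //; apply: iid_from_products => // n C C0 mC.
have Cs0 : all (@nonneg_times R) (mkseq C n) by apply/allP => D /mapP[i _ ->]; exact: C0.
have := excursions_in_eq lam_gt0 J_range X_law X1_law mZ Zlim me elim Cs0.
have -> : excursions_in e (mkseq C n) = \bigcap_(i in `I_n) e i @^-1` cylinder_set (C i).
  rewrite /excursions_in size_mkseq; apply/seteqP; split => w h i iN;
    by have := h i iN; rewrite nth_mkseq.
move=> ->; rewrite big_map -{1}[n]subn0 -/(index_iota 0 n) big_mkord -prodEFin.
by apply: eq_bigr => i _; rewrite -(cylinder_probE P1 mZ (C0 i)).
Qed.
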